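(* Let $X$ be a complex Banach space with type $p\in[1,2]$ and cotype $q\in[2,\infty]$. Let $\phi\in(0,\pi)$ and let $A$ be a sectorial operator on $X$ with a bounded $H^\infty$-calculus of angle $<\phi$ (i.e. of some angle $\sigma<\phi$). Fix a nonzero $f\in H^\infty_0(\Sigma_\phi)$. Then there is a constant $C$ such that for all $x\in X$, $$\|t\mapsto f(tA)x\|_{L^q(\mathbb{R}_+,\frac{dt}{t};X)}\le C\|x\|\quad\text{and}\quad\|x\|\le C\|t\mapsto f(tA)x\|_{L^p(\mathbb{R}_+,\frac{dt}{t};X)},$$ where the second estimate holds whenever its right-hand side is finite.
   Context: $\Sigma_\sigma=\{z\in\mathbb{C}\setminus\{0\}:|\arg z|<\sigma\}$. Sectorial: for $\sigma\in(0,\pi)$, a linear operator $(A,D(A))$ on $X$ is sectorial of type $\sigma$ if $D(A)$ is dense in $X$, $A$ is injective and has dense range, $\sigma(A)\subseteq\overline{\Sigma_\sigma}$, and for every $\sigma'\in(\sigma,\pi)$ the set $\{z(z-A)^{-1}:z\in\mathbb{C}\setminus\{0\},|\arg(z)|>\sigma'\}$ is uniformly bounded. $H^\infty(\Sigma_\sigma)$ is the space of bounded holomorphic functions on $\Sigma_\sigma$ with the supremum norm. $v\in H^\infty_0(\Sigma_\sigma)$ means $v\in H^\infty(\Sigma_\sigma)$ and there is $\varepsilon>0$ with $|v(z)|\le\frac{|z|^\varepsilon}{1+|z|^{2\varepsilon}}$ for $z\in\Sigma_\sigma$. For $A$ sectorial of angle $<\sigma$ and $v\in H^\infty_0(\Sigma_\sigma)$,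 $v(tA)$ ($t>0$) is defined by the Dunford calculus, $v(tA)=\frac1{2\pi i}\int_{\partial\Sigma_\nu}v(tz)(z-A)^{-1}\,dz$ with $\nu<\sigma$ larger than the sectoriality angle of $A$. $A$ has a bounded $H^\infty$-calculus of angle $\sigma$ if there is a constant $C$ with $\|v(A)x\|\le C\|v\|_\infty\|x\|$ for all $v\in H^\infty_0(\Sigma_\sigma)$ and $x\in X$. Type $p$: there is $\tau$ with $(\mathbb{E}\|\sum_{n\le N}\varepsilon_nx_n\|^p)^{1/p}\le\tau(\sum_{n\le N}\|x_n\|^p)^{1/p}$ for all finite families in $X$. Cotype $q$: there is $c$ with $(\sum_{n\le N}\|x_n\|^q)^{1/q}\le c(\mathbb{E}\|\sum_{n\le N}\varepsilon_nx_n\|^q)^{1/q}$ for all finite families (obvious modification for $q=\infty$). Here $(\varepsilon_n)$ are i.i.d. with $\mathbb{P}(\varepsilon_n=\pm1)=\frac12$. *)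

(* Defs.v *)
From Stdlib Require Import Reals.
From HB Require Import structures.
From mathcomp Require Import all_boot all_order all_algebra.
From mathcomp Require Import all_classical all_reals all_analysis.
From mathcomp Require Import measurable_realfun Rstruct Rstruct_topology.
From Coquelicot Require Import Coquelicot.

Set Implicit Arguments.
Unset Strict Implicit.
Unset Printing Implicit Defensive.

(* Banach spaces, complex derivatives and vector-valued integrals are those of
   Coquelicot; measures, Lebesgue integrals and L^q norms are those of
   MathComp-Analysis, over the realType instance of Stdlib's R.  Trigonometric
   functions are Stdlib's. *)

Section haar_measure.
Import Order.TTheory GRing.Theory Num.Theory.
Local Open Scope classical_set_scope.
Local Open Scope ring_scope.
Local Open Scope ereal_scope.

Definition dt_over_t {R : realType} (A : set (measurableTypeR R)) : \bar R :=
  \int[lebesgue_measure]_(t in A `&` `]0%R, +oo[) (t^-1)%:E.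

Context {R : realType}.
Local Notation nu := (@dt_over_t R).

Let inv_ge0 (A : set R) (t : R) : (A `&` `]0%R, +oo[) t -> 0 <= (t^-1)%:E.
Proof.
by move=> [_] /=; rewrite in_itv/= andbT => t0; rewrite lee_fin invr_ge0 ltW.
Qed.

Let dt_over_t0 : nu set0 = 0.
Proof. by rewrite /dt_over_t set0I integral_set0. Qed.

Let dt_over_t_ge0 A : 0 <= nu A.
Proof. by apply: integral_ge0 => t /inv_ge0. Qed.

Let dt_over_t_sigma_additive : semi_sigma_additive nu.
Proof.
move=> /= F mF tF mUF; rewrite /dt_over_t setI_bigcupl.
rewrite ge0_integral_bigcup//=.
- apply: is_cvg_ereal_nneg_natsum_cond => n _ _.
  by apply: integral_ge0 => t /inv_ge0.
- by move=> k; exact: measurableI.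
- have mV : measurable_fun (`]0%R, +oo[ : set R) (fun t : R => (t^-1)%R).
    apply: open_continuous_measurable_fun; first exact: interval_open.
    move=> t; rewrite inE/= in_itv/= andbT => t0.
    by apply: inv_continuous; rewrite gt_eqF.
  apply/measurable_EFinP; apply: measurable_funS mV => //.
  by rewrite -setI_bigcupl; exact: subIsetr.
- by move=> t; rewrite -setI_bigcupl => /inv_ge0.
- exact: trivIset_setIr.
Qed.

HB.instance Definition _ := isMeasure.Build _ _ _ nu
  dt_over_t0 dt_over_t_ge0 dt_over_t_sigma_additive.

End haar_measure.

Local Open Scope R_scope.

(** [F] is a function on (0,+oo), extended by 0 where [dt_over_t] vanishes; for
    [q = +oo], [Lnorm] is the essential supremum. *)
Definition Lq_dt_over_t (X : NormedModule C_AbsRing) (q : \bar R) (F : R -> X)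
  : \bar R :=
  Lnorm (@dt_over_t R) q
    (fun t => EFin (if Rlt_dec 0 t then norm (F t) else 0)).

Definition simple_function (X : Type) (s : R -> X) : Prop :=
  finite_set (range s) /\
  forall y : X,
    measurable (preimage s (set1 y) : set (measurableTypeR R)).

Definition strongly_measurable_Rplus (X : NormedModule C_AbsRing) (F : R -> X)
  : Prop :=
  exists s : nat -> R -> X,
    (forall n, simple_function (s n)) /\
    (forall t, 0 < t -> filterlim (fun n => s n t) eventually (locally (F t))).

(** A sign pattern [e : {ffun 'I_N -> bool}] stands for
    [(eps_1, ..., eps_N) \in {-1,1}^N]; for i.i.d. Rademacher variables all
    [2 ^ N] patterns are equally likely. *)
Definition signed_sum (X : NormedModule C_AbsRing) (N : nat) (x : 'I_N -> X)
    (e : {ffun 'I_N -> bool}) : X :=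
  \big[plus/zero]_(i < N) (if e i then x i else opp (x i)).

Definition rademacher_mean (N : nat) (g : {ffun 'I_N -> bool} -> R) : R :=
  (\big[Rplus/0]_(e : {ffun 'I_N -> bool}) g e) / 2 ^ N.

(** [powR a p] is the real power, with [powR 0 p = 0] for [p <> 0] (unlike
    Stdlib's [Rpower]). *)
Definition lp_norm (X : NormedModule C_AbsRing) (p : R) (N : nat)
    (x : 'I_N -> X) : R :=
  powR (\big[Rplus/0]_(i < N) powR (norm (x i)) p) (/ p).

Definition rademacher_norm (X : NormedModule C_AbsRing) (p : R) (N : nat)
    (x : 'I_N -> X) : R :=
  powR (rademacher_mean (fun e => powR (norm (signed_sum x e)) p)) (/ p).

Definition has_type (X : NormedModule C_AbsRing) (p : R) : Prop :=
  exists tau : R, forall (N : nat) (x : 'I_N -> X),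
    rademacher_norm p x <= tau * lp_norm p x.

Definition has_cotype (X : NormedModule C_AbsRing) (q : \bar R) : Prop :=
  match q with
  | EFin r => exists c : R, forall (N : nat) (x : 'I_N -> X),
      lp_norm r x <= c * rademacher_norm r x
  | EPInf => exists c : R, forall (N : nat) (x : 'I_N -> X),
      \big[Rmax/0]_(i < N) norm (x i) <=
      c * \big[Rmax/0]_(e : {ffun 'I_N -> bool}) norm (signed_sum x e)
  | ENInf => False
  end.

(** The principal argument, with values in (-PI, PI] for [z <> 0]. *)
Definition Carg (z : C) : R :=
  if Rle_dec 0 (Im z) then Ratan.acos (Re z / Cmod z)
  else - Ratan.acos (Re z / Cmod z).

Definition sector (sigma : R) (z : C) : Prop :=
  z <> RtoC 0 /\ Rabs (Carg z) < sigma.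

Definition adherent (T : UniformSpace) (D : T -> Prop) (x : T) : Prop :=
  forall P : T -> Prop, locally x P -> exists y, P y /\ D y.

Definition bounded_holomorphic (sigma : R) (v : C -> C) : Prop :=
  (forall z, sector sigma z ->
     ex_derive (K := C_AbsRing) (V := C_NormedModule) v z) /\
  (exists M : R, forall z, sector sigma z -> Cmod (v z) <= M).

Definition Hinf_norm (sigma : R) (v : C -> C) : R :=
  real (Lub_Rbar (fun r => exists2 z, sector sigma z & r = Cmod (v z))).

(** Stdlib's [Rpower] is only used here at [Cmod z > 0]. *)
Definition Hinf0 (sigma : R) (v : C -> C) : Prop :=
  bounded_holomorphic sigma v /\
  exists2 eps : R, 0 < eps &
    forall z, sector sigma z ->
      Cmod (v z) <= Rpower (Cmod z) eps / (1 + Rpower (Cmod z) (2 * eps)).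

(** Only the values of [op_fun] on [op_dom] are meaningful. *)
Record operator (X : NormedModule C_AbsRing) := Operator {
  op_dom : X -> Prop;
  op_fun :> X -> X;
  op_dom_zero : op_dom zero;
  op_dom_plus : forall x y, op_dom x -> op_dom y -> op_dom (plus x y);
  op_dom_scal : forall (c : C) x, op_dom x -> op_dom (scal c x);
  op_fun_plus : forall x y, op_dom x -> op_dom y ->
    op_fun (plus x y) = plus (op_fun x) (op_fun y);
  op_fun_scal : forall (c : C) x, op_dom x ->
    op_fun (scal c x) = scal c (op_fun x)
}.

(** [T = (z - A)^{-1}] as a bounded operator; boundedness is part of
    Coquelicot's [is_linear]. *)
Definition is_resolvent (X : NormedModule C_AbsRing) (A : operator X) (z : C)
    (T : X -> X) : Prop :=
  is_linear T /\
  (forall x, op_dom A (T x) /\ minus (scal z (T x)) (A (T x)) = x) /\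
  (forall x, op_dom A x -> T (minus (scal z x) (A x)) = x).

Definition spectrum (X : NormedModule C_AbsRing) (A : operator X) (z : C)
  : Prop :=
  ~ exists T : X -> X, is_resolvent A z T.

(** For [z] outside the spectrum, [resolvent A z x] is the unique solution [y]
    of [(z - A) y = x]; otherwise its value is meaningless. *)
Definition resolvent (X : CompleteNormedModule C_AbsRing) (A : operator X)
    (z : C) (x : X) : X :=
  iota (fun y : X => op_dom A y /\ minus (scal z y) (A y) = x).

Definition sectorial (X : CompleteNormedModule C_AbsRing) (A : operator X)
    (sigma : R) : Prop :=
  0 < sigma < PI /\
  (forall x, adherent (op_dom A) x) /\
  (forall x y, op_dom A x -> op_dom A y -> A x = A y -> x = y) /\
  (forall y, adherent (fun y' : X => exists2 x, op_dom A x & y' = A x) y) /\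
  (forall z, spectrum A z -> adherent (sector sigma) z) /\
  (forall sigma', sigma < sigma' < PI ->
     exists M : R, forall z : C, z <> RtoC 0 -> sigma' < Rabs (Carg z) ->
       forall x, norm (scal z (resolvent A z x)) <= M * norm x).

(** Coquelicot only integrates functions with values in real normed modules. *)
Section restriction_of_scalars.
Context (X : CompleteNormedModule C_AbsRing).

Let rscal (a : R) (x : X) : X := scal (RtoC a) x.

Lemma rscal_assoc (a b : R) (x : X) :
  rscal a (rscal b x) = rscal (mult a b) x.
Proof. by rewrite /rscal scal_assoc; congr scal; exact: esym (RtoC_mult a b). Qed.

Lemma rscal_one (x : X) : rscal one x = x.
Proof. exact: (scal_one x). Qed.

Lemma rscal_distr_l (a : R) (x y : X) :
  rscal a (plus x y) = plus (rscal a x) (rscal a y).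
Proof. exact: scal_distr_l. Qed.

Lemma rscal_distr_r (a b : R) (x : X) :
  rscal (plus a b) x = plus (rscal a x) (rscal b x).
Proof.
rewrite /rscal -scal_distr_r; congr scal.
exact: RtoC_plus a b.
Qed.

Definition restr_ModuleSpace_mixin : ModuleSpace.mixin_of R_AbsRing X :=
  @ModuleSpace.Mixin R_AbsRing X rscal
    rscal_assoc rscal_one rscal_distr_l rscal_distr_r.

Definition restr_NormedModuleAux : NormedModuleAux R_AbsRing :=
  NormedModuleAux.Pack R_AbsRing X
    (NormedModuleAux.Class R_AbsRing X
      (ModuleSpace.Class R_AbsRing X (AbelianGroup.class X)
         restr_ModuleSpace_mixin)
      (UniformSpace.class X)) X.

Lemma rscal_norm (a : R_AbsRing) (x : restr_NormedModuleAux) :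
  @norm C_AbsRing X (scal a x) <= abs a * @norm C_AbsRing X x.
Proof.
by have := @norm_scal C_AbsRing X (RtoC a) x; rewrite /abs /= Cmod_R.
Qed.

Definition restr_NormedModule_mixin :
    NormedModule.mixin_of R_AbsRing restr_NormedModuleAux :=
  @NormedModule.Mixin R_AbsRing restr_NormedModuleAux
    (@norm C_AbsRing X) (@norm_factor C_AbsRing X)
    (@norm_triangle C_AbsRing X) rscal_norm
    (@norm_compat1 C_AbsRing X) (@norm_compat2 C_AbsRing X)
    (@norm_eq_zero C_AbsRing X).

Definition restr_scalars : CompleteNormedModule R_AbsRing :=
  CompleteNormedModule.Pack R_AbsRing X
    (CompleteNormedModule.Class R_AbsRing X
      (NormedModule.Class R_AbsRing X _ restr_NormedModule_mixin)
      (CompleteSpace.class X)) X.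

End restriction_of_scalars.

(** The integral of [v(z) (z - A)^{-1} x dz] along the ray
    [z = r e^{i theta}], with [r] running from 0 to +oo. *)
Definition ray_integral (X : CompleteNormedModule C_AbsRing) (A : operator X)
    (theta : R) (v : C -> C) (x : X) : X :=
  let u : C := (Rtrigo_def.cos theta, Rtrigo_def.sin theta) in
  RInt_gen (V := restr_scalars X)
    (fun r : R =>
       scal (Cmult (v (Cmult (RtoC r) u)) u)
            (resolvent A (Cmult (RtoC r) u) x))
    (at_right 0) (Rbar_locally p_infty).

(** [v(A) x], integrating over the boundary of the sector of angle [nu] with
    the sector on its left: in along the upper ray, out along the lower one. *)
Definition dunford (X : CompleteNormedModule C_AbsRing) (A : operator X)
    (nu : R) (v : C -> C) (x : X) : X :=
  scal (Cinv (Cmult (RtoC (2 * PI)) Ci))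
       (minus (ray_integral A (- nu) v x) (ray_integral A nu v x)).

(** The angles allowed in the Dunford calculus of functions on the sector of
    angle [sigma]; such an angle exists iff [A] is sectorial of angle
    [< sigma]. *)
Definition dunford_angle (X : CompleteNormedModule C_AbsRing) (A : operator X)
    (sigma nu : R) : Prop :=
  nu < sigma /\ exists2 omega : R, omega < nu & sectorial A omega.

(** By Cauchy's theorem the choice of [nu] is immaterial. *)
Definition bounded_Hinf_calculus (X : CompleteNormedModule C_AbsRing)
    (A : operator X) (sigma : R) : Prop :=
  exists2 nu : R, dunford_angle A sigma nu &
  exists K : R, forall (v : C -> C) (x : X), Hinf0 sigma v ->
    norm (dunford A nu v x) <= K * Hinf_norm sigma v * norm x.

(* Main.v *)
Require Import Defs.
From HB Require Import structures.
From Stdlib Require Import Reals.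
From mathcomp Require Import all_boot all_order all_algebra.
From mathcomp Require Import all_classical all_reals all_analysis.
From mathcomp Require Import measurable_realfun ess_sup_inf Rstruct Rstruct_topology.
From Stdlib Require Import Reals Lra FunctionalExtensionality Classical.
From Coquelicot Require Import Coquelicot.
Set Implicit Arguments.
Unset Strict Implicit.
Unset Printing Implicit Defensive.
Local Open Scope R_scope.

(** By the H^oo-calculus the sums [\sum_k eps_k f(e^(s+k) A)] are bounded uniformly in
    the signs, since [\sum_k |f(e^(s+k) z)|] is bounded on the sector.  Averaging over
    the signs, cotype [q] gives [\sum_k |f(e^(s+k) A) x|^q <= (C |x|)^q], and integrating
    over [s] in [0, 1] yields the first estimate.

    For the second, let [g] be a multiple of a high power of [z / (z + b)^2].  It peaks
    at [b], so for suitable [b] it can be normalized by [\int g f dt/t = 1]; by Cauchy's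
    theorem the same holds on every ray of the sector, and for small [l] the Riemann sums
    [l \sum_k (g f)(e^(kl) z)] are close to [1].  Hence [x] is, up to a small error,
    [l \sum_k g(e^(kl) A) f(e^(kl) A) x], the expectation of
    [l (\sum_k eps_k g(e^(kl) A)) (\sum_j eps_j f(e^(jl) A) x)].  The first factor is
    bounded by the calculus and type [p] controls the second.

    Contours are straight lines in the logarithmic coordinate [w = ln z]; multiplicativity
    of the calculus is only needed when one factor is rational, where it follows from the
    resolvent identity. *)

(** * Linear arithmetic in complex modules *)

(** Reproducing [x] rests on a product formula [g(tA) f(tA) = (g f)(tA)]. For two general functions
    it is a double contour integral; for [g] rational with its pole on the negative axis, [g(tA)] is
    a polynomial in one resolvent and the formula becomes algebra under the integral sign. Two
    obstacles remain. The functions [1] and [1 - l \sum_k (g f)(e^(kl) z)] do not tend to 0 at 0 and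
    infinity, as [H^oo_0] requires, and a finite sum is close to [1] only for [|z|] in a bounded
    range. Both are met by the factor [e_b(z) = b / (z + b) - b^(-1) / (z + b^(-1))]: it is small
    near 0 and infinity, bounded on the sector uniformly in [b], and [e_b(A) x] tends to [x] by
    density of the domain and the range. Identifying the contour integral of [e_b] with a
    combination of resolvents is a residue computation. Convergence is always measured against
    [1 / (2 cosh (eps s))], the bound in the definition of [H^oo_0] written in [s = ln |z|]. Its
    primitive is an arctangent, so tails and Riemann sums have explicit bounds. *)

Inductive module_expr :=
  MVar (n : nat) | MZero | MPlus (a b : module_expr) | MOpp (a : module_expr)
| MScal (c : C) (a : module_expr).

Section module_normalization.
Context (X : NormedModule C_AbsRing).

Fixpoint module_eval (env : list X) (e : module_expr) : X :=
  match e with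
  | MVar n => List.nth n env zero
  | MZero => zero
  | MPlus a b => plus (module_eval env a) (module_eval env b)
  | MOpp a => opp (module_eval env a)
  | MScal c a => scal c (module_eval env a)
  end.

Fixpoint module_coef (e : module_expr) (n : nat) : C :=
  match e with
  | MVar m => if Nat.eqb n m then RtoC 1 else RtoC 0
  | MZero => RtoC 0
  | MPlus a b => Cplus (module_coef a n) (module_coef b n)
  | MOpp a => Copp (module_coef a n)
  | MScal c a => Cmult c (module_coef a n)
  end.

Fixpoint module_lincomb (env : list X) (f : nat -> C) : X :=
  match env with
  | List.nil => zero
  | List.cons x env => plus (scal (f O) x) (module_lincomb env (fun n => f (S n)))
  end.

Lemma module_lincomb_ext env f g :
  (forall n, f n = g n) -> module_lincomb env f = module_lincomb env g.
Proof.
elim: env f g => [//|x env IH] f g h /=.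
by rewrite h; congr plus; apply: IH.
Qed.

Lemma module_lincomb0 env : module_lincomb env (fun=> RtoC 0) = zero.
Proof.
by elim: env => [//|x env IH] /=; rewrite IH plus_zero_r; exact: scal_zero_l.
Qed.

Lemma module_lincomb_plus env f g :
  module_lincomb env (fun n => Cplus (f n) (g n)) =
  plus (module_lincomb env f) (module_lincomb env g).
Proof.
elim: env f g => [|x env IH] f g /=; first by rewrite plus_zero_l.
rewrite IH (scal_distr_r (f O) (g O) x) -!plus_assoc; congr plus.
by rewrite !plus_assoc (plus_comm (scal (g O) x)).
Qed.

Lemma module_lincomb_scal env c f :
  module_lincomb env (fun n => Cmult c (f n)) = scal c (module_lincomb env f).
Proof.
elim: env f => [|x env IH] f /=; first by rewrite scal_zero_r.
by rewrite IH scal_distr_l scal_assoc.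
Qed.

Lemma module_lincomb_var env n :
  module_lincomb env (module_coef (MVar n)) = List.nth n env zero.
Proof.
elim: env n => [|x env IH] [|n] //=.
- by rewrite module_lincomb0 plus_zero_r; exact: scal_one.
- rewrite -IH; rewrite (_ : scal (RtoC 0) x = zero) ?plus_zero_l //; exact: scal_zero_l.
Qed.

Lemma module_evalE env e : module_eval env e = module_lincomb env (module_coef e).
Proof.
elim: e => [n||a IHa b IHb|a IHa|c a IHa].
- by rewrite module_lincomb_var.
- by rewrite /= module_lincomb0.
- by rewrite /= IHa IHb -module_lincomb_plus.
- rewrite /= IHa -scal_opp_one -module_lincomb_scal.
  apply: module_lincomb_ext => n.
  by rewrite -[opp one]/(Copp (RtoC 1)); ring.
- by rewrite /= IHa -module_lincomb_scal.
Qed.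

(** Only the variables of the environment are compared, so for a concrete list this computes to
    finitely many equations between complex coefficients, which [ring] can solve. *)
Fixpoint module_coef_agree (k : nat) (e1 e2 : module_expr) : Prop :=
  match k with
  | O => True
  | S k => module_coef e1 k = module_coef e2 k /\ module_coef_agree k e1 e2
  end.

Lemma module_lincomb_ext_lt env f g :
  (forall n, (n < length env)%coq_nat -> f n = g n) ->
  module_lincomb env f = module_lincomb env g.
Proof.
elim: env f g => [//|x env IH] f g h /=.
rewrite h /=; last exact/Nat.lt_0_succ.
by congr plus; apply: IH => n hn; apply: h; rewrite /=; apply/(Nat.succ_lt_mono n).
Qed.

Lemma module_eq env e1 e2 :
  module_coef_agree (length env) e1 e2 -> module_eval env e1 = module_eval env e2.
Proof.
move=> h; rewrite !module_evalE; apply: module_lincomb_ext_lt => n.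
elim: (length env) h => [|k IH] /=; first by move=> _ /Nat.nlt_0_r.
move=> [hk h] /Nat.lt_succ_r /Nat.lt_eq_cases [|->//]; exact: IH.
Qed.

End module_normalization.

Ltac module_lookup x env :=
  match env with
  | List.cons x _ => constr:(O)
  | List.cons _ ?env => let n := module_lookup x env in constr:(S n)
  end.

Ltac module_add x env :=
  match env with
  | _ => let _ := module_lookup x env in env
  | _ => constr:(List.cons x env)
  end.

Ltac module_atoms env t :=
  lazymatch t with
  | @plus _ ?a ?b => let env := module_atoms env a in module_atoms env b
  | @minus _ ?a ?b => let env := module_atoms env a in module_atoms env b
  | @opp _ ?a => module_atoms env a
  | @scal _ _ ?c ?a => module_atoms env a
  | @zero _ => env
  | _ => module_add t env
  end.

Ltac module_reify env t :=
  lazymatch t with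
  | @plus _ ?a ?b =>
    let a := module_reify env a in let b := module_reify env b in
    constr:(MPlus a b)
  | @minus _ ?a ?b =>
    let a := module_reify env a in let b := module_reify env b in
    constr:(MPlus a (MOpp b))
  | @opp _ ?a => let a := module_reify env a in constr:(MOpp a)
  | @scal ?K _ ?c ?a => let a := module_reify env a in
      lazymatch type of c with
      | R => constr:(MScal (RtoC c) a)
      | Ring.sort R_Ring => constr:(MScal (RtoC c) a)
      | Ring.sort (AbsRing.Ring R_AbsRing) => constr:(MScal (RtoC c) a)
      | AbsRing.sort R_AbsRing => constr:(MScal (RtoC c) a)
      | _ => constr:(MScal c a)
      end
  | @zero _ => constr:(MZero)
  | _ => let n := module_lookup t env in constr:(MVar n)
  end.

Ltac module_start X :=
  cbv beta;
  change (AbsRing.sort R_AbsRing) with R; change (UniformSpace.sort R_UniformSpace) with R;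
  match goal with
  | |- @eq _ ?a ?b =>
    let env := module_atoms (@List.nil (NormedModule.sort C_AbsRing X)) a in
    let env := module_atoms env b in
    let ea := module_reify env a in
    let eb := module_reify env b in
    change (module_eval (X := X) env ea = module_eval (X := X) env eb);
    apply: module_eq; cbn -[Cplus Cmult Copp RtoC Cinv Cminus Cdiv]
  end.

(** On [C] the operations can appear through any of several structures (ring, module, normed
    module); replacing them by [Cplus], [Cmult] and the like makes [ring] and [field] applicable. *)
Ltac unfold_C :=
  repeat match goal with
  | |- context [@minus ?G ?a ?b] =>
    let t := type of a in unify t C; change (@minus G a b) with (Cplus a (Copp b))
  | |- context [@plus ?G ?a ?b] =>
    let t := type of a in unify t C; change (@plus G a b) with (Cplus a b)
  | |- context [@opp ?G ?a] =>
    let t := type of a in unify t C; change (@opp G a) with (Copp a)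
  | |- context [@scal ?K ?G ?a ?b] =>
    let t := type of b in unify t C; change (@scal K G a b) with (Cmult a b)
  | |- context [@mult ?K ?a ?b] =>
    let t := type of b in unify t C; change (@mult K a b) with (Cmult a b)
  | |- context [@norm ?K ?G ?a] =>
    let t := type of a in unify t C; change (@norm K G a) with (Cmod a)
  | |- context [@zero ?G] =>
    let t := type of (@zero G) in unify t C; change (@zero G) with (RtoC 0)
  | |- context [@one ?K] =>
    let t := type of (@one K) in unify t C; change (@one K) with (RtoC 1)
  end;
  repeat match goal with
  | |- @eq ?T ?a ?b => lazymatch T with C => fail | _ => change (@eq C a b) end
  end.

Lemma Ceq_minus0 (a b : C) : Cminus a b = RtoC 0 -> a = b.
Proof.
by move=> h; rewrite -(Cplus_0_l b) -h; ring.
Qed.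

(* Passing through [Cminus] makes [ring] see the type [C]. *)
Ltac Cring := unfold_C; apply: Ceq_minus0; ring.
Ltac Cfield := unfold_C; apply: Ceq_minus0; field.

(** [module X] proves equations in [X] that hold in every module, up to the
    equations between coefficients that it leaves. *)
Ltac module X := module_start X; repeat split; try first [ring | Cring].

(** [lra] compares norms syntactically, whereas the structures of a complete
    module reach its group and module structures along several paths. *)
Ltac unify_paths := repeat progress (
  try change (CompleteNormedModule.AbelianMonoid C_AbsRing ?X) with
    (NormedModule.AbelianMonoid C_AbsRing (CompleteNormedModule.NormedModule C_AbsRing X)) in *;
  try change (CompleteNormedModule.AbelianMonoid R_AbsRing (restr_scalars ?X)) with
    (NormedModule.AbelianMonoid C_AbsRing (CompleteNormedModule.NormedModule C_AbsRing X)) in *;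
  try change (NormedModule.AbelianMonoid R_AbsRing (CompleteNormedModule.NormedModule R_AbsRing (restr_scalars ?X))) with
    (NormedModule.AbelianMonoid C_AbsRing (CompleteNormedModule.NormedModule C_AbsRing X)) in *;
  try change (CompleteNormedModule.AbelianGroup C_AbsRing ?X) with
    (NormedModule.AbelianGroup C_AbsRing (CompleteNormedModule.NormedModule C_AbsRing X)) in *;
  try change (CompleteNormedModule.AbelianGroup R_AbsRing (restr_scalars ?X)) with
    (NormedModule.AbelianGroup C_AbsRing (CompleteNormedModule.NormedModule C_AbsRing X)) in *;
  try change (NormedModule.AbelianGroup R_AbsRing (CompleteNormedModule.NormedModule R_AbsRing (restr_scalars ?X))) with
    (NormedModule.AbelianGroup C_AbsRing (CompleteNormedModule.NormedModule C_AbsRing X)) in *;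
  try change (CompleteNormedModule.ModuleSpace C_AbsRing ?X) with
    (NormedModule.ModuleSpace C_AbsRing (CompleteNormedModule.NormedModule C_AbsRing X)) in *;
  try change (ModuleSpace.AbelianGroup C_Ring (NormedModule.ModuleSpace C_AbsRing ?X)) with
    (NormedModule.AbelianGroup C_AbsRing X) in *;
  try change (ModuleSpace.AbelianMonoid C_Ring (NormedModule.ModuleSpace C_AbsRing ?X)) with
    (NormedModule.AbelianMonoid C_AbsRing X) in *;
  try change (AbelianGroup.AbelianMonoid (NormedModule.AbelianGroup C_AbsRing ?X)) with
    (NormedModule.AbelianMonoid C_AbsRing X) in * ).

Ltac norm_lra := unify_paths; lra.

(** * Complex derivatives *)

Section complex_derivative.
Context (X : NormedModule C_AbsRing).

(** The complex derivative unfolded to an estimate on increments, for scalar functions and for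
    vector-valued ones such as resolvents alike. [cdiff_of_ex_derive] and [cdiff_ex_derive] link it
    to [ex_derive]. *)
Definition cdiff (F : C -> X) (z : C) (l : X) : Prop :=
  forall eta, 0 < eta -> exists2 delta, 0 < delta & forall h : C,
    Cmod h < delta ->
    norm (minus (minus (F (Cplus z h)) (F z)) (scal h l)) <= eta * Cmod h.

Lemma norm_scalC (c : C) (x : X) : norm (scal c x) <= Cmod c * norm x.
Proof. exact: (@norm_scal C_AbsRing X c x). Qed.

Lemma norm_scalC_eq (c : C) (x : X) : norm (scal c x) = Cmod c * norm x.
Proof.
apply: Rle_antisym; first exact: norm_scalC.
have [->|c0] := Ceq_dec c (RtoC 0).
  by rewrite Cmod_0 Rmult_0_l; exact: norm_ge_0.
have e : x = scal (Cinv c) (scal c x) by module X; field.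
have := norm_scalC (Cinv c) (scal c x); rewrite -e Cmod_inv // => h.
have hc := proj1 (Cmod_gt_0 c) c0.
apply: (Rmult_le_reg_l (/ Cmod c)); first exact: Rinv_0_lt_compat.
by rewrite -Rmult_assoc Rinv_l ?Rmult_1_l //; lra.
Qed.

Lemma norm_minus_sym (x y : X) : norm (minus x y) = norm (minus y x).
Proof. by rewrite -norm_opp; congr norm; module X. Qed.

Lemma norm_minus_le (x y : X) : norm (minus x y) <= norm x + norm y.
Proof. rewrite -(norm_opp y); exact: norm_triangle. Qed.

Lemma norm_le_minus (x y : X) : norm x <= norm y + norm (minus x y).
Proof.
apply: Rle_trans (norm_triangle y (minus x y)).
by apply: Req_le; congr norm; module X.
Qed.

Lemma cdiff_of_ex_derive (F : C -> X) z :
  ex_derive (K := C_AbsRing) (V := X) F z -> exists l, cdiff F z l.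
Proof.
case=> l [_ h]; exists l => eta heta.
have [d hd] := h z (fun P HP => HP) (mkposreal _ heta).
have [d' hd'] := (locally_norm_le_locally (K := C_AbsRing) (V := AbsRing_NormedModule C_AbsRing) z _ (ex_intro _ d hd)).
exists d'; first exact: cond_pos.
move=> k hk.
have := hd' (Cplus z k); rewrite /ball_norm.
have -> : minus (Cplus z k) z = k :> C by Cring.
exact.
Qed.

Lemma cdiff_ex_derive (F : C -> X) z l :
  cdiff F z l -> ex_derive (K := C_AbsRing) (V := X) F z.
Proof.
move=> h; exists l; split; first exact: is_linear_scal_l.
move=> x hx.
have -> : x = z by symmetry; apply: is_filter_lim_locally_unique.
move=> eps; have [d d0 hd] := h eps (cond_pos eps).
apply: (locally_le_locally_norm (K := C_AbsRing) (V := AbsRing_NormedModule C_AbsRing)).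
exists (mkposreal _ d0) => y hy.
have := hd (minus y z) hy.
by rewrite (_ : Cplus z (minus y z) = y) //; Cring.
Qed.

Lemma cdiff_ext F G z l : (forall w, F w = G w) -> cdiff F z l -> cdiff G z l.
Proof.
by move=> e h eta /h [d d0 hd]; exists d => // k /hd; rewrite !e.
Qed.

Lemma cdiff_const (x : X) z : cdiff (fun=> x) z zero.
Proof.
move=> eta h; exists 1 => [|k _]; first lra.
rewrite (_ : minus _ _ = zero); last by module X.
rewrite norm_zero; have := Cmod_ge_0 k => ?; nra.
Qed.

Lemma cdiff_plus F G z l m :
  cdiff F z l -> cdiff G z m -> cdiff (fun w => plus (F w) (G w)) z (plus l m).
Proof.
move=> hF hG eta h.
have [d1 d10 h1] := hF (eta / 2) ltac:(lra).
have [d2 d20 h2] := hG (eta / 2) ltac:(lra).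
exists (Rmin d1 d2); first exact: Rmin_pos.
move=> k hk; have := Rmin_l d1 d2; have := Rmin_r d1 d2 => ha hb.
have := h1 k ltac:(lra); have := h2 k ltac:(lra) => hc hd.
rewrite (_ : minus _ _ = plus (minus (minus (F (Cplus z k)) (F z)) (scal k l))
  (minus (minus (G (Cplus z k)) (G z)) (scal k m))); last by module X.
apply: Rle_trans (norm_triangle _ _) _; lra.
Qed.

Lemma cdiff_bound F z l : cdiff F z l ->
  exists2 delta, 0 < delta & forall h, Cmod h < delta ->
    norm (minus (F (Cplus z h)) (F z)) <= (norm l + 1) * Cmod h.
Proof.
move=> /(_ 1 Rlt_0_1) [d d0 hd]; exists d => // k hk.
have h1 := hd k hk; have h2 := norm_scalC k l.
have := norm_le_minus (minus (F (Cplus z k)) (F z)) (scal k l).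
lra.
Qed.

Lemma cdiff_continuous F z l : cdiff F z l -> forall eta, 0 < eta ->
  exists2 delta, 0 < delta & forall h, Cmod h < delta ->
    norm (minus (F (Cplus z h)) (F z)) < eta.
Proof.
move=> /cdiff_bound [d d0 hd] eta heta.
have hl := norm_ge_0 l.
exists (Rmin d (eta / (norm l + 1))) => [|h hh].
  by apply: Rmin_pos => //; apply: Rdiv_lt_0_compat; lra.
have := Rmin_l d (eta / (norm l + 1)); have := Rmin_r d (eta / (norm l + 1)) => h1 h2.
apply: Rle_lt_trans (hd h _) _; first lra.
have : Cmod h < eta / (norm l + 1) by lra.
move=> /(Rmult_lt_compat_l (norm l + 1) _ _ ltac:(lra)).
by rewrite (_ : (norm l + 1) * (eta / _) = eta) //; field; lra.
Qed.

End complex_derivative.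

Section complex_derivative_rules.
Context (X : NormedModule C_AbsRing).

Lemma cdiff_scal (f : C -> C_NormedModule) (G : C -> X) z (a : C) m :
  cdiff f z a -> cdiff G z m ->
  cdiff (fun w => scal (f w : C) (G w)) z (plus (scal a (G z)) (scal (f z : C) m)).
Proof.
move=> hf hG eta heta.
have [d3 d30 h3] := cdiff_bound hf.
have hfz := Cmod_ge_0 (f z); have hGz := norm_ge_0 (G z).
have hm := norm_ge_0 m; have ha := norm_ge_0 (a : C_NormedModule).
(* The increment of the product splits into [(df - k a) G(z)], [f(z) (dG - k m)] and [df dG]. The
   constants [e1], [e2] and [d4] bound each part by [eta / 3 * |k|]; the minimum with 1 in [e2]
   gives [|dG| <= (|m| + 1) |k|] for the last one. *)
pose e1 := eta / (3 * (norm (G z) + 1)).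
have e10 : 0 < e1 by apply: Rdiv_lt_0_compat; lra.
pose e2 := Rmin 1 (eta / (3 * (Cmod (f z) + 1))).
have e20 : 0 < e2 by apply: Rmin_pos; [lra|apply: Rdiv_lt_0_compat; lra].
have [d1 d10 h1] := hf e1 e10.
have [d2 d20 h2] := hG e2 e20.
pose B := (norm (a : C_NormedModule) + 1) * (norm m + 1).
have B0 : 0 < B by apply: Rmult_lt_0_compat; lra.
pose d4 := eta / (3 * B).
have d40 : 0 < d4 by apply: Rdiv_lt_0_compat; lra.
exists (Rmin (Rmin d1 d2) (Rmin d3 d4)); first by repeat apply: Rmin_pos.
move=> k /Rmin_Rgt_l [] /Rmin_Rgt_l [k1 k2] /Rmin_Rgt_l [k3 k4].
have {}h1 := h1 k k1; have {}h2 := h2 k k2; have {}h3 := h3 k k3.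
set df := minus (f (Cplus z k)) (f z) in h1 h3.
set dG := minus (G (Cplus z k)) (G z) in h2.
rewrite (_ : minus _ _ = plus (scal (minus df (scal k a : C_NormedModule) : C) (G z))
  (plus (scal (f z : C) (minus dG (scal k m))) (scal (df : C) dG))); last first.
  by rewrite /df /dG; module X; Cring.
have hk := Cmod_ge_0 k.
have i1 : norm (scal (minus df (scal k a : C_NormedModule) : C) (G z)) <= eta / 3 * Cmod k.
  apply: Rle_trans (norm_scalC _ _) _.
  apply: Rle_trans (Rmult_le_compat_r _ _ _ hGz h1) _.
  rewrite (_ : e1 * Cmod k * norm (G z) = eta / 3 * Cmod k * (norm (G z) / (norm (G z) + 1))); last first.
    by rewrite /e1; field; lra.
  rewrite -[X in _ <= X]Rmult_1_r; apply: Rmult_le_compat_l; first by apply: Rmult_le_pos; lra.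
  by apply/Rle_div_l; lra.
have i2 : norm (scal (f z : C) (minus dG (scal k m))) <= eta / 3 * Cmod k.
  apply: Rle_trans (norm_scalC _ _) _.
  have : e2 <= eta / (3 * (Cmod (f z) + 1)) by exact: Rmin_r.
  move=> /(Rmult_le_compat_r _ _ _ hk) /(Rle_trans _ _ _ h2) /(Rmult_le_compat_l _ _ _ hfz).
  move/Rle_trans; apply.
  rewrite (_ : Cmod (f z) * _ = eta / 3 * Cmod k * (Cmod (f z) / (Cmod (f z) + 1))); last first.
    by field; lra.
  rewrite -[X in _ <= X]Rmult_1_r; apply: Rmult_le_compat_l; first by apply: Rmult_le_pos; lra.
  by apply/Rle_div_l; lra.
have i3 : norm (scal (df : C) dG) <= eta / 3 * Cmod k.
  apply: Rle_trans (norm_scalC _ _) _.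
  have i4 : norm dG <= (norm m + 1) * Cmod k.
    have := norm_le_minus dG (scal k m); have := norm_scalC k m.
    have : e2 * Cmod k <= 1 * Cmod k by apply: Rmult_le_compat_r => //; exact: Rmin_l.
    lra.
  apply: Rle_trans (Rmult_le_compat _ _ _ _ (Cmod_ge_0 _) (norm_ge_0 _) h3 i4) _.
  rewrite (_ : _ * _ = B * Cmod k * Cmod k); last by rewrite /B; ring.
  apply: Rmult_le_compat_r => //.
  have : Cmod k <= d4 by lra.
  move=> /(Rmult_le_compat_l B _ _ ltac:(lra)) /Rle_trans; apply.
  by apply: Req_le; rewrite /d4; field; lra.
apply: Rle_trans (norm_triangle _ _) _.
apply: Rle_trans (_ : eta / 3 * Cmod k + (eta / 3 * Cmod k + eta / 3 * Cmod k) <= _).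
  apply: Rplus_le_compat i1 _; apply: Rle_trans (norm_triangle _ _) _.
  exact: Rplus_le_compat i2 i3.
by apply: Req_le; field.
Qed.

Lemma cdiff_comp (F : C -> X) (g : C -> C_NormedModule) z (a : C) l :
  cdiff g z a -> cdiff F (g z) l -> cdiff (fun w => F (g w)) z (scal a l).
Proof.
move=> hg hF eta heta.
have [d3 d30 h3] := cdiff_bound hg.
have ha := norm_ge_0 (a : C_NormedModule); have hl := norm_ge_0 l.
set A := norm (a : C_NormedModule) + 1 in h3.
have A0 : 0 < A by rewrite /A; lra.
have [d1 d10 h1] := hF (eta / (2 * A)) ltac:(apply: Rdiv_lt_0_compat; lra).
have [d2 d20 h2] := hg (eta / (2 * (norm l + 1))) ltac:(apply: Rdiv_lt_0_compat; lra).
exists (Rmin (Rmin (d1 / A) d2) d3).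
  by repeat apply: Rmin_pos => //; apply: Rdiv_lt_0_compat; lra.
move=> k /Rmin_Rgt_l [] /Rmin_Rgt_l [k1 k2] k3.
have {}h2 := h2 k k2; have {}h3 := h3 k k3.
set dg := minus (g (Cplus z k)) (g z) in h2 h3.
have e : g (Cplus z k) = Cplus (g z) dg by rewrite /dg; Cring.
have hd : Cmod dg < d1.
  apply: Rle_lt_trans h3 _.
  have := Rmult_lt_compat_l A _ _ A0 k1.
  by rewrite (_ : A * (d1 / A) = d1) //; field; lra.
have {}h1 := h1 dg hd.
rewrite e (_ : minus _ _ = plus (minus (minus (F (Cplus (g z) dg)) (F (g z))) (scal dg l))
  (scal (minus dg (scal k a : C_NormedModule) : C) l)); last first.
  by module X; Cring.
apply: Rle_trans (norm_triangle _ _) _.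
have hk := Cmod_ge_0 k.
have i1 : eta / (2 * A) * Cmod dg <= eta / 2 * Cmod k.
  have : 0 <= eta / (2 * A) by apply: Rlt_le; apply: Rdiv_lt_0_compat; lra.
  move=> q0; apply: Rle_trans (Rmult_le_compat_l _ _ _ q0 h3) _.
  by apply: Req_le; field; lra.
have i2 : norm (scal (minus dg (scal k a : C_NormedModule) : C) l) <= eta / 2 * Cmod k.
  apply: Rle_trans (norm_scalC _ _) _.
  apply: Rle_trans (Rmult_le_compat_r _ _ _ hl h2) _.
  rewrite (_ : _ * _ * _ = eta / 2 * Cmod k * (norm l / (norm l + 1))); last by field; lra.
  rewrite -[X in _ <= X]Rmult_1_r; apply: Rmult_le_compat_l; first by apply: Rmult_le_pos; lra.
  by apply/Rle_div_l; lra.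
apply: Rle_trans (Rplus_le_compat _ _ _ _ (Rle_trans _ _ _ h1 i1) i2) _.
by apply: Req_le; field.
Qed.

Lemma cdiff_id z : cdiff (fun w : C => w : C_NormedModule) z (RtoC 1).
Proof.
move=> eta h; exists 1 => [|k _]; first lra.
rewrite (_ : minus _ _ = RtoC 0); last first.
  by Cring.
rewrite /norm /= Cmod_0; have := Cmod_ge_0 k => ?; nra.
Qed.

Lemma cdiff_Cinv z : z <> RtoC 0 ->
  cdiff (fun w : C => Cinv w : C_NormedModule) z (Copp (Cinv (Cmult z z))).
Proof.
move=> z0 eta heta.
have mz := proj1 (Cmod_gt_0 z) z0.
exists (Rmin (Cmod z / 2) (eta * (Cmod z * Cmod z * Cmod z) / 2)).
  apply: Rmin_pos; first lra.
  by apply: Rdiv_lt_0_compat; last lra; repeat apply: Rmult_lt_0_compat.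
move=> k /Rmin_Rgt_l [k1 k2].
have mk := Cmod_ge_0 k.
have mzk : Cmod z / 2 <= Cmod (Cplus z k).
  have := Cmod_triangle (Cplus z k) (Copp k); rewrite Cmod_opp.
  rewrite (_ : Cplus (Cplus z k) (Copp k) = z); last by ring.
  lra.
have zk0 : Cplus z k <> RtoC 0.
  by apply/Cmod_gt_0; lra.
rewrite (_ : minus _ _ = Cmult (Cmult k k) (Cinv (Cmult (Cmult z z) (Cplus z k)))); last first.
  by Cfield; split.
have q0 : Cmult (Cmult z z) (Cplus z k) <> RtoC 0 by repeat apply: Cmult_neq_0.
rewrite /norm /= !Cmod_mult Cmod_inv // !Cmod_mult.
have mm : 0 < Cmod z * Cmod z by apply: Rmult_lt_0_compat.
apply: (Rmult_le_reg_r (Cmod z * Cmod z * Cmod (Cplus z k))).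
  by apply: Rmult_lt_0_compat => //; lra.
rewrite (_ : Cmod k * Cmod k * / (_ * _) * (_ * _) = Cmod k * Cmod k); last by field; lra.
rewrite (_ : eta * Cmod k * _ = Cmod k * (eta * (Cmod z * Cmod z * Cmod (Cplus z k)))); last by ring.
apply: Rmult_le_compat_l => //.
apply: Rle_trans (_ : eta * (Cmod z * Cmod z * (Cmod z / 2)) <= _); first lra.
by apply: Rmult_le_compat_l; [lra|apply: Rmult_le_compat_l; lra].
Qed.

End complex_derivative_rules.

(** * Cauchy's theorem on rectangles *)

Section lines.
Context (X : CompleteNormedModule C_AbsRing).
Local Notation V := (restr_scalars X).

Lemma continuousP (f : R -> V) x :
  (forall eta, 0 < eta -> exists2 delta, 0 < delta &
     forall y, Rabs (y - x) < delta -> @norm C_AbsRing X (minus (f y) (f x)) < eta) <->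
  continuous f x.
Proof.
split => h.
  apply/(filterlim_locally_ball_norm (U := V)) => eta.
  have [d d0 hd] := h eta (cond_pos eta).
  by exists (mkposreal _ d0) => y hy; apply: hd.
move=> eta eta0.
have := proj1 (filterlim_locally_ball_norm (U := V) (F := locally x) f (f x)) h (mkposreal _ eta0).
by case=> d hd; exists d; [exact: cond_pos|move=> y hy; apply: hd].
Qed.

Lemma is_derive_lineP (f : R -> V) x (l : V) :
  (forall eta, 0 < eta -> exists2 delta, 0 < delta &
     forall h, Rabs h < delta ->
     @norm C_AbsRing X (minus (minus (f (x + h)) (f x)) (scal h l)) <= eta * Rabs h) ->
  is_derive f x l.
Proof.
move=> h; split; first exact: is_linear_scal_l.
move=> y hy.
have -> : y = x by symmetry; apply: (is_filter_lim_locally_unique (V := R_NormedModule)).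
move=> eta; have [d d0 hd] := h eta (cond_pos eta).
exists (mkposreal _ d0) => z hz.
have := hd (z - x) hz.
by rewrite (_ : x + (z - x) = z) //; ring.
Qed.

Definition ccont (F : C -> X) (z : C) : Prop :=
  forall eta, 0 < eta -> exists2 delta, 0 < delta & forall h : C,
    Cmod h < delta -> norm (minus (F (Cplus z h)) (F z)) < eta.

Lemma cdiff_ccont F z l : cdiff F z l -> ccont F z.
Proof. exact: cdiff_continuous. Qed.

Lemma Cplus_hor s t c : Cplus (s, c) (RtoC t) = (s + t, c).
Proof. by rewrite /Cplus /=; congr pair; ring. Qed.

Lemma Cplus_ver s t c : Cplus (s, c) (Cmult Ci (RtoC t)) = (s, c + t).
Proof. by rewrite /Cplus /=; congr pair; ring. Qed.

Lemma Cmod_ver t : Cmod (Cmult Ci (RtoC t)) = Rabs t.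
Proof. by rewrite Cmod_mult Cmod_Ci Rmult_1_l Cmod_R. Qed.

Lemma ccont_hor F s c : ccont F (s, c) -> continuous (fun s => F (s, c) : V) s.
Proof.
move=> h; apply/continuousP => eta /h [d d0 hd]; exists d => // y hy.
have := hd (RtoC (y - s)); rewrite Cmod_R Cplus_hor (_ : s + (y - s) = y); last by ring.
exact.
Qed.

Lemma ccont_ver F s c : ccont F (s, c) -> continuous (fun t => F (s, t) : V) c.
Proof.
move=> h; apply/continuousP => eta /h [d d0 hd]; exists d => // y hy.
have := hd (Cmult Ci (RtoC (y - c))).
rewrite Cmod_ver Cplus_ver (_ : c + (y - c) = y); last by ring.
exact.
Qed.

Lemma cdiff_hor F s c l : cdiff F (s, c) l -> is_derive (fun s => F (s, c) : V) s l.
Proof.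
move=> h; apply: is_derive_lineP => eta /h [d d0 hd]; exists d => // y hy.
by have := hd (RtoC y); rewrite Cmod_R Cplus_hor; apply.
Qed.

Lemma cdiff_ver F s c l : cdiff F (s, c) l ->
  is_derive (fun t => F (s, t) : V) c (scal Ci l : X).
Proof.
move=> h; apply: is_derive_lineP => eta /h [d d0 hd]; exists d => // y hy.
have := hd (Cmult Ci (RtoC y)); rewrite Cmod_ver Cplus_ver => /(_ hy).
congr (_ <= _); congr norm; module X.
Qed.

Lemma ccont_plus F G z : ccont F z -> ccont G z -> ccont (fun w => plus (F w) (G w)) z.
Proof.
move=> hF hG eta h.
have [d1 d10 h1] := hF (eta / 2) ltac:(lra).
have [d2 d20 h2] := hG (eta / 2) ltac:(lra).
exists (Rmin d1 d2); first exact: Rmin_pos.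
move=> k /Rmin_Rgt_l [k1 k2].
rewrite (_ : minus _ _ = plus (minus (F (Cplus z k)) (F z)) (minus (G (Cplus z k)) (G z))); last by module X.
apply: Rle_lt_trans (norm_triangle _ _) _.
have := h1 k k1; have := h2 k k2; lra.
Qed.

Lemma ccont_scal F c z : ccont F z -> ccont (fun w => scal c (F w)) z.
Proof.
move=> hF eta heta.
have hc := Cmod_ge_0 c.
have [d d0 hd] := hF (eta / (Cmod c + 1)) ltac:(apply: Rdiv_lt_0_compat; lra).
exists d => // k /hd {}hd.
rewrite (_ : minus _ _ = scal c (minus (F (Cplus z k)) (F z))); last by module X.
apply: Rle_lt_trans (norm_scalC _ _) _.
apply: Rle_lt_trans (_ : (Cmod c + 1) * norm (minus (F (Cplus z k)) (F z)) < _).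
  by apply: Rmult_le_compat_r; [exact: norm_ge_0|lra].
have := Rmult_lt_compat_l (Cmod c + 1) _ _ ltac:(lra) hd.
by rewrite (_ : (Cmod c + 1) * (eta / _) = eta) //; field; lra.
Qed.

Lemma ccont_minus F G z : ccont F z -> ccont G z -> ccont (fun w => minus (F w) (G w)) z.
Proof.
move=> hF /(ccont_scal (RtoC (-1))) hG; have := ccont_plus hF hG.
move=> h eta /h [d d0 hd]; exists d => // k /hd.
by congr (_ < _); congr norm; module X.
Qed.

Definition in_rect a b c d (z : C) := a <= fst z <= b /\ c <= snd z <= d.

(** The integral over the boundary of the rectangle, counterclockwise: bottom minus top, then right
    minus left with [dz = i dt]. *)
Definition rect_int (F : C -> X) a b c d : X :=
  plus (minus (RInt (V := V) (fun s => F (s, c)) a b)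
              (RInt (V := V) (fun s => F (s, d)) a b))
       (scal Ci (minus (RInt (V := V) (fun t => F (b, t)) c d)
                       (RInt (V := V) (fun t => F (a, t)) c d))).

Lemma ex_RInt_hor F a b c : a <= b -> (forall s, a <= s <= b -> ccont F (s, c)) ->
  ex_RInt (V := V) (fun s => F (s, c)) a b.
Proof.
move=> ab h; apply: ex_RInt_continuous => s; rewrite Rmin_left // Rmax_right // => hs.
exact/ccont_hor/h.
Qed.

Lemma ex_RInt_ver F a c d : c <= d -> (forall t, c <= t <= d -> ccont F (a, t)) ->
  ex_RInt (V := V) (fun t => F (a, t)) c d.
Proof.
move=> ab h; apply: ex_RInt_continuous => s; rewrite Rmin_left // Rmax_right // => hs.
exact/ccont_ver/h.
Qed.

Lemma norm_RInt_const (f : R -> V) a b M : a <= b -> ex_RInt f a b ->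
  (forall x, a <= x <= b -> @norm C_AbsRing X (f x) <= M) ->
  @norm C_AbsRing X (RInt f a b) <= (b - a) * M.
Proof.
move=> ab ex h.
exact: (@norm_RInt_le_const V f a b _ M ab h (RInt_correct f a b ex)).
Qed.

Lemma rect_int_split_hor F a m b c d : a <= m <= b -> c <= d ->
  (forall z, in_rect a b c d z -> ccont F z) ->
  rect_int F a b c d = plus (rect_int F a m c d) (rect_int F m b c d).
Proof.
move=> [am mb] cd h; rewrite /rect_int.
rewrite -(RInt_Chasles (V := V) (fun s => F (s, c)) a m b).
- rewrite -(RInt_Chasles (V := V) (fun s => F (s, d)) a m b).
  + module X.
  + by apply: ex_RInt_hor => // s hs; apply: h; rewrite /in_rect /=; lra.
  + by apply: ex_RInt_hor => // s hs; apply: h; rewrite /in_rect /=; lra.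
- by apply: ex_RInt_hor => // s hs; apply: h; rewrite /in_rect /=; lra.
- by apply: ex_RInt_hor => // s hs; apply: h; rewrite /in_rect /=; lra.
Qed.

Lemma rect_int_split_ver F a b c m d : a <= b -> c <= m <= d ->
  (forall z, in_rect a b c d z -> ccont F z) ->
  rect_int F a b c d = plus (rect_int F a b c m) (rect_int F a b m d).
Proof.
move=> ab [cm md] h; rewrite /rect_int.
rewrite -(RInt_Chasles (V := V) (fun t => F (b, t)) c m d).
- rewrite -(RInt_Chasles (V := V) (fun t => F (a, t)) c m d).
  + module X.
  + by apply: ex_RInt_ver => // s hs; apply: h; rewrite /in_rect /=; lra.
  + by apply: ex_RInt_ver => // s hs; apply: h; rewrite /in_rect /=; lra.
- by apply: ex_RInt_ver => // s hs; apply: h; rewrite /in_rect /=; lra.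
- by apply: ex_RInt_ver => // s hs; apply: h; rewrite /in_rect /=; lra.
Qed.

Lemma norm_rect_int F a b c d M : a <= b -> c <= d ->
  (forall z, in_rect a b c d z -> ccont F z) ->
  (forall z, in_rect a b c d z -> norm (F z) <= M) ->
  norm (rect_int F a b c d) <= 2 * M * ((b - a) + (d - c)).
Proof.
move=> ab cd h hM; rewrite /rect_int.
have h1 : norm (RInt (V := V) (fun s => F (s, c)) a b : X) <= (b - a) * M.
  apply: norm_RInt_const => //.
    by apply: ex_RInt_hor => // s hs; apply: h; rewrite /in_rect /=; lra.
  by move=> s hs; apply: hM; rewrite /in_rect /=; lra.
have h2 : norm (RInt (V := V) (fun s => F (s, d)) a b : X) <= (b - a) * M.
  apply: norm_RInt_const => //.
    by apply: ex_RInt_hor => // s hs; apply: h; rewrite /in_rect /=; lra.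
  by move=> s hs; apply: hM; rewrite /in_rect /=; lra.
have h3 : norm (RInt (V := V) (fun t => F (b, t)) c d : X) <= (d - c) * M.
  apply: norm_RInt_const => //.
    by apply: ex_RInt_ver => // s hs; apply: h; rewrite /in_rect /=; lra.
  by move=> s hs; apply: hM; rewrite /in_rect /=; lra.
have h4 : norm (RInt (V := V) (fun t => F (a, t)) c d : X) <= (d - c) * M.
  apply: norm_RInt_const => //.
    by apply: ex_RInt_ver => // s hs; apply: h; rewrite /in_rect /=; lra.
  by move=> s hs; apply: hM; rewrite /in_rect /=; lra.
apply: Rle_trans (norm_triangle _ _) _.
apply: Rle_trans (Rplus_le_compat _ _ _ _ (norm_minus_le _ _) (norm_scalC _ _)) _.
rewrite Cmod_Ci Rmult_1_l.
apply: Rle_trans (Rplus_le_compat_l _ _ _ (norm_minus_le _ _)) _.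
set n1 := norm _ in h1 *; set n2 := norm _ in h2 *; set n3 := norm _ in h3 *.
set n4 := norm _ in h4 *; lra.
Qed.

Lemma rect_int_primitive F Q a b c d : a <= b -> c <= d ->
  (forall z, in_rect a b c d z -> ccont F z) ->
  (forall z, in_rect a b c d z -> cdiff Q z (F z)) ->
  rect_int F a b c d = zero.
Proof.
move=> ab cd h hQ.
have hor t : c <= t <= d ->
    RInt (V := V) (fun s => F (s, t)) a b = minus (Q (b, t)) (Q (a, t)).
  move=> ht; apply: is_RInt_unique.
  apply: (is_RInt_derive (V := V) (fun s => Q (s, t))) => s;
    rewrite Rmin_left // Rmax_right // => hs.
  - by apply: cdiff_hor; apply: hQ; rewrite /in_rect /=; lra.
  - by apply: ccont_hor; apply: h; rewrite /in_rect /=; lra.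
have ver s : a <= s <= b ->
    scal Ci (RInt (V := V) (fun t => F (s, t)) c d : X) = minus (Q (s, d)) (Q (s, c)).
  move=> hs.
  have hi : ex_RInt (V := V) (fun t => F (s, t)) c d.
    by apply: ex_RInt_ver => // t ht; apply: h; rewrite /in_rect /=; lra.
  (* Along a vertical line [Q] has derivative [i F], so [- i Q] is a primitive of [F]. *)
  have : is_RInt (V := V) (fun t => F (s, t)) c d
      (scal (Copp Ci) (minus (Q (s, d)) (Q (s, c))) : X).
    rewrite (_ : (scal _ _ : X) = minus (scal (Copp Ci) (Q (s, d))) (scal (Copp Ci) (Q (s, c)))); last by module X.
    apply: (is_RInt_derive (V := V) (fun t => scal (Copp Ci) (Q (s, t)) : X)) => t;
      rewrite Rmin_left // Rmax_right // => ht.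
    + have hz : cdiff Q (s, t) (F (s, t)) by apply: hQ; rewrite /in_rect /=; lra.
      have := cdiff_ver (cdiff_scal (@cdiff_const C_NormedModule (Copp Ci) (s, t)) hz).
      congr is_derive; module X.
      by apply: injective_projections; rewrite /=; ring.
    + by apply: ccont_ver; apply: h; rewrite /in_rect /=; lra.
  move/(is_RInt_unique (V := V)) ->.
  by module X; apply: injective_projections; rewrite /=; ring.
rewrite /rect_int !hor; try lra.
rewrite (_ : scal Ci _ = minus (minus (Q (b, d)) (Q (b, c))) (minus (Q (a, d)) (Q (a, c)))).
  by module X.
rewrite -!ver; try lra.
by module X.
Qed.

Lemma rect_int_minus F G a b c d : a <= b -> c <= d ->
  (forall z, in_rect a b c d z -> ccont F z) ->
  (forall z, in_rect a b c d z -> ccont G z) ->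
  rect_int (fun z => minus (F z) (G z)) a b c d =
  minus (rect_int F a b c d) (rect_int G a b c d).
Proof.
move=> ab cd hF hG.
have hor t : c <= t <= d -> RInt (V := V) (fun s => minus (F (s, t)) (G (s, t)) : X) a b =
    minus (RInt (V := V) (fun s => F (s, t)) a b) (RInt (V := V) (fun s => G (s, t)) a b).
  move=> ht; apply: (RInt_minus (V := V) (fun s => F (s, t)) (fun s => G (s, t)));
    by apply: ex_RInt_hor => // s hs; first [apply: hF | apply: hG]; rewrite /in_rect /=; lra.
have ver s : a <= s <= b -> RInt (V := V) (fun t => minus (F (s, t)) (G (s, t)) : X) c d =
    minus (RInt (V := V) (fun t => F (s, t)) c d) (RInt (V := V) (fun t => G (s, t)) c d).
  move=> hs; apply: (RInt_minus (V := V) (fun t => F (s, t)) (fun t => G (s, t)));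
    by apply: ex_RInt_ver => // t ht; first [apply: hF | apply: hG]; rewrite /in_rect /=; lra.
rewrite /rect_int !hor; try lra.
rewrite !ver; try lra.
module X.
Qed.

(** The affine part [L] of [F] at [z] has the primitive [Q] and integrates to zero. The remainder is
    at most [eta] times the half-perimeter on the rectangle, and the length of the boundary gives
    the second factor. *)
Lemma rect_int_local F z l eta : cdiff F z l -> 0 < eta ->
  exists2 delta, 0 < delta & forall a b c d, in_rect a b c d z ->
    (forall z, in_rect a b c d z -> ccont F z) ->
    (b - a) + (d - c) < delta ->
    norm (rect_int F a b c d) <= 2 * eta * ((b - a) + (d - c)) ^ 2.
Proof.
move=> hF eta0.
have [delta d0 hd] := hF eta eta0; exists delta => // a b c d hz hc small.
have ab : a <= b by case: hz; lra.
have cd : c <= d by case: hz; lra.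
pose L w := plus (F z) (scal (Cminus w z) l).
pose Q w := plus (scal (Cminus w z) (F z)) (scal (Cmult (RtoC (/ 2)) (Cmult (Cminus w z) (Cminus w z))) l).
have did w : cdiff (fun w => Cminus w z : C_NormedModule) w (RtoC 1).
  have := cdiff_plus (cdiff_id w) (@cdiff_const C_NormedModule (Copp z) w).
  by rewrite plus_zero_r.
have dQ w : cdiff Q w (L w).
  have h1 := cdiff_scal (did w) (@cdiff_const X (F z) w).
  have h2 := cdiff_scal (@cdiff_const C_NormedModule (RtoC (/ 2)) w) (cdiff_scal (did w) (did w)).
  have h3 := cdiff_scal h2 (@cdiff_const X l w).
  have := cdiff_plus h1 h3.
  congr cdiff; rewrite /L -[@zero C_NormedModule]/(RtoC 0); unfold_C.
  by module X; apply: injective_projections; rewrite /=; field.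
have dL w : cdiff L w l.
  have := cdiff_plus (@cdiff_const X (F z) w) (cdiff_scal (did w) (@cdiff_const X l w)).
  by congr cdiff; module X.
have cL w := cdiff_ccont (dL w).
have e : rect_int F a b c d = rect_int (fun w => minus (F w) (L w)) a b c d.
  rewrite rect_int_minus // (rect_int_primitive (F := L) (Q := Q)) //.
  by module X.
rewrite e.
have bd w : in_rect a b c d w -> Cmod (Cminus w z) <= (b - a) + (d - c).
  move: hz => [] h1 h2 [] h3 h4.
  have -> : Cminus w z = Cplus (RtoC (fst w - fst z)) (Cmult Ci (RtoC (snd w - snd z))).
    by apply: injective_projections; rewrite /=; ring.
  apply: Rle_trans (Cmod_triangle _ _) _; rewrite Cmod_R Cmod_ver.
  by apply: Rplus_le_compat; apply: Rabs_le; lra.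
apply: Rle_trans (norm_rect_int (M := eta * ((b - a) + (d - c))) ab cd _ _) _.
- by move=> w hw; apply: ccont_minus; [exact: hc|exact: cL].
- move=> w hw; have hm := bd w hw.
  have := hd (Cminus w z) ltac:(lra).
  rewrite (_ : Cplus z (Cminus w z) = w); last by ring.
  rewrite (_ : minus _ _ = minus (F w) (L w)); last by rewrite /L; module X.
  move/Rle_trans; apply; apply: Rmult_le_compat_l; lra.
by apply: Req_le; ring.
Qed.

End lines.

(** * Goursat's bisection argument *)

Section goursat.
Context (X : CompleteNormedModule C_AbsRing).
Context (F : C -> X) (a0 c0 W H : R).
Context (W0 : 0 <= W) (H0 : 0 <= H).

Let w n := W / 2 ^ n.
Let h n := H / 2 ^ n.

Let w_ge0 n : 0 <= w n.
Proof. by apply: Rdiv_le_0_compat => //; apply: pow_lt; lra. Qed.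

Let h_ge0 n : 0 <= h n.
Proof. by apply: Rdiv_le_0_compat => //; apply: pow_lt; lra. Qed.

Let wS n : w n = 2 * w n.+1.
Proof. by rewrite /w /=; field; apply: pow_nonzero; lra. Qed.

Let hS n : h n = 2 * h n.+1.
Proof. by rewrite /h /=; field; apply: pow_nonzero; lra. Qed.

Let I n (ac : R * R) :=
  rect_int F (fst ac) (fst ac + w n) (snd ac) (snd ac + h n).

Let quarter n (ac q : R * R) : R * R :=
  (fst ac + fst q * w n.+1, snd ac + snd q * h n.+1).

(** Selects a quarter whose boundary integral has at least a quarter of the norm of the whole. The
    last quarter is taken untested: if the other three fail, the triangle inequality forces it to
    qualify. *)
Let step n (ac : R * R) : R * R :=
  if Rle_dec (norm (I n ac) / 4) (norm (I n.+1 (quarter n ac (0, 0))))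
  then quarter n ac (0, 0)
  else if Rle_dec (norm (I n ac) / 4) (norm (I n.+1 (quarter n ac (1, 0))))
  then quarter n ac (1, 0)
  else if Rle_dec (norm (I n ac) / 4) (norm (I n.+1 (quarter n ac (0, 1))))
  then quarter n ac (0, 1)
  else quarter n ac (1, 1).

Fixpoint goursat_corner n : R * R :=
  match n with O => (a0, c0) | S n => step n (goursat_corner n) end.

Let a n := fst (goursat_corner n).
Let c n := snd (goursat_corner n).

Let corner_step n :
  a n <= a n.+1 <= a n + w n.+1 /\ c n <= c n.+1 <= c n + h n.+1.
Proof.
have := w_ge0 n.+1; have := h_ge0 n.+1.
rewrite /a /c /= /step.
by repeat case: Rle_dec => _ /=; lra.
Qed.

Let corner_mono (n k : nat) : a n <= a (n + k)%nat <= a n + w n - w (n + k)%nat /\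
  c n <= c (n + k)%nat <= c n + h n - h (n + k)%nat.
Proof.
elim: k => [|k IH]; first by rewrite addn0; lra.
rewrite addnS; have := corner_step (n + k); have := wS (n + k); have := hS (n + k).
lra.
Qed.

Let corner_le n m : a n <= a m + w m /\ c n <= c m + h m.
Proof.
have [/subnK <-|/ltnW /subnK <-] := leqP n m.
  have := corner_mono n (m - n); rewrite addnC.
  have := w_ge0 (m - n + n); have := h_ge0 (m - n + n); lra.
have := corner_mono m (n - m); rewrite addnC.
have := w_ge0 (n - m + m); have := h_ge0 (n - m + m); lra.
Qed.

(** The lower left corners increase in both coordinates and stay below the upper right corner of
    every rectangle, so their suprema give a point common to all of them. *)
Let corner_lim : exists z, forall n, in_rect (a n) (a n + w n) (c n) (c n + h n) z.
Proof.
have [al [al1 al2]] : {m | is_lub (fun x => exists n, x = a n) m}.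
  apply: completeness; last by exists (a 0%nat), 0%nat.
  by exists (a 0%nat + w 0%nat) => _ [n ->]; apply corner_le.
have [be [be1 be2]] : {m | is_lub (fun x => exists n, x = c n) m}.
  apply: completeness; last by exists (c 0%nat), 0%nat.
  by exists (c 0%nat + h 0%nat) => _ [n ->]; apply corner_le.
exists (al, be) => n; rewrite /in_rect /=; split; split.
- by apply: al1; exists n.
- by apply: al2 => _ [m ->]; apply corner_le.
- by apply: be1; exists n.
- by apply: be2 => _ [m ->]; apply corner_le.
Qed.

Context (dF : forall z, in_rect a0 (a0 + W) c0 (c0 + H) z -> exists l, cdiff F z l).

Let sub_rect n z : in_rect (a n) (a n + w n) (c n) (c n + h n) z ->
  in_rect a0 (a0 + W) c0 (c0 + H) z.
Proof.
have := corner_mono 0 n; rewrite add0n.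
have -> : w 0%nat = W by rewrite /w /=; field.
have -> : h 0%nat = H by rewrite /h /=; field.
have -> : a 0 = a0 by [].
have -> : c 0 = c0 by [].
rewrite /in_rect; lra.
Qed.

Let ccont_sub n z : in_rect (a n) (a n + w n) (c n) (c n + h n) z -> ccont F z.
Proof. by move/sub_rect/dF => [l /cdiff_ccont]. Qed.

Let I_step n : norm (I n (goursat_corner n)) / 4 <= norm (I n.+1 (goursat_corner n.+1)).
Proof.
have hw := w_ge0 n.+1; have hh := h_ge0 n.+1.
have hc := @ccont_sub n.
rewrite /= /step; case: Rle_dec => [//|m1] /=.
case: Rle_dec => [//|m2] /=; case: Rle_dec => [//|m3] /=.
have n1 := Rnot_le_lt _ _ m1; have n2 := Rnot_le_lt _ _ m2; have n3 := Rnot_le_lt _ _ m3.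
set ac := goursat_corner n in n1 n2 n3 *.
have e : I n ac = plus (plus (I n.+1 (quarter n ac (0, 0))) (I n.+1 (quarter n ac (0, 1))))
  (plus (I n.+1 (quarter n ac (1, 0))) (I n.+1 (quarter n ac (1, 1)))).
  rewrite /I /quarter /= (wS n) (hS n) !Rmult_0_l !Rmult_1_l !Rplus_0_r.
  rewrite (_ : fst ac + w n.+1 + w n.+1 = fst ac + 2 * w n.+1); last by ring.
  rewrite (_ : snd ac + h n.+1 + h n.+1 = snd ac + 2 * h n.+1); last by ring.
  move: hc; rewrite (wS n) (hS n) /a /c -/ac => hc.
  rewrite (rect_int_split_hor (m := fst ac + w n.+1)) //; try lra.
  rewrite (rect_int_split_ver (m := snd ac + h n.+1)); try lra.
    rewrite (rect_int_split_ver (a := fst ac + _) (m := snd ac + h n.+1)) //; try lra.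
    move=> z hz; apply: hc; move: hz; rewrite /in_rect; lra.
  move=> z hz; apply: hc; move: hz; rewrite /in_rect; lra.
apply: Rnot_lt_le => n4.
have : norm (I n ac) <= norm (I n ac) / 4 + norm (I n ac) / 4 + (norm (I n ac) / 4 + norm (I n.+1 (quarter n ac (1, 1)))).
  rewrite {1}e; apply: Rle_trans (norm_triangle _ _) _.
  apply: Rplus_le_compat; apply: Rle_trans (norm_triangle _ _) _; lra.
lra.
Qed.

Let I_lower n : norm (I 0 (a0, c0)) / 4 ^ n <= norm (I n (goursat_corner n)).
Proof.
elim: n => [|n IH]; first by rewrite /=; lra.
apply: Rle_trans (I_step n); rewrite /= (_ : _ / _ = norm (I 0 (a0, c0)) / 4 ^ n / 4).
  lra.
by field; apply: pow_nonzero; lra.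
Qed.

Lemma goursat_aux : rect_int F a0 (a0 + W) c0 (c0 + H) = zero.
Proof.
apply: norm_eq_zero.
have -> : rect_int F a0 (a0 + W) c0 (c0 + H) = I 0 (a0, c0).
  by rewrite /I /w /h /=; congr rect_int; field.
set J := norm _.
have [J0|J0] := Rle_lt_dec J 0; first by apply: Rle_antisym => //; exact: norm_ge_0.
exfalso.
have [z hz] := corner_lim.
have [l dl] := dF (sub_rect (hz 0%nat)).
have WH : 0 < (W + H) ^ 2 + 1 by have := pow2_ge_0 (W + H); lra.
(* Bisection gives [J / 4^n <= 2 eta ((W + H) / 2^n)^2], and this [eta] makes the right side at most
   [(J / 2) / 4^n]. The added 1 keeps the denominator positive for a degenerate rectangle. *)
pose eta := J / (4 * ((W + H) ^ 2 + 1)).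
have eta0 : 0 < eta by apply: Rdiv_lt_0_compat; lra.
have [d d0 hd] := rect_int_local dl eta0.
have [n hn] : exists n, (W + H) / 2 ^ n < d.
  have [n hn] := Pow_x_infinity 2 ltac:(rewrite Rabs_pos_eq; lra) ((W + H) / d + 1).
  exists n; have := hn n (Nat.le_refl n).
  have p2 : 0 < 2 ^ n by apply: pow_lt; lra.
  rewrite Rabs_pos_eq; last lra.
  move=> /Rge_le h2.
  apply/Rlt_div_l => //.
  have : (W + H) / d < 2 ^ n by lra.
  by move/Rlt_div_l; rewrite Rmult_comm; apply.
have p2 : 0 < 2 ^ n by apply: pow_lt; lra.
have := hd _ _ _ _ (hz n) (@ccont_sub n).
rewrite (_ : a n + w n - a n + (c n + h n - c n) = (W + H) / 2 ^ n); last first.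
  by rewrite /w /h; field; lra.
move=> /(_ hn); rewrite -[rect_int _ _ _ _ _]/(I n (goursat_corner n)) => up.
have := Rle_trans _ _ _ (I_lower n) up; rewrite -/J.
rewrite (_ : 2 * eta * ((W + H) / 2 ^ n) ^ 2 = (J / 2 * ((W + H) ^ 2 / ((W + H) ^ 2 + 1))) / 4 ^ n); last first.
  rewrite /eta (_ : 4 ^ n = 2 ^ n * 2 ^ n); last by rewrite -Rpow_mult_distr; congr pow; ring.
  by field; split; lra.
have p4 : 0 < 4 ^ n by apply: pow_lt; lra.
move=> /(Rmult_le_compat_r (4 ^ n) _ _ ltac:(lra)).
rewrite /Rdiv !(Rmult_assoc _ (/ 4 ^ n)) Rinv_l ?Rmult_1_r; last lra.
have : (W + H) ^ 2 * / ((W + H) ^ 2 + 1) <= 1.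
  by apply/Rle_div_l; lra.
set q := _ * _ => hq.
have : J * / 2 * q <= J * / 2 * 1 by apply: Rmult_le_compat_l; lra.
lra.
Qed.

End goursat.

Section goursat_rect.
Context (X : CompleteNormedModule C_AbsRing).

Lemma goursat (F : C -> X) a b c d : a <= b -> c <= d ->
  (forall z, in_rect a b c d z -> exists l, cdiff F z l) ->
  rect_int F a b c d = zero.
Proof.
move=> ab cd h.
have eb : a + (b - a) = b by ring.
have ed : c + (d - c) = d by ring.
have := @goursat_aux X F a c (b - a) (d - c) ltac:(lra) ltac:(lra).
by rewrite eb ed; apply.
Qed.

End goursat_rect.

(** * Integrals over horizontal lines *)

Section decay_kernel.

(** This is [1 / (2 cosh (eps s))], the bound [r^eps / (1 + r^(2 eps))] at [r = e^s]. Translating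
    [s] changes it by a bounded factor only, and it has an elementary primitive. *)
Definition decay (eps s : R) : R := / (exp (eps * s) + exp (- (eps * s))).

Definition decay_primitive (eps s : R) : R := atan (exp (eps * s)) / eps.

Lemma decay_gt0 eps s : 0 < decay eps s.
Proof.
apply: Rinv_0_lt_compat; have := exp_pos (eps * s); have := exp_pos (- (eps * s)); lra.
Qed.

Lemma decay_opp eps s : decay eps (- s) = decay eps s.
Proof. by rewrite /decay Rplus_comm !Ropp_mult_distr_r Ropp_involutive. Qed.

Lemma decay_shift eps s tau : 0 <= eps ->
  decay eps (s + tau) <= exp (eps * Rabs tau) * decay eps s.
Proof.
move=> e0; rewrite /decay.
have h1 := exp_pos (eps * s); have h2 := exp_pos (- (eps * s)).
have h3 := exp_pos (eps * (s + tau)); have h4 := exp_pos (- (eps * (s + tau))).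
have h5 := exp_pos (eps * Rabs tau).
apply: (Rmult_le_reg_r (exp (eps * (s + tau)) + exp (- (eps * (s + tau))))); first lra.
rewrite Rinv_l; last lra.
apply: (Rmult_le_reg_r (exp (eps * s) + exp (- (eps * s)))); first lra.
rewrite (_ : _ * / _ * _ * _ = exp (eps * Rabs tau) * (exp (eps * (s + tau)) + exp (- (eps * (s + tau))))); last by field; lra.
rewrite Rmult_1_l Rmult_plus_distr_l -!exp_plus.
have ex_le x y : x <= y -> exp x <= exp y.
  by case=> [/exp_increasing /Rlt_le //|->]; lra.
have a1 : eps * (- tau) <= eps * Rabs tau.
  by apply: Rmult_le_compat_l => //; rewrite -Rabs_Ropp; exact: Rle_abs.
have a2 : eps * tau <= eps * Rabs tau.
  by apply: Rmult_le_compat_l => //; exact: Rle_abs.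
by apply: Rplus_le_compat; apply: ex_le; lra.
Qed.

Lemma decay_le_half eps s : decay eps s <= / 2.
Proof.
apply: Rinv_le_contravar; first lra.
have h1 := exp_pos (eps * s); rewrite exp_Ropp.
apply: (Rmult_le_reg_r (exp (eps * s))) => //.
rewrite Rmult_plus_distr_r Rinv_l; last lra.
have := pow2_ge_0 (exp (eps * s) - 1); lra.
Qed.

Lemma decay_le_exp eps s : decay eps s <= exp (- (eps * s)).
Proof.
rewrite exp_Ropp; apply: Rinv_le_contravar; first exact: exp_pos.
have := exp_pos (- (eps * s)); lra.
Qed.

Lemma is_derive_decay_primitive eps s : 0 < eps ->
  is_derive (decay_primitive eps) s (decay eps s).
Proof.
move=> e0; rewrite /decay_primitive.
auto_derive; first lra.
rewrite /decay exp_Ropp /Rsqr; have := exp_pos (eps * s) => h.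
field; repeat split; try lra; nra.
Qed.

Lemma continuous_decay eps s : continuous (decay eps) s.
Proof.
apply: (ex_derive_continuous (K := R_AbsRing) (V := R_NormedModule)).
rewrite /decay; auto_derive.
have := exp_pos (eps * s); have := exp_pos (- (eps * s)); lra.
Qed.

Lemma is_RInt_decay eps a b : 0 < eps ->
  is_RInt (decay eps) a b (decay_primitive eps b - decay_primitive eps a).
Proof.
move=> e0; apply: (is_RInt_derive (V := R_CompleteNormedModule)) => s _.
- exact: is_derive_decay_primitive.
- exact: continuous_decay.
Qed.

Lemma decay_primitive_ge0 eps s : 0 < eps -> 0 < decay_primitive eps s.
Proof.
move=> e0; apply: Rdiv_lt_0_compat => //; rewrite -atan_0.
by apply: atan_increasing; exact: exp_pos.
Qed.

Lemma decay_primitive_lt eps s : 0 < eps -> decay_primitive eps s < PI / (2 * eps).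
Proof.
move=> e0; rewrite (_ : PI / (2 * eps) = PI / 2 / eps); last by field; lra.
apply: Rmult_lt_compat_r; first exact: Rinv_0_lt_compat.
exact: (proj2 (atan_bound _)).
Qed.

Lemma decay_primitive_mono eps s t : 0 < eps -> s <= t ->
  decay_primitive eps s <= decay_primitive eps t.
Proof.
move=> e0 [st|->]; last lra.
apply: Rlt_le; apply: Rmult_lt_compat_r; first exact: Rinv_0_lt_compat.
by apply: atan_increasing; apply: exp_increasing; apply: Rmult_lt_compat_l.
Qed.

Lemma atan_le x : 0 <= x -> atan x <= x.
Proof.
case=> [x0|<-]; last by rewrite atan_0; lra.
have [|c [h hc]] := MVT_cor2 atan (fun t => / (1 + t ^ 2)) 0 x x0.
  move=> c _; have := derivable_pt_lim_atan c.
  by rewrite (_ : c ^ 2 = Rsqr c) //; rewrite /Rsqr; ring.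
move: h; rewrite atan_0 !Rminus_0_r => ->.
rewrite -[X in _ <= X]Rmult_1_l; apply: Rmult_le_compat_r; first lra.
rewrite -[X in _ <= X]Rinv_1; apply: Rinv_le_contravar; first lra.
have := pow2_ge_0 c; lra.
Qed.

Lemma decay_primitive_opp eps s : 0 < eps ->
  decay_primitive eps (- s) = PI / (2 * eps) - decay_primitive eps s.
Proof.
move=> e0; rewrite /decay_primitive.
rewrite (_ : eps * - s = - (eps * s)); last by ring.
have h := exp_pos (eps * s).
by rewrite exp_Ropp atan_inv //; field; lra.
Qed.

(** As [atan x <= x], the left tail is at most [exp (- eps * s) / eps]; [L] makes this at most
    [eta / 2], and [Rmax] keeps it nonnegative. *)
Lemma decay_primitive_tail eps eta : 0 < eps -> 0 < eta ->
  exists L, 0 <= L /\ forall s, L <= s -> decay_primitive eps (- s) < eta.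
Proof.
move=> e0 eta0.
exists (Rmax 0 (- ln (eta * eps / 2) / eps)); split; first exact: Rmax_l.
move=> s hm; have hs := Rle_trans _ _ _ (Rmax_r _ _) hm.
have ee0 : 0 < eta * eps / 2 by apply: Rdiv_lt_0_compat; [exact: Rmult_lt_0_compat|lra].
have h1 : exp (eps * - s) <= eta * eps / 2.
  rewrite -(exp_ln (eta * eps / 2)) //.
  have : eps * - s <= ln (eta * eps / 2).
    move/Rle_div_l: hs => /(_ e0); lra.
  by case=> [/exp_increasing /Rlt_le //|->]; lra.
rewrite /decay_primitive; apply/Rlt_div_l => //.
apply: Rle_lt_trans (atan_le (Rlt_le _ _ (exp_pos _))) _.
have : 0 < eta * eps by exact: Rmult_lt_0_compat.
lra.
Qed.

End decay_kernel.

Section line_integral.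
Context (X : CompleteNormedModule C_AbsRing).
Local Notation V := (restr_scalars X).

(** The improper integral over the real line, both ends tending to infinity independently. As a
    relation it carries its own convergence, so that sums and images under operators need no further
    integrability argument. *)
Definition is_line_int (F : R -> X) (l : X) : Prop :=
  (forall a b, ex_RInt (V := V) F a b) /\
  forall eta, 0 < eta -> exists L, forall a b, a <= - L -> L <= b ->
    norm (minus (RInt (V := V) F a b : X) l) < eta.

Definition decays (eps M : R) (F : R -> X) : Prop :=
  [/\ 0 < eps, (forall s, continuous (F : R -> V) s) &
      forall s, norm (F s) <= M * decay eps s].

Lemma decays_ex_RInt eps M F a b : decays eps M F -> ex_RInt (V := V) F a b.
Proof. by move=> [_ h _]; apply: ex_RInt_continuous => s _; exact: h. Qed.

Lemma decays_M_ge0 eps M F : decays eps M F -> 0 <= M.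
Proof.
move=> [_ _ /(_ 0)]; have := norm_ge_0 (F 0); have := decay_gt0 eps 0.
move=> h1 h2 h3; apply: (Rmult_le_reg_r (decay eps 0)) => //; lra.
Qed.

Lemma decays_norm_RInt eps M F a b : decays eps M F -> a <= b ->
  norm (RInt (V := V) F a b : X) <=
  M * (decay_primitive eps b - decay_primitive eps a).
Proof.
move=> h ab; have [e0 hc hd] := h.
apply: (@norm_RInt_le V F (fun s => M * decay eps s) a b) => //.
- by move=> s _; exact: hd.
- by apply: (RInt_correct (V := V)); apply: decays_ex_RInt h.
- exact: (is_RInt_scal (V := R_NormedModule) (decay eps) a b M _ (is_RInt_decay (eps:=eps) (a:=a) (b:=b) e0)).
Qed.

Lemma decays_norm_RInt_abs eps M F a b : decays eps M F ->
  norm (RInt (V := V) F a b : X) <=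
  M * Rabs (decay_primitive eps b - decay_primitive eps a).
Proof.
move=> h; have [e0 _ _] := h; have [ab|/Rlt_le ba] := Rle_lt_dec a b.
  rewrite Rabs_pos_eq; first exact: decays_norm_RInt.
  by have := decay_primitive_mono e0 ab; lra.
rewrite -(opp_RInt_swap (V := V)); last by apply: decays_ex_RInt h.
rewrite (norm_opp (V := X)) Rabs_minus_sym Rabs_pos_eq; first exact: decays_norm_RInt.
by have := decay_primitive_mono e0 ba; lra.
Qed.

(** Cauchy's criterion: two integrals over long segments differ by the pieces between their left
    ends and between their right ends, and on each piece the primitive of [decay] varies little. *)
Lemma is_line_int_ex eps M F : decays eps M F -> exists l, is_line_int F l.
Proof.
move=> h; have [e0 _ _] := h; have M0 := decays_M_ge0 h.
pose FF := filter_prod (Rbar_locally m_infty) (Rbar_locally p_infty).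
have cauchy : forall eta : posreal, exists P : R * R -> Prop, FF P /\
    forall u v, P u -> P v -> ball (RInt (V := V) F (fst u) (snd u) : V) eta (RInt (V := V) F (fst v) (snd v) : V).
  move=> eta; pose e1 := eta / (4 * (M + 1)).
  have e10 : 0 < e1 by apply: Rdiv_lt_0_compat; [exact: cond_pos|lra].
  have [L [L0 hL]] := decay_primitive_tail e0 e10.
  exists (fun ab => fst ab < - L /\ L < snd ab); split.
    exists (fun a => a < - L) (fun b => L < b).
    - by exists (- L).
    - by exists L.
    - by [].
  move=> [a b] [a' b'] /= [ha hb] [ha' hb'].
  apply: (norm_compat1 (V := V)).
  have e : minus (RInt (V := V) F a' b') (RInt (V := V) F a b) =
      plus (RInt (V := V) F a' a) (RInt (V := V) F b b').
    rewrite -(RInt_Chasles (V := V) F a' a b'); try by apply: decays_ex_RInt h.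
    rewrite -(RInt_Chasles (V := V) F a b b'); try by apply: decays_ex_RInt h.
    by rewrite /minus -!plus_assoc; congr plus; rewrite plus_comm -plus_assoc plus_opp_l plus_zero_r.
  rewrite e; apply: Rle_lt_trans (norm_triangle (V := V) _ _) _.
  have i1 := decays_norm_RInt_abs a' a h; have i2 := decays_norm_RInt_abs b b' h.
  have lim x y : x < - L -> y < - L -> Rabs (decay_primitive eps x - decay_primitive eps y) <= e1.
    move=> hx hy; have := hL (- x) ltac:(lra); have := hL (- y) ltac:(lra).
    rewrite !Ropp_involutive => h1 h2.
    have := decay_primitive_ge0 x e0; have := decay_primitive_ge0 y e0 => h3 h4.
    by apply: Rabs_le; lra.
  have j1 := lim a a' ha ha'.
  have j2 : Rabs (decay_primitive eps b' - decay_primitive eps b) <= e1.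
    have := lim (- b) (- b') ltac:(lra) ltac:(lra); rewrite !decay_primitive_opp //.
    by congr (_ <= _); congr Rabs; ring.
  have k1 := Rmult_le_compat_l M _ _ M0 j1; have k2 := Rmult_le_compat_l M _ _ M0 j2.
  have k3 : M * e1 <= eta / 4.
    rewrite (_ : M * e1 = eta / 4 * (M / (M + 1))); last by rewrite /e1; field; lra.
    rewrite -[X in _ <= X]Rmult_1_r; apply: Rmult_le_compat_l.
      by have := cond_pos eta; lra.
    by apply/Rle_div_l; lra.
  apply: Rle_lt_trans (Rplus_le_compat _ _ _ _ (Rle_trans _ _ _ i1 k1) (Rle_trans _ _ _ i2 k2)) _.
  have := cond_pos eta; lra.
have [l hl] := proj1 (filterlim_locally_cauchy (U := V) (F := FF) (fun ab => RInt (V := V) F (fst ab) (snd ab))) cauchy.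
exists (l : X); split; first by move=> a b; apply: decays_ex_RInt h.
move=> eta eta0.
have := proj1 (filterlim_locally_ball_norm (U := V) (F := FF) (fun ab => RInt (V := V) F (fst ab) (snd ab)) l) hl (mkposreal _ eta0).
move=> [P Q [A hA] [B hB] hPQ].
exists (Rmax (1 - A) (B + 1)) => a b ha hb.
have := Rmax_l (1 - A) (B + 1); have := Rmax_r (1 - A) (B + 1) => h1 h2.
by apply: (hPQ a b); [apply: hA|apply: hB]; lra.
Qed.

Lemma is_line_int_unique F l l' : is_line_int F l -> is_line_int F l' -> l = l'.
Proof.
move=> [_ h] [_ h'].
suff : norm (minus l l') = 0.
  move/norm_eq_zero => e; have -> : l = plus (minus l l') l' by module X.
  by rewrite e plus_zero_l.
apply: Rle_antisym; last exact: norm_ge_0.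
apply: le_epsilon => eta eta0.
have [L hL] := h (eta / 2) ltac:(lra); have [L' hL'] := h' (eta / 2) ltac:(lra).
pose b := Rmax L L'.
have := Rmax_l L L'; have := Rmax_r L L'; rewrite -/b => b1 b2.
have := hL (- b) b ltac:(lra) b2; have := hL' (- b) b ltac:(lra) b1.
set i : X := RInt (V := V) _ _ _ => h1 h2.
rewrite (_ : minus l l' = plus (minus l i) (minus i l')); last by module X.
apply: Rle_trans (norm_triangle _ _) _; rewrite (norm_minus_sym l); norm_lra.
Qed.

Lemma is_line_int_ext F G l : (forall s, F s = G s) -> is_line_int F l -> is_line_int G l.
Proof. by move=> e; rewrite (_ : F = G) //; apply: functional_extensionality. Qed.

Lemma is_line_int_plus F G l m : is_line_int F l -> is_line_int G m ->
  is_line_int (fun s => plus (F s) (G s)) (plus l m).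
Proof.
move=> [eF hF] [eG hG]; split.
  by move=> a b; apply: (ex_RInt_plus (V := V)); [exact: eF|exact: eG].
move=> eta eta0.
have [L hL] := hF (eta / 2) ltac:(lra); have [L' hL'] := hG (eta / 2) ltac:(lra).
exists (Rmax L L') => a b ha hb.
have h1 := Rmax_l L L'; have h2 := Rmax_r L L'.
have := hL a b ltac:(lra) ltac:(lra); have := hL' a b ltac:(lra) ltac:(lra).
rewrite (_ : RInt (V := V) (fun s => plus (F s) (G s)) a b = plus (RInt (V := V) F a b) (RInt (V := V) G a b)); last first.
  by apply: (RInt_plus (V := V) F G); [exact: eF|exact: eG].
set i : X := RInt (V := V) _ _ _; set j : X := RInt (V := V) _ _ _ => h3 h4.
rewrite (_ : minus (plus j i) _ = plus (minus j l) (minus i m)); last by module X.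
apply: Rle_lt_trans (norm_triangle _ _) _; norm_lra.
Qed.

(** A linear [T] commutes with Riemann sums, and a bounded one with their limit. *)
Lemma is_RInt_lin (T : X -> X) F a b l : is_linear T ->
  is_RInt (V := V) F a b l -> is_RInt (V := V) (fun s => T (F s)) a b (T l).
Proof.
move=> hT h; rewrite /is_RInt.
have [hp hs [M [M0 hM]]] := hT.
have hm x y : T (minus x y) = minus (T x) (T y) by exact: linear_minus.
have hz : T zero = zero by exact: linear_zero.
have e ptd : scal (sign (b - a)) (Riemann_sum (V := V) (fun s => T (F s)) ptd) =
    T (scal (sign (b - a)) (Riemann_sum (V := V) F ptd)) :> X.
  rewrite -[RHS]/(T (scal (RtoC (sign (b - a))) (Riemann_sum (V := V) F ptd : X))) hs.
  rewrite -[LHS]/(scal (RtoC (sign (b - a))) (Riemann_sum (V := V) (fun s => T (F s)) ptd : X)).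
  congr scal; elim/(@SF_cons_ind R): ptd => [x0|[x y] s IH].
    by rewrite /Riemann_sum /= hz.
  rewrite !(Riemann_sum_cons (V := V)) IH.
  rewrite -[in RHS]/(plus (scal (RtoC (SF_h s - x)) (F y)) (Riemann_sum (V := V) F s : X)).
  by rewrite hp hs.
apply: (filterlim_ext (F := Riemann_fine a b) _ _ (fun ptd => esym (e ptd))).
apply: (filterlim_comp _ _ _ (fun ptd => scal (sign (b - a)) (Riemann_sum (V := V) F ptd)) T _ (locally (l : V)) _ h).
apply/(filterlim_locally_ball_norm (U := V)) => eta.
apply: (locally_le_locally_norm (V := V)).
have e0 : 0 < eta / M by apply: Rdiv_lt_0_compat; [exact: cond_pos|].
exists (mkposreal _ e0) => y hy.
rewrite /ball_norm -[@norm _ _ _]/(norm (minus (T y) (T l))) -hm.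
apply: Rle_lt_trans (hM _) _.
have := Rmult_lt_compat_l M _ _ M0 hy.
by rewrite /= (_ : M * (eta / M) = eta) //; field; lra.
Qed.

Lemma is_line_int_lin (T : X -> X) F l : is_linear T ->
  is_line_int F l -> is_line_int (fun s => T (F s)) (T l).
Proof.
move=> hT [eF hF]; have [hp hs [M [M0 hM]]] := hT.
have hm x y : T (minus x y) = minus (T x) (T y) by exact: linear_minus.
split.
  by move=> a b; have [i hi] := eF a b; exists (T i); apply: is_RInt_lin.
move=> eta eta0; have [L hL] := hF (eta / M) (Rdiv_lt_0_compat _ _ eta0 M0).
exists L => a b ha hb; have := hL a b ha hb.
rewrite (_ : RInt (V := V) (fun s => T (F s)) a b = T (RInt (V := V) F a b)); last first.
  by apply: (is_RInt_unique (V := V)); apply: is_RInt_lin => //; apply: (RInt_correct (V := V)); exact: eF.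
rewrite -hm => h; apply: Rle_lt_trans (hM _) _.
have := Rmult_lt_compat_l M _ _ M0 h.
by rewrite /= (_ : M * (eta / M) = eta) //; field; lra.
Qed.

Lemma is_linear_scalC (c : C) : is_linear (fun x : X => scal c x).
Proof.
split.
- by move=> x y; module X.
- by move=> k x; module X.
- exists (Cmod c + 1); split; first by have := Cmod_ge_0 c; lra.
  move=> x; apply: Rle_trans (norm_scalC c x) _.
  by apply: Rmult_le_compat_r; [exact: norm_ge_0|lra].
Qed.

Lemma is_line_int_scal (c : C) F l :
  is_line_int F l -> is_line_int (fun s => scal c (F s)) (scal c l).
Proof. exact: is_line_int_lin (is_linear_scalC c). Qed.

Lemma is_line_int_minus F G l m : is_line_int F l -> is_line_int G m ->
  is_line_int (fun s => minus (F s) (G s)) (minus l m).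
Proof.
move=> hF /(is_line_int_scal (RtoC (-1))) hG; have := is_line_int_plus hF hG.
rewrite (_ : plus l _ = minus l m); last by module X.
by apply: is_line_int_ext => s; module X.
Qed.

Lemma is_line_int_shift tau F l :
  is_line_int F l -> is_line_int (fun s => F (s + tau)) l.
Proof.
move=> [eF hF].
have hi a b : is_RInt (V := V) (fun s => F (s + tau)) a b (RInt (V := V) F (a + tau) (b + tau)).
  have := is_RInt_comp_lin (V := V) F 1 tau a b (RInt (V := V) F (a + tau) (b + tau)).
  rewrite !Rmult_1_l => /(_ (RInt_correct _ _ _ (eF _ _))).
  apply: is_RInt_ext => s _; rewrite Rmult_1_l; exact: (scal_one (F (s + tau))).
split; first by move=> a b; exists (RInt (V := V) F (a + tau) (b + tau)).
move=> eta /hF [L hL]; exists (L + Rabs tau) => a b ha hb.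
rewrite (_ : RInt (V := V) (fun s => F (s + tau)) a b = RInt (V := V) F (a + tau) (b + tau)); last exact: is_RInt_unique.
have := Rle_abs tau; have := Rle_abs (- tau); rewrite Rabs_Ropp => h1 h2.
by apply: hL; lra.
Qed.

(** The substitution [s = ln r], which turns the ray integrals of the Dunford calculus into line
    integrals. *)
Lemma is_line_int_RInt_gen F l : (forall s, continuous (F : R -> V) s) ->
  is_line_int F l ->
  is_RInt_gen (V := V) (fun r => scal (/ r) (F (ln r) : V)) (at_right 0) (Rbar_locally p_infty) (l : V).
Proof.
move=> hc [eF hF].
have hi a b : 0 < a -> 0 < b -> is_RInt (V := V) (fun r => scal (/ r) (F (ln r) : V)) a b (RInt (V := V) F (ln a) (ln b)).
  move=> a0 b0; apply: (is_RInt_comp (V := V) F ln Rinv) => x.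
    by move=> _; exact: hc.
  move=> [hx _]; have x0 : 0 < x by apply: Rlt_le_trans hx; exact: Rmin_pos.
  split; first by apply/is_derive_Reals; exact: derivable_pt_lim_ln.
  by apply: continuous_Rinv; lra.
move=> P [eta hP].
have := cond_pos eta => eta0; have [L hL] := hF eta eta0.
exists (fun a => 0 < a < exp (- Rabs L)) (fun b => exp (Rabs L) < b).
- exists (mkposreal _ (exp_pos (- Rabs L))) => y hy y0; split => //.
  by move: hy; rewrite /ball /= /AbsRing_ball /= /abs /minus /plus /opp /= Ropp_0 Rplus_0_r Rabs_pos_eq; lra.
- by exists (exp (Rabs L)).
- move=> a b [a0 ha] hb /=.
  have b0 : 0 < b by apply: Rlt_trans hb; exact: exp_pos.
  exists (RInt (V := V) F (ln a) (ln b)); split; first exact: hi.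
  apply: hP; apply: (norm_compat1 (V := V)); apply: hL.
  + have := ln_increasing _ _ a0 ha; rewrite ln_exp; have := Rle_abs L; lra.
  + have := ln_increasing _ _ (exp_pos _) hb; rewrite ln_exp; have := Rle_abs L; lra.
Qed.

(** Cauchy's theorem on the rectangle [[-b', b'] x [th1, th2]]: as [b'] grows, the horizontal sides
    tend to the two line integrals and the vertical sides vanish because of the decay. In the
    coordinate [ln z] this rotates a ray of the contour. *)
Lemma is_line_int_rotate (F : C -> X) eps M th1 th2 l : 0 < eps -> th1 <= th2 ->
  (forall s th, th1 <= th <= th2 -> exists d, cdiff F (s, th) d) ->
  (forall s th, th1 <= th <= th2 -> norm (F (s, th)) <= M * decay eps s) ->
  is_line_int (fun s => F (s, th1)) l <-> is_line_int (fun s => F (s, th2)) l.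
Proof.
move=> e0 th12 hd hM.
have dec th : th1 <= th <= th2 -> decays eps M (fun s => F (s, th)).
  move=> hth; split => // s; last exact: hM.
  by have [d /cdiff_ccont /ccont_hor] := hd s th hth.
have [l1 h1] := is_line_int_ex (dec th1 ltac:(lra)).
have [l2 h2] := is_line_int_ex (dec th2 ltac:(lra)).
suff e : l1 = l2.
  split => h; first by rewrite (is_line_int_unique h h1) e.
  by rewrite (is_line_int_unique h h2) -e.
have M0 := decays_M_ge0 (dec th1 ltac:(lra)).
suff : norm (minus l1 l2) = 0.
  move/norm_eq_zero => e; have -> : l1 = plus (minus l1 l2) l2 by module X.
  by rewrite e plus_zero_l.
apply: Rle_antisym; last exact: norm_ge_0.
apply: le_epsilon => eta eta0.
have [L1 hL1] := proj2 h1 (eta / 4) ltac:(lra).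
have [L2 hL2] := proj2 h2 (eta / 4) ltac:(lra).
pose Q := (th2 - th1) * M + 1.
have Q0 : 0 < Q.
  have : 0 <= (th2 - th1) * M by apply: Rmult_le_pos; lra.
  by rewrite /Q; lra.
(* From here on [decay eps] is at most [exp (- eps s) <= eta / (4 Q)], and [Q] exceeds
   [(th2 - th1) M], so each vertical side contributes at most [eta / 4]. *)
pose L3 := - ln (eta / (4 * Q)) / eps.
have e1 : 0 < eta / (4 * Q) by apply: Rdiv_lt_0_compat; lra.
pose b := Rmax (Rmax L1 L2) L3.
have b1 : L1 <= b by apply: Rle_trans (Rmax_l _ _); exact: Rmax_l.
have b2 : L2 <= b by apply: Rle_trans (Rmax_l _ _); exact: Rmax_r.
have b3 : L3 <= b by exact: Rmax_r.
pose b' := Rmax b 0.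
have bb' : b <= b' by exact: Rmax_l.
have b'0 : 0 <= b' by exact: Rmax_r.
have := hL1 (- b') b' ltac:(lra) ltac:(lra); have := hL2 (- b') b' ltac:(lra) ltac:(lra).
have G : rect_int F (- b') b' th1 th2 = zero.
  apply: goursat => //; first lra.
  by move=> [s th] [/= hs hth]; exact: hd.
move: G; rewrite /rect_int.
set i1 : X := RInt (V := V) _ _ _; set i2 : X := RInt (V := V) _ _ _; set i3 : X := RInt (V := V) _ _ _; set i4 : X := RInt (V := V) _ _ _.
move=> G k2 k1.
have dk : decay eps b' <= eta / (4 * Q).
  apply: Rle_trans (decay_le_exp _ _) _.
  rewrite -(exp_ln (eta / (4 * Q))) //.
  have : - (eps * b') <= ln (eta / (4 * Q)).
    have : L3 <= b' by lra.
    by rewrite /L3 => /(Rle_div_l _ _ _ e0); lra.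
  by case=> [/exp_increasing /Rlt_le //|->]; lra.
have side s : decay eps s <= eta / (4 * Q) ->
    norm (RInt (V := V) (fun t => F (s, t)) th1 th2 : X) <= eta / 4.
  move=> hs.
  apply: Rle_trans (@norm_RInt_const X (fun t => F (s, t)) th1 th2 (M * (eta / (4 * Q))) th12 _ _) _.
  - by apply: ex_RInt_ver => // t ht; have [d /cdiff_ccont] := hd s t ht.
  - move=> t ht; apply: Rle_trans (hM s t ht) _.
    exact: Rmult_le_compat_l.
  rewrite (_ : _ * _ = eta / 4 * (((th2 - th1) * M) / Q)); last by field; lra.
  rewrite -[X in _ <= X]Rmult_1_r; apply: Rmult_le_compat_l; first lra.
  by apply/Rle_div_l => //; rewrite /Q; lra.
have k3 : norm (i3 : X) <= eta / 4 by apply: side.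
have k4 : norm (i4 : X) <= eta / 4 by apply: side; rewrite decay_opp.
have G' : minus i1 i2 = scal Ci (minus i4 i3 : X) :> X.
  rewrite (_ : (minus i1 i2 : X) = minus (plus (minus i1 i2) (scal Ci (minus i3 i4 : X))) (scal Ci (minus i3 i4 : X))); last by module X.
  by rewrite G; module X.
rewrite (_ : minus l1 l2 = plus (plus (minus l1 i1) (minus i2 l2)) (minus i1 i2)); last by module X.
rewrite G'.
apply: Rle_trans (norm_triangle _ _) _.
have q1 := norm_triangle (minus l1 i1) (minus i2 l2).
have q2 : norm (scal Ci (minus i4 i3 : X)) <= norm (i4 : X) + norm (i3 : X).
  by apply: Rle_trans (norm_scalC _ _) _; rewrite Cmod_Ci Rmult_1_l; exact: norm_minus_le.
move: q1; rewrite (norm_minus_sym l1 i1) => q1.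
move: k1 k2 k3 k4 q1 q2.
set n1 := norm _; set n2 := norm _; set n3 := norm _; set n4 := norm _.
set n5 := norm _; set n6 := norm _; lra.
Qed.

End line_integral.

(** * Logarithmic coordinates on sectors *)

Section exponential.

Definition cexp (w : C) : C := (exp (fst w) * cos (snd w), exp (fst w) * sin (snd w)).

Lemma cexp_plus w w' : cexp (Cplus w w') = Cmult (cexp w) (cexp w').
Proof.
rewrite /cexp /Cplus /Cmult /= exp_plus cos_plus sin_plus.
by congr pair; ring.
Qed.

Lemma Cmod_cexp w : Cmod (cexp w) = exp (fst w).
Proof.
rewrite /Cmod /cexp /=.
rewrite (_ : _ + _ = exp (fst w) * exp (fst w) * (Rsqr (sin (snd w)) + Rsqr (cos (snd w)))).
  by rewrite sin2_cos2 Rmult_1_r sqrt_square //; apply: Rlt_le; exact: exp_pos.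
by rewrite /Rsqr; ring.
Qed.

Lemma cexp_neq0 w : cexp w <> RtoC 0.
Proof. by apply/Cmod_gt_0; rewrite Cmod_cexp; exact: exp_pos. Qed.

Lemma cexp_real s : cexp (s, 0) = RtoC (exp s).
Proof. by rewrite /cexp /= cos_0 sin_0 Rmult_1_r Rmult_0_r. Qed.

(** Both bounds come from [1 + t <= exp t]: at [t = x] it gives the sign, and at [t = - x] it gives
    [exp x * (1 - x) <= 1]. *)
Lemma exp_taylor1 x : Rabs x <= / 2 -> Rabs (exp x - 1 - x) <= 2 * x ^ 2.
Proof.
move=> /Rabs_le_between hx.
have h1 := exp_ineq1_le x; have h2 := exp_ineq1_le (- x).
rewrite Rabs_pos_eq; last lra.
have h3 : exp x * (1 - x) <= 1.
  have e : exp x * exp (- x) = 1 by rewrite -exp_plus Rplus_opp_r exp_0.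
  rewrite -e; apply: Rmult_le_compat_l; [exact: Rlt_le (exp_pos x)|lra].
have h4 := pow2_ge_0 x.
have h5 : (exp x - 1 - x) * (1 - x) <= x ^ 2 by nra.
nra.
Qed.

Lemma Rabs_sin_le y : Rabs (sin y) <= Rabs y.
Proof.
have pos t : 0 <= t -> Rabs (sin t) <= t.
  case=> [t0|<-]; last by rewrite sin_0 Rabs_R0; lra.
  apply: Rabs_le; split; last exact: Rlt_le (sin_lt_x t t0).
  have [t1|t1] := Rle_lt_dec t 1.
    have : 0 <= sin t by apply: sin_ge_0; have := PI2_1; lra.
    lra.
  have := SIN_bound t; lra.
have [y0|/Rlt_le y0] := Rle_lt_dec 0 y.
  by rewrite (Rabs_pos_eq y) //; exact: pos.
have := pos (- y) ltac:(lra); rewrite sin_neg Rabs_Ropp => h.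
by rewrite (Rabs_left1 y).
Qed.

Lemma cos_taylor1 y : Rabs (cos y - 1) <= y ^ 2.
Proof.
have -> : cos y - 1 = - (2 * (sin (y / 2) * sin (y / 2))).
  have {1}-> : y = 2 * (y / 2) by field.
  by rewrite cos_2a_sin; ring.
rewrite Rabs_Ropp Rabs_pos_eq; last by have := pow2_ge_0 (sin (y / 2)); rewrite /=; nra.
have h := Rabs_sin_le (y / 2).
have : sin (y / 2) ^ 2 <= (y / 2) ^ 2.
  by rewrite -(pow2_abs (sin _)) -(pow2_abs (y / 2)); apply: pow_incr; split => //; exact: Rabs_pos.
have := pow2_ge_0 y; rewrite /=; nra.
Qed.

Lemma sin_taylor1 y : Rabs y <= 1 -> Rabs (sin y - y) <= y ^ 2.
Proof.
move=> hy.
have [||c [hc h]] := MVT_gen (fun t => sin t - t) 0 y (fun t => cos t - 1).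
- by move=> x _; auto_derive => //; ring.
- move=> x _; apply: derivable_continuous_pt; apply: derivable_pt_minus; [exact: derivable_pt_sin|exact: derivable_pt_id].
move: h; rewrite sin_0 !Rminus_0_r => ->; rewrite Rabs_mult.
have hcy : Rabs c <= Rabs y.
  move: hc; rewrite /Rmin /Rmax; case: Rle_dec => [y0|/Rnot_le_lt y0] hc.
    by rewrite !Rabs_pos_eq; lra.
  by rewrite !Rabs_left1; lra.
have h1 := cos_taylor1 c.
have h2 : c ^ 2 <= Rabs y.
  rewrite -(pow2_abs c); apply: Rle_trans (_ : Rabs y ^ 2 <= _).
    by apply: pow_incr; split => //; exact: Rabs_pos.
  have := Rabs_pos y; rewrite /=; nra.
rewrite -(pow2_abs y) /= Rmult_1_r; apply: Rmult_le_compat_r; [exact: Rabs_pos|lra].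
Qed.

Lemma Cmod_le_sum z : Cmod z <= Rabs (fst z) + Rabs (snd z).
Proof.
have -> : z = Cplus (RtoC (fst z)) (Cmult Ci (RtoC (snd z))).
  by apply: injective_projections; rewrite /=; ring.
apply: Rle_trans (Cmod_triangle _ _) _.
by rewrite Cmod_R Cmod_ver /=; apply: Req_le; congr (Rabs _ + Rabs _); ring.
Qed.

Lemma Rabs_fst_le z : Rabs (fst z) <= Cmod z.
Proof. by have := Rmax_Cmod z; have := Rmax_l (Rabs (fst z)) (Rabs (snd z)); lra. Qed.

Lemma Rabs_snd_le z : Rabs (snd z) <= Cmod z.
Proof. by have := Rmax_Cmod z; have := Rmax_r (Rabs (fst z)) (Rabs (snd z)); lra. Qed.

(** The errors of [exp x], [cos y] and [sin y] are of second order, hence so are both components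
    here. Only the order matters; the constant is crude. *)
Lemma cexp_taylor1 h : Cmod h <= / 2 ->
  Cmod (Cminus (Cminus (cexp h) (RtoC 1)) h) <= 10 * Cmod h ^ 2.
Proof.
case: h => x y hm; have hx := Rabs_fst_le (x, y); have hy := Rabs_snd_le (x, y).
move: hm hx hy; set m := Cmod (x, y) => hm /= hx hy.
have m0 : 0 <= m by exact: Cmod_ge_0.
apply: Rle_trans (Cmod_le_sum _) _; rewrite /= Ropp_0 Rplus_0_r.
have x2 : x ^ 2 <= m ^ 2.
  by rewrite -(pow2_abs x); apply: pow_incr; split => //; exact: Rabs_pos.
have y2 : y ^ 2 <= m ^ 2.
  by rewrite -(pow2_abs y); apply: pow_incr; split => //; exact: Rabs_pos.
have e1 := exp_taylor1 (x := x) ltac:(lra).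
have c1 := cos_taylor1 y; have s1 := sin_taylor1 (y := y) ltac:(lra).
have s2 := Rabs_sin_le y.
have mm : m ^ 2 <= m / 2 by rewrite /=; nra.
have ee : Rabs (exp x - 1) <= 2 * m.
  have -> : exp x - 1 = (exp x - 1 - x) + x by ring.
  apply: Rle_trans (Rabs_triang _ _) _; lra.
have cb : Rabs (cos y) <= 1 by apply: Rabs_le; exact: COS_bound.
have -> : exp x * cos y + - (1) + - x = (exp x - 1 - x) * cos y + (1 + x) * (cos y - 1) by ring.
have -> : exp x * sin y + - y = (exp x - 1) * sin y + (sin y - y) by ring.
have t1 : Rabs ((exp x - 1 - x) * cos y) <= 2 * m ^ 2.
  rewrite Rabs_mult; have := Rabs_pos (exp x - 1 - x); have := Rabs_pos (cos y); nra.
have t2 : Rabs ((1 + x) * (cos y - 1)) <= 2 * m ^ 2.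
  rewrite Rabs_mult; have : Rabs (1 + x) <= 2.
    by apply: Rabs_le; move/Rabs_le_between: hx; lra.
  have := Rabs_pos (1 + x); have := Rabs_pos (cos y - 1); nra.
have t3 : Rabs ((exp x - 1) * sin y) <= 2 * m ^ 2.
  rewrite Rabs_mult /= Rmult_1_r -Rmult_assoc.
  by apply: Rmult_le_compat; try exact: Rabs_pos; lra.
have := Rabs_triang ((exp x - 1 - x) * cos y) ((1 + x) * (cos y - 1)).
have := Rabs_triang ((exp x - 1) * sin y) (sin y - y).
have := pow2_ge_0 m; lra.
Qed.

Lemma cdiff_cexp w : cdiff (fun w => cexp w : C_NormedModule) w (cexp w).
Proof.
move=> eta eta0; have m0 := exp_pos (fst w).
pose d := Rmin (/ 2) (eta / (10 * exp (fst w))).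
exists d; first by apply: Rmin_pos; [lra|apply: Rdiv_lt_0_compat; lra].
move=> h hh.
have h1 : Cmod h <= / 2 by have := Rmin_l (/ 2) (eta / (10 * exp (fst w))); rewrite /d in hh; lra.
have h2 : Cmod h <= eta / (10 * exp (fst w)) by have := Rmin_r (/ 2) (eta / (10 * exp (fst w))); rewrite /d in hh; lra.
rewrite (_ : minus _ _ = Cmult (cexp w) (Cminus (Cminus (cexp h) (RtoC 1)) h)); last first.
  by rewrite cexp_plus; Cring.
rewrite /norm /= Cmod_mult Cmod_cexp.
apply: Rle_trans (Rmult_le_compat_l _ _ _ (Rlt_le _ _ m0) (cexp_taylor1 h1)) _.
have := Cmod_ge_0 h => hm.
have : exp (fst w) * 10 * Cmod h <= eta.
  have := Rmult_le_compat_l (10 * exp (fst w)) _ _ ltac:(lra) h2.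
  rewrite (_ : 10 * exp (fst w) * (eta / _) = eta); first lra.
  by field; lra.
move=> /(Rmult_le_compat_r (Cmod h) _ _ hm); rewrite /=; lra.
Qed.

Lemma Carg_abs z : Rabs (Carg z) = Ratan.acos (Re z / Cmod z).
Proof.
have h := Ratan.acos_bound (Re z / Cmod z).
rewrite /Carg; case: Rle_dec => ? /=; rewrite ?Rabs_Ropp Rabs_pos_eq //; lra.
Qed.

Lemma Re_div_Cmod_bound z : z <> RtoC 0 -> -1 <= Re z / Cmod z <= 1.
Proof.
move=> /Cmod_gt_0 m0; have /Rabs_le_between h := re_le_Cmod z.
split; first by apply/Rle_div_r => //; lra.
by apply/Rle_div_l => //; lra.
Qed.

(** Monotonicity of [cos] on [[0, PI]] replaces the argument by a condition on the real part, which
    behaves well under products, dilations and small perturbations. *)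
Lemma sectorE phi z : 0 < phi < PI ->
  sector phi z <-> (z <> RtoC 0 /\ cos phi * Cmod z < Re z).
Proof.
move=> hphi; split => -[z0 h]; split => //; have m0 := proj1 (Cmod_gt_0 z) z0;
  have hb := Re_div_Cmod_bound z0.
- move: h; rewrite Carg_abs => h.
  apply/Rlt_div_r => //; rewrite -(Ratan.cos_acos (Re z / Cmod z)) //.
  apply: cos_decreasing_1; try lra; have := Ratan.acos_bound (Re z / Cmod z); lra.
- rewrite Carg_abs; apply: Rnot_le_lt => h1.
  have := Ratan.acos_bound (Re z / Cmod z) => h2.
  have := cos_decr_1 phi (Ratan.acos (Re z / Cmod z)) ltac:(lra) ltac:(lra) ltac:(lra) ltac:(lra) h1.
  rewrite Ratan.cos_acos // => /(Rmult_le_compat_r (Cmod z) _ _ ltac:(lra)).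
  rewrite /Rdiv Rmult_assoc Rinv_l; lra.
Qed.

Lemma Carg_gt sigma z : 0 < sigma < PI -> z <> RtoC 0 ->
  Re z < cos sigma * Cmod z -> sigma < Rabs (Carg z).
Proof.
move=> hs z0 h; have m0 := proj1 (Cmod_gt_0 z) z0; have hb := Re_div_Cmod_bound z0.
rewrite Carg_abs; apply: Rnot_le_lt => h1.
have h2 := Ratan.acos_bound (Re z / Cmod z).
have := cos_decr_1 (Ratan.acos (Re z / Cmod z)) sigma ltac:(lra) ltac:(lra) ltac:(lra) ltac:(lra) h1.
rewrite Ratan.cos_acos // => /(Rmult_le_compat_r (Cmod z) _ _ ltac:(lra)).
rewrite /Rdiv Rmult_assoc Rinv_l; lra.
Qed.

Lemma polar z : z <> RtoC 0 -> z = cexp (ln (Cmod z), Carg z).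
Proof.
move=> z0; have m0 := proj1 (Cmod_gt_0 z) z0; have hb := Re_div_Cmod_bound z0.
have hc : cos (Carg z) = Re z / Cmod z.
  by rewrite /Carg; case: Rle_dec => ? /=; rewrite ?cos_neg Ratan.cos_acos.
have hm : Cmod z ^ 2 = Re z ^ 2 + Im z ^ 2 by exact: Cmod2_alt.
have hs : sin (Carg z) = Im z / Cmod z.
  have e : sqrt (1 - Rsqr (Re z / Cmod z)) = Rabs (Im z) / Cmod z.
    rewrite -(sqrt_Rsqr (Rabs (Im z) / Cmod z)); last first.
      by apply: Rdiv_le_0_compat => //; exact: Rabs_pos.
    congr sqrt; rewrite /Rsqr.
    rewrite (_ : Rabs (Im z) / Cmod z * _ = Rabs (Im z) ^ 2 / Cmod z ^ 2); last by field; lra.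
    rewrite pow2_abs (_ : Im z ^ 2 = Cmod z ^ 2 - Re z ^ 2); last lra.
    by field; lra.
  rewrite /Carg; case: Rle_dec => [i0|i1] /=.
    by rewrite Ratan.sin_acos // e Rabs_pos_eq.
  have i0 := Rnot_le_lt _ _ i1.
  by rewrite sin_neg Ratan.sin_acos // e Rabs_left //; field; lra.
rewrite /cexp /= exp_ln // hc hs; apply: injective_projections => /=; rewrite /Re /Im; field; lra.
Qed.

Lemma cos_Rabs t : cos (Rabs t) = cos t.
Proof. by rewrite /Rabs; case: Rcase_abs => _ //; rewrite cos_neg. Qed.

Lemma sector_cexp phi s th : phi < PI -> Rabs th < phi -> sector phi (cexp (s, th)).
Proof.
move=> hphi hth; have := Rabs_pos th => th0.
apply/sectorE; first lra.
split; first exact: cexp_neq0.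
rewrite Cmod_cexp /= Rmult_comm; apply: Rmult_lt_compat_l; first exact: exp_pos.
rewrite -(cos_Rabs th).
by apply: cos_decreasing_1; lra.
Qed.

Lemma sector_polar phi z : sector phi z ->
  exists s th, [/\ z = cexp (s, th), Rabs th < phi & s = ln (Cmod z)].
Proof. by move=> [z0 h]; exists (ln (Cmod z)), (Carg z); split => //; exact: polar. Qed.

(** If the cosine of the angle between [z] and [b] is at least [c], then [|z + b|^2] exceeds
    [(1 + c) / 2 * (|z| + |b|)^2] by at least [(1 - c) / 2 * (|z| - |b|)^2]. All lower bounds on
    denominators below come from this. *)
Lemma Cmod_plus_ge c : -1 < c <= 1 -> exists2 k, 0 < k & forall z b,
  c * (Cmod z * Cmod b) <= Re (Cmult z (Cconj b)) ->
  k * (Cmod z + Cmod b) <= Cmod (Cplus z b).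
Proof.
move=> hc; exists (sqrt ((1 + c) / 2)); first by apply: sqrt_lt_R0; lra.
move=> z b h; apply: Rsqr_incr_0_var; last exact: Cmod_ge_0.
rewrite Rsqr_mult Rsqr_sqrt; last lra.
rewrite !Rsqr_pow2 Cmod2_alt.
have hz := Cmod2_alt z; have hb := Cmod2_alt b.
have e : Re (Cplus z b) ^ 2 + Im (Cplus z b) ^ 2 = Cmod z ^ 2 + Cmod b ^ 2 + 2 * Re (Cmult z (Cconj b)).
  by rewrite hz hb /Re /Im /=; ring.
rewrite e; have := pow2_ge_0 (Cmod z - Cmod b); nra.
Qed.

End exponential.

(** * Resolvents of sectorial operators *)

(** The condition [|arg z| >= nu] in terms of the real part. It is not strict, so the rays of angle
    [nu] and [- nu] that form the contour belong to the region. *)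
Definition outside (nu : R) (z : C) : Prop :=
  z <> RtoC 0 /\ Re z <= cos nu * Cmod z.

Lemma cos_le_outer nu th : 0 <= nu <= PI -> nu <= th <= 2 * PI - nu -> cos th <= cos nu.
Proof.
move=> hnu hth; have [th1|th1] := Rle_lt_dec th PI.
  by apply: cos_decr_1; lra.
have <- : cos (2 * PI - th) = cos th.
  by rewrite cos_minus cos_2PI sin_2PI; ring.
by apply: cos_decr_1; lra.
Qed.

Lemma outside_cexp nu s th : cos th <= cos nu -> outside nu (cexp (s, th)).
Proof.
move=> h; split; first exact: cexp_neq0.
rewrite Cmod_cexp /= Rmult_comm; apply: Rmult_le_compat_r => //.
exact: Rlt_le (exp_pos s).
Qed.

(** The smaller angle leaves room [cos nu - cos nu' > 0] in proportion to [|z|], while [h] changes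
    the real part and the modulus by at most [|h|] each. *)
Lemma outside_near nu nu' z : 0 <= nu -> nu < nu' <= PI -> outside nu' z ->
  exists2 d, 0 < d & forall h, Cmod h < d -> outside nu (Cplus z h) /\ Cmod z / 2 <= Cmod (Cplus z h).
Proof.
move=> nu0 hnu [z0 hz]; have m0 := proj1 (Cmod_gt_0 z) z0.
have hc : cos nu' < cos nu by apply: cos_decreasing_1; lra.
exists (Rmin (Cmod z / 2) ((cos nu - cos nu') * Cmod z / 2)).
  apply: Rmin_pos; first lra.
  by apply: Rdiv_lt_0_compat; [apply: Rmult_lt_0_compat; lra|lra].
move=> h /Rmin_Rgt_l [h1 h2].
have t1 := Cmod_triangle (Cplus z h) (Copp h); rewrite Cmod_opp in t1.
rewrite (_ : Cplus (Cplus z h) (Copp h) = z) in t1; last by ring.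
have m1 : Cmod z / 2 <= Cmod (Cplus z h) by lra.
split => //; split; first by apply/Cmod_gt_0; lra.
have hr : Re (Cplus z h) <= Re z + Cmod h.
  by rewrite /Re /=; have := Rabs_fst_le h; have := Rle_abs (fst h); rewrite /=; lra.
have cb := COS_bound nu.
have : cos nu * (Cmod z - Cmod (Cplus z h)) <= Cmod h.
  have t2 := Cmod_triangle z h.
  have : Rabs (Cmod z - Cmod (Cplus z h)) <= Cmod h by apply: Rabs_le; lra.
  move=> h3; apply: Rle_trans (Rle_abs _) _; rewrite Rabs_mult.
  have : Rabs (cos nu) <= 1 by apply: Rabs_le; lra.
  have := Rabs_pos (Cmod z - Cmod (Cplus z h)); have := Rabs_pos (cos nu); nra.
nra.
Qed.

Section resolvent_bound.
Context (X : CompleteNormedModule C_AbsRing) (A : operator X).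

Lemma resolvent_unique z T : is_resolvent A z T -> resolvent A z = T.
Proof.
move=> [[_ _ _] [h1 h2]]; apply: functional_extensionality => x.
apply: iota_unique; last exact: h1.
by move=> y [hy <-]; rewrite h2.
Qed.

(** Every point of the spectrum is a limit of points of the sector of angle [omega], but a whole
    neighbourhood of [z] avoids that sector. *)
Lemma sectorial_spectrum omega nu z : sectorial A omega -> omega < nu <= PI ->
  outside nu z -> is_resolvent A z (resolvent A z).
Proof.
move=> [hom [_ [_ [_ [hs _]]]]] hnu hz.
apply: NNPP => hn.
have sp : spectrum A z.
  by move=> [T hT]; apply: hn; rewrite (resolvent_unique hT).
have [d d0 hd] := outside_near (nu := omega) ltac:(lra) hnu hz.
have [y [/= hy1 [y0 hy2]]] := hs z sp (ball_norm (V := C_NormedModule) z (mkposreal _ d0)) (locally_ball_norm (V := C_NormedModule) z (mkposreal _ d0)).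
have : outside omega y.
  have := hd (minus y z : C) hy1.
  by rewrite (_ : Cplus z (minus y z) = y); [case|Cring].
move=> [_ hy3].
have [_] := proj1 (sectorE y hom) (conj y0 hy2); lra.
Qed.

Lemma sectorial_resolvent_bound omega nu : sectorial A omega -> omega < nu <= PI ->
  exists2 M, 0 <= M & forall z, outside nu z ->
    is_resolvent A z (resolvent A z) /\
    forall x, Cmod z * norm (resolvent A z x) <= M * norm x.
Proof.
move=> hA hnu; have [hom [_ [_ [_ [_ hb]]]]] := hA.
(* The definition of sectoriality bounds the resolvent only where [|arg z|] exceeds the chosen angle
   strictly; an angle below [nu] includes the rays of angle [nu]. *)
have [M hM] := hb ((omega + nu) / 2) ltac:(lra).
exists (Rmax M 0); first exact: Rmax_r.
move=> z hz; split; first exact: sectorial_spectrum hA hnu hz.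
move=> x; rewrite -norm_scalC_eq.
apply: Rle_trans (hM z _ _ x) _.
- by case: hz.
- case: hz => z0 hz; apply: Carg_gt => //; first lra.
  apply: Rle_lt_trans hz _; apply: Rmult_lt_compat_r; first exact/Cmod_gt_0.
  by apply: cos_decreasing_1; lra.
- by apply: Rmult_le_compat_r; [exact: norm_ge_0|exact: Rmax_l].
Qed.

End resolvent_bound.

Section resolvent_theory.
Context (X : CompleteNormedModule C_AbsRing) (A : operator X) (nu M : R).
Context (nu_bound : 0 < nu < PI) (M_ge0 : 0 <= M).
Context (hR : forall z, outside nu z -> is_resolvent A z (resolvent A z) /\
    forall x, Cmod z * norm (resolvent A z x) <= M * norm x).
Local Notation Rz := (resolvent A).

Lemma resolvent_linear z : outside nu z -> is_linear (Rz z).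
Proof. by move=> /hR [[]]. Qed.

Lemma resolvent_dom z x : outside nu z -> op_dom A (Rz z x).
Proof. by move=> /hR [[_ [/(_ x) [] h _]]]. Qed.

Lemma resolvent_eq z x : outside nu z -> A (Rz z x) = minus (scal z (Rz z x)) x.
Proof.
move=> /hR [[_ [/(_ x) [_ h] _]] _]; rewrite -{3}h; module X.
Qed.

Lemma resolvent_A z x : outside nu z -> op_dom A x ->
  Rz z (A x) = minus (scal z (Rz z x)) x.
Proof.
move=> hz hx; have [[hl [_ /(_ x hx) h]] _] := hR hz.
move: h; rewrite linear_minus // (linear_scal _ hl) => h.
rewrite -{3}h; module X.
Qed.

Lemma resolvent_identity z w x : outside nu z -> outside nu w ->
  minus (Rz z x) (Rz w x) = scal (Cminus w z) (Rz z (Rz w x)).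
Proof.
move=> hz hw; have hl := resolvent_linear hz.
have e : x = minus (scal w (Rz w x)) (A (Rz w x)).
  by rewrite resolvent_eq //; module X.
rewrite {1}e linear_minus // (resolvent_A hz (resolvent_dom x hw)) (linear_scal _ hl).
module X.
Qed.

Lemma resolvent_norm z x : outside nu z -> norm (Rz z x) <= M / Cmod z * norm x.
Proof.
move=> hz; have [_ /(_ x) h] := hR hz.
have m0 := proj1 (Cmod_gt_0 z) (proj1 hz).
rewrite (_ : M / Cmod z * norm x = M * norm x / Cmod z); last by field; lra.
by apply/Rle_div_r => //; lra.
Qed.

(** Two uses of the resolvent identity turn the remainder into [h^2 R(z + h) R(z) R(z) x]. The gap
    between [nu] and [nu'] keeps [z + h] where the resolvent bound holds. *)
Lemma cdiff_resolvent nu' z x : nu < nu' <= PI -> outside nu' z ->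
  cdiff (fun w => Rz w x) z (opp (Rz z (Rz z x))).
Proof.
move=> hnu hz eta eta0.
have [d d0 hd] := outside_near (nu := nu) ltac:(lra) hnu hz.
have m0 := proj1 (Cmod_gt_0 z) (proj1 hz).
have hz1 : outside nu z by have [] := hd (RtoC 0) ltac:(by rewrite Cmod_0); rewrite Cplus_0_r.
pose B := 2 * M / Cmod z * norm (Rz z (Rz z x)).
have B0 : 0 <= B.
  by apply: Rmult_le_pos; [apply: Rdiv_le_0_compat; lra|exact: norm_ge_0].
exists (Rmin d (eta / (B + 1))).
  by apply: Rmin_pos => //; apply: Rdiv_lt_0_compat; lra.
move=> h /Rmin_Rgt_l [h1 h2]; have [hzh mzh] := hd h h1.
have e1 := resolvent_identity x hzh hz1.
have e2 := resolvent_identity (Rz z x) hzh hz1.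
rewrite e1 (_ : minus _ _ = scal (Copp h) (minus (Rz (Cplus z h) (Rz z x)) (Rz z (Rz z x)))); last by module X.
rewrite e2 norm_scalC_eq norm_scalC_eq Cmod_opp.
rewrite (_ : Cminus z (Cplus z h) = Copp h); last by ring.
rewrite Cmod_opp.
have hh := Cmod_ge_0 h.
have b1 : norm (Rz (Cplus z h) (Rz z (Rz z x))) <= B.
  apply: Rle_trans (resolvent_norm _ hzh) _; apply: Rmult_le_compat_r; first exact: norm_ge_0.
  rewrite /Rdiv (Rmult_comm 2) Rmult_assoc; apply: Rmult_le_compat_l => //.
  rewrite (_ : 2 * / Cmod z = / (Cmod z / 2)); last by field; lra.
  by apply: Rinv_le_contravar; lra.
have b2 : Cmod h * (B + 1) <= eta.
  by apply/Rle_div_r; lra.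
rewrite (_ : Cmod h * (Cmod h * _) = (Cmod h * norm (Rz (Cplus z h) (Rz z (Rz z x)))) * Cmod h); last by ring.
apply: Rmult_le_compat_r => //.
apply: Rle_trans (_ : Cmod h * (B + 1) <= _) => //.
by apply: Rmult_le_compat_l => //; lra.
Qed.

End resolvent_theory.

(** * The Dunford calculus *)

(** Holomorphic functions of class [H^oo_0] up to a constant factor:
    [decay eps (ln r) = r^eps / (1 + r^(2 eps))]. *)
Definition holo_decay (phi eps K : R) (v : C -> C) : Prop :=
  [/\ 0 < eps,
      (forall z, sector phi z -> exists l, cdiff (v : C -> C_NormedModule) z l) &
      forall z, sector phi z -> Cmod (v z) <= K * decay eps (ln (Cmod z))].

Section holo_decay_theory.

Lemma sector_mono phi phi' z : phi <= phi' -> sector phi z -> sector phi' z.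
Proof. by move=> h [z0 hz]; split => //; lra. Qed.

Lemma holo_decay_mono phi phi' eps K v : phi <= phi' ->
  holo_decay phi' eps K v -> holo_decay phi eps K v.
Proof.
move=> h [e0 h1 h2]; split => // z hz; [apply: h1|apply: h2]; exact: sector_mono hz.
Qed.

Lemma decay_Rpower eps r : 0 < r ->
  Rpower r eps / (1 + Rpower r (2 * eps)) = decay eps (ln r).
Proof.
move=> r0; rewrite /Rpower /decay.
rewrite (_ : 2 * eps * ln r = eps * ln r + eps * ln r); last by ring.
rewrite exp_plus exp_Ropp; have := exp_pos (eps * ln r) => h.
by field; split; nra.
Qed.

Lemma Hinf0_holo_decay phi v : Hinf0 phi v -> exists eps, holo_decay phi eps 1 v.
Proof.
move=> [[h1 _] [eps e0 h2]]; exists eps; split => //.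
- by move=> z /h1 /cdiff_of_ex_derive.
- move=> z hz; rewrite Rmult_1_l -decay_Rpower; first exact: h2.
  by apply/Cmod_gt_0; case: hz.
Qed.

Lemma holo_decay_Hinf0 phi eps K v : K <= 1 -> holo_decay phi eps K v -> Hinf0 phi v.
Proof.
move=> K1 [e0 h1 h2]; split.
  split; first by move=> z /h1 [l /cdiff_ex_derive].
  exists (Rabs K) => z /h2 /Rle_trans; apply.
  have := decay_gt0 eps (ln (Cmod z)); have := decay_le_half eps (ln (Cmod z)).
  have := Rle_abs K; have := Rabs_pos K; nra.
exists eps => // z hz; rewrite decay_Rpower; last by apply/Cmod_gt_0; case: hz.
apply: Rle_trans (h2 z hz) _; have := decay_gt0 eps (ln (Cmod z)); nra.
Qed.

Lemma holo_decay_K_ge0 phi eps K v : 0 < phi < PI -> holo_decay phi eps K v -> 0 <= K.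
Proof.
move=> hphi [e0 _ h].
have := h (cexp (0, 0)) ltac:(by apply: sector_cexp; rewrite ?Rabs_R0; lra).
have := Cmod_ge_0 (v (cexp (0, 0))); have := decay_gt0 eps (ln (Cmod (cexp (0, 0)))).
set d := decay _ _; set m := Cmod _; nra.
Qed.

Lemma holo_decay_plus phi eps K L v w : holo_decay phi eps K v -> holo_decay phi eps L w ->
  holo_decay phi eps (K + L) (fun z => Cplus (v z) (w z)).
Proof.
move=> [e0 h1 h2] [_ h3 h4]; split => // z hz.
- have [l hl] := h1 z hz; have [m hm] := h3 z hz.
  by exists (plus l m); exact: cdiff_plus hl hm.
- apply: Rle_trans (Cmod_triangle _ _) _; have := h2 z hz; have := h4 z hz; lra.
Qed.

Lemma holo_decay_mult phi eps K B u v :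
  (forall z, sector phi z -> exists l, cdiff (u : C -> C_NormedModule) z l) ->
  (forall z, sector phi z -> Cmod (u z) <= B) ->
  holo_decay phi eps K v -> holo_decay phi eps (B * K) (fun z => Cmult (u z) (v z)).
Proof.
move=> hu hB [e0 h1 h2]; split => // z hz.
- have [l hl] := h1 z hz; have [m hm] := hu z hz.
  by exists (plus (scal m (v z : C_NormedModule)) (scal (u z) l)); exact: cdiff_scal hm hl.
- rewrite Cmod_mult Rmult_assoc.
  by apply: Rmult_le_compat; [exact: Cmod_ge_0|exact: Cmod_ge_0|exact: hB|exact: h2].
Qed.

Lemma holo_decay_scal phi eps K c v : holo_decay phi eps K v ->
  holo_decay phi eps (Cmod c * K) (fun z => Cmult c (v z)).
Proof.
apply: holo_decay_mult => z _; last lra.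
by exists zero; exact: (@cdiff_const C_NormedModule c z).
Qed.

Lemma holo_decay_ext phi eps K v w : (forall z, v z = w z) ->
  holo_decay phi eps K v -> holo_decay phi eps K w.
Proof. by move=> e; rewrite (_ : v = w) //; exact: functional_extensionality. Qed.

Lemma holo_decay_ub phi eps K L v : K <= L -> holo_decay phi eps K v -> holo_decay phi eps L v.
Proof.
move=> KL [e0 h1 h2]; split => // z hz; apply: Rle_trans (h2 z hz) _.
have := decay_gt0 eps (ln (Cmod z)); nra.
Qed.

Lemma holo_decay0 phi eps : 0 < eps -> holo_decay phi eps 0 (fun=> RtoC 0).
Proof.
move=> e0; split => // z _; last by rewrite Cmod_0; lra.
by exists zero; exact: (@cdiff_const C_NormedModule (RtoC 0) z).
Qed.

Lemma cdiff_dilate (v : C -> C) lam z l :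
  cdiff (v : C -> C_NormedModule) (Cmult (RtoC lam) z) l ->
  cdiff ((fun w => v (Cmult (RtoC lam) w)) : C -> C_NormedModule) z (Cmult (RtoC lam) l).
Proof.
move=> h.
have hd : cdiff (fun w => Cmult (RtoC lam) w : C_NormedModule) z (RtoC lam).
  have := cdiff_scal (@cdiff_const C_NormedModule (RtoC lam) z) (cdiff_id z).
  by congr cdiff; Cring.
exact: (cdiff_comp hd h).
Qed.

Lemma sector_dilate phi lam z : 0 < lam -> sector phi z -> sector phi (Cmult (RtoC lam) z).
Proof.
move=> l0 [z0 hz]; split.
  by apply: Cmult_neq_0 => //; move/RtoC_inj; lra.
move: hz; rewrite !Carg_abs Cmod_mult Cmod_R Rabs_pos_eq; last lra.
rewrite (_ : Re (Cmult (RtoC lam) z) = lam * Re z); last by rewrite /Re /=; ring.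
rewrite (_ : lam * Re z / _ = Re z / Cmod z) //.
by have m0 := proj1 (Cmod_gt_0 z) z0; field; lra.
Qed.

Lemma holo_decay_dilate phi eps K v lam : 0 < phi < PI -> 0 < lam -> holo_decay phi eps K v ->
  holo_decay phi eps (K * exp (eps * Rabs (ln lam))) (fun z => v (Cmult (RtoC lam) z)).
Proof.
move=> hphi l0 h; have K0 := holo_decay_K_ge0 hphi h; move: h => [e0 h1 h2]; split => // z hz.
- have [l hl] := h1 _ (sector_dilate l0 hz).
  by exists (Cmult (RtoC lam) l); exact: cdiff_dilate.
- have m0 : 0 < Cmod z by apply/Cmod_gt_0; case: hz.
  apply: Rle_trans (h2 _ (sector_dilate l0 hz)) _.
  rewrite Cmod_mult Cmod_R Rabs_pos_eq; last lra.
  rewrite ln_mult // Rplus_comm Rmult_assoc; apply: Rmult_le_compat_l => //.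
  by apply: decay_shift; lra.
Qed.

End holo_decay_theory.

Section dunford.
Context (X : CompleteNormedModule C_AbsRing) (A : operator X).
Local Notation V := (restr_scalars X).

(** On a ray [z = cexp w], so that [dz = z dw]; hence the factor [cexp w]. *)
Definition dunford_integrand (v : C -> C) (x : X) (w : C) : X :=
  scal (Cmult (v (cexp w)) (cexp w)) (resolvent A (cexp w) x).

Lemma ray_integral_line_int th v x l :
  (forall s, continuous ((fun s => dunford_integrand v x (s, th)) : R -> V) s) ->
  is_line_int (fun s => dunford_integrand v x (s, th)) l ->
  ray_integral A th v x = l.
Proof.
move=> hc hl.
have h := @is_line_int_RInt_gen X (fun s => dunford_integrand v x (s, th)) l hc hl.
rewrite /ray_integral.
set u : C := (cos th, sin th).
apply: (@is_RInt_gen_unique V (at_right 0) (Rbar_locally p_infty) _ _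
  (fun r => scal (Cmult (v (Cmult (RtoC r) u)) u) (resolvent A (Cmult (RtoC r) u) x)) l).
apply: (@is_RInt_gen_ext V (at_right 0) (Rbar_locally p_infty) _ _ _ _ l _ h).
exists (fun a => 0 < a) (fun b => 0 < b).
- by exists (mkposreal _ Rlt_0_1) => y _.
- by exists 0.
- move=> a b a0 b0 r [/= hr _].
  have r0 : 0 < r by apply: Rlt_trans hr; exact: Rmin_pos.
  rewrite /dunford_integrand /cexp /= exp_ln //.
  rewrite (_ : (r * cos th, r * sin th) = Cmult (RtoC r) u); last first.
    by apply: injective_projections; rewrite /=; ring.
  set z := Cmult (RtoC r) u.
  rewrite -[scal _ _]/(scal (RtoC (/ r)) (scal (Cmult (v z) z) (resolvent A z x))).
  module X; rewrite /z RtoC_inv; last lra.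
  by field; move/RtoC_inj; lra.
Qed.

Definition dunford_const : C := Cinv (Cmult (RtoC (2 * PI)) Ci).

(** The calculus as a relation that includes the convergence of both ray integrals; linearity and
    changes of [v] can then be proved without any decay condition. [is_dunford_dunford] returns to
    the function [dunford]. *)
Definition is_dunford nu (v : C -> C) (x y : X) : Prop :=
  exists l1 l2, [/\ is_line_int (fun s => dunford_integrand v x (s, - nu)) l1,
    is_line_int (fun s => dunford_integrand v x (s, nu)) l2 &
    y = scal dunford_const (minus l1 l2)].

Lemma is_dunford_fun nu v x y y' : is_dunford nu v x y -> is_dunford nu v x y' -> y = y'.
Proof.
move=> [l1 [l2 [h1 h2 ->]]] [m1 [m2 [h3 h4 ->]]].
by rewrite (is_line_int_unique h1 h3) (is_line_int_unique h2 h4).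
Qed.

Lemma is_dunford_plus nu v w x y y' : is_dunford nu v x y -> is_dunford nu w x y' ->
  is_dunford nu (fun z => Cplus (v z) (w z)) x (plus y y').
Proof.
move=> [l1 [l2 [h1 h2 ->]]] [m1 [m2 [h3 h4 ->]]].
exists (plus l1 m1), (plus l2 m2); split; last by module X.
- apply: is_line_int_ext (is_line_int_plus h1 h3) => s.
  by rewrite /dunford_integrand; module X.
- apply: is_line_int_ext (is_line_int_plus h2 h4) => s.
  by rewrite /dunford_integrand; module X.
Qed.

Lemma is_dunford_scal nu c v x y : is_dunford nu v x y ->
  is_dunford nu (fun z => Cmult c (v z)) x (scal c y).
Proof.
move=> [l1 [l2 [h1 h2 ->]]].
exists (scal c l1), (scal c l2); split; last by module X.
- apply: is_line_int_ext (is_line_int_scal c h1) => s.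
  by rewrite /dunford_integrand; module X.
- apply: is_line_int_ext (is_line_int_scal c h2) => s.
  by rewrite /dunford_integrand; module X.
Qed.

Lemma is_dunford_ext nu v w x y : (forall z, v z = w z) ->
  is_dunford nu v x y -> is_dunford nu w x y.
Proof. by move=> e; rewrite (_ : v = w) //; exact: functional_extensionality. Qed.

Context (omega : R) (hA : sectorial A omega).

Lemma omega_bound : 0 < omega < PI.
Proof. by case: hA. Qed.

Lemma dunford_integrand_cdiff nu v x w : omega < nu <= PI ->
  outside nu (cexp w) -> (exists l, cdiff (v : C -> C_NormedModule) (cexp w) l) ->
  exists d, cdiff (dunford_integrand v x) w d.
Proof.
move=> hnu hw [l hl]; have ho := omega_bound.
pose nu1 := (omega + nu) / 2.
have [M M0 hM] := sectorial_resolvent_bound hA (nu := nu1) ltac:(rewrite /nu1; lra).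
have hr := cdiff_resolvent (nu := nu1) ltac:(rewrite /nu1; lra) M0 hM (nu' := nu) x ltac:(rewrite /nu1; lra) hw.
have h1 := cdiff_comp (cdiff_cexp w) hr.
have h2 := cdiff_scal (cdiff_comp (cdiff_cexp w) hl) (cdiff_cexp w).
by eexists; exact: (cdiff_scal h2 h1).
Qed.

(** The factor [cexp w] coming from [dz] cancels the resolvent bound [M / |z|], so the integrand
    decays exactly as [v] does. *)
Lemma dunford_integrand_norm nu : omega < nu <= PI ->
  exists2 M, 0 <= M & forall v x w, outside nu (cexp w) ->
    norm (dunford_integrand v x w) <= Cmod (v (cexp w)) * M * norm x.
Proof.
move=> hnu; have [M M0 hM] := sectorial_resolvent_bound hA hnu.
exists M => // v x w hw; have [_ /(_ x) h] := hM _ hw.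
rewrite /dunford_integrand norm_scalC_eq Cmod_mult !Rmult_assoc.
by apply: Rmult_le_compat_l => //; exact: Cmod_ge_0.
Qed.

Lemma dunford_integrand_decays phi eps K v x nu : phi < PI -> omega < nu < phi ->
  holo_decay phi eps K v ->
  exists2 M, 0 <= M & forall th, Rabs th < phi -> cos th <= cos nu ->
    decays eps M (fun s => dunford_integrand v x (s, th)).
Proof.
move=> hphi hnu hv; have ho := omega_bound.
have K0 := holo_decay_K_ge0 (phi := phi) ltac:(lra) hv; move: hv => [e0 h1 h2].
have [M M0 hM] := dunford_integrand_norm (nu := nu) ltac:(lra).
exists (K * M * norm x); first by repeat apply: Rmult_le_pos => //; exact: norm_ge_0.
move=> th hth hc; split => // s.
- apply: ccont_hor.
  have [d /cdiff_ccont] // := @dunford_integrand_cdiff nu v x (s, th) ltac:(lra) (outside_cexp s hc) (h1 _ (sector_cexp s hphi hth)).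
- apply: Rle_trans (hM v x (s, th) (outside_cexp s hc)) _.
  have := h2 _ (sector_cexp s hphi hth); rewrite Cmod_cexp ln_exp /= => h3.
  rewrite (_ : K * M * norm x * _ = K * decay eps s * (M * norm x)); last by ring.
  rewrite Rmult_assoc; apply: Rmult_le_compat_r => //.
  by apply: Rmult_le_pos => //; exact: norm_ge_0.
Qed.

Lemma is_dunford_dunford phi eps K v x nu : phi < PI -> omega < nu < phi ->
  holo_decay phi eps K v -> is_dunford nu v x (dunford A nu v x).
Proof.
move=> hphi hnu hv; have ho := omega_bound.
have [M M0 hd] := dunford_integrand_decays x hphi hnu hv.
have d1 := hd (- nu) ltac:(by rewrite Rabs_Ropp Rabs_pos_eq; lra) ltac:(by rewrite cos_neg; lra).
have d2 := hd nu ltac:(by rewrite Rabs_pos_eq; lra) ltac:(lra).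
have [l1 h1] := is_line_int_ex d1; have [l2 h2] := is_line_int_ex d2.
exists l1, l2; split => //.
rewrite /dunford (ray_integral_line_int _ h1); last by case: d1.
by rewrite (ray_integral_line_int _ h2) //; case: d2.
Qed.

Lemma is_dunford_rotate phi eps K v x y nu nu' : phi < PI -> omega < nu <= nu' -> nu' < phi ->
  holo_decay phi eps K v -> is_dunford nu v x y -> is_dunford nu' v x y.
Proof.
move=> hphi hnu hnu' hv; have ho := omega_bound.
have [M M0 hd] := dunford_integrand_decays x hphi (nu := nu) ltac:(lra) hv.
have [e0 h1 h2] := hv.
have rot th1 th2 l : th1 <= th2 -> (forall th, th1 <= th <= th2 -> nu <= Rabs th <= nu') ->
    is_line_int (fun s => dunford_integrand v x (s, th1)) l <->
    is_line_int (fun s => dunford_integrand v x (s, th2)) l.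
  move=> h12 hth.
  have hc th : th1 <= th <= th2 -> cos th <= cos nu.
    by move=> /hth h; rewrite -(cos_Rabs th); apply: cos_decr_1; lra.
  apply: (is_line_int_rotate (eps := eps) (M := M) l) => //.
  - move=> s th hs; apply: (@dunford_integrand_cdiff nu); first lra.
      by apply: outside_cexp; exact: hc.
    by apply: h1; apply: sector_cexp => //; have := hth th hs; lra.
  - move=> s th hs; have [_ _] := hd th ltac:(have := hth th hs; lra) (hc th hs).
    exact.
move=> [l1 [l2 [i1 i2 e]]]; exists l1, l2; split => //.
- apply/(rot (- nu') (- nu)) => //; first lra.
  by move=> th hth; rewrite Rabs_left1; lra.
- apply/(rot nu nu') => //; first lra.
  by move=> th hth; rewrite Rabs_pos_eq; lra.
Qed.

(** The bounded calculus is given for one contour, while the final estimates concern every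
    admissible one; this passes between them. *)
Lemma dunford_rotate phi eps K v x nu nu' : phi < PI -> omega < nu -> omega < nu' ->
  nu < phi -> nu' < phi -> holo_decay phi eps K v ->
  dunford A nu v x = dunford A nu' v x.
Proof.
move=> hphi h1 h2 h3 h4 hv.
have d1 := is_dunford_dunford x hphi (conj h1 h3) hv.
have d2 := is_dunford_dunford x hphi (conj h2 h4) hv.
have [h|/Rlt_le h] := Rle_lt_dec nu nu'.
  exact: (is_dunford_fun (is_dunford_rotate hphi (conj h1 h) h4 hv d1) d2).
exact: (is_dunford_fun d1 (is_dunford_rotate hphi (conj h2 h) h3 hv d2)).
Qed.

End dunford.

Lemma Hinf_norm_le sigma v B : 0 < sigma < PI ->
  (forall z, sector sigma z -> Cmod (v z) <= B) -> 0 <= Hinf_norm sigma v <= B.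
Proof.
move=> hs hB; rewrite /Hinf_norm.
set E := fun r => _; have [ub lub] := Lub_Rbar_correct E.
have hz : sector sigma (cexp (0, 0)) by apply: sector_cexp; rewrite ?Rabs_R0; lra.
have := ub (Cmod (v (cexp (0, 0)))) (ex_intro2 _ _ (cexp (0, 0)) hz erefl).
have : Rbar_le (Lub_Rbar E) (Finite B) by apply: lub => _ [z hz' ->]; exact: hB.
case: (Lub_Rbar E) => [l| |] //= h1 h2.
by have := Cmod_ge_0 (v (cexp (0, 0))); lra.
Qed.

Lemma cos_ge_m1 t : -1 <= cos t.
Proof. exact: (proj1 (COS_bound t)). Qed.

(** * Cauchy kernels on sectors *)

Section rational_functions.

Definition cauchy_kernel (b : R) (z : C) : C := Cinv (Cplus z (RtoC b)).

Lemma sector_plus_ge sigma : 0 < sigma < PI -> exists2 k, 0 < k & forall z b,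
  0 <= b -> cos sigma * Cmod z <= Re z -> k * (Cmod z + b) <= Cmod (Cplus z (RtoC b)).
Proof.
move=> hs; have hc : -1 < cos sigma <= 1.
  split; last exact: (proj2 (COS_bound sigma)).
  by rewrite -cos_PI; apply: cos_decreasing_1; lra.
have [k k0 hk] := Cmod_plus_ge hc; exists k => // z b b0 hz.
have := hk z (RtoC b); rewrite Cmod_R Rabs_pos_eq //; apply.
rewrite (_ : Re _ = Re z * b); last by rewrite /Re /=; ring.
by rewrite -Rmult_assoc; apply: Rmult_le_compat_r.
Qed.

Lemma plus_real_neq0 z b : 0 < b -> (exists2 c, -1 < c & c * Cmod z <= Re z) ->
  Cplus z (RtoC b) <> RtoC 0.
Proof.
move=> b0 [c hc h] e; have ez : z = RtoC (- b).
  have -> : z = Cminus (Cplus z (RtoC b)) (RtoC b) by ring.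
  by rewrite e RtoC_opp; ring.
move: h; rewrite ez Cmod_R Rabs_Ropp Rabs_pos_eq; last lra.
rewrite /Re /=; nra.
Qed.

Lemma sector_Re sigma z : 0 < sigma < PI -> sector sigma z -> cos sigma * Cmod z <= Re z.
Proof. by move=> hs /(sectorE _ hs) [_ /Rlt_le]. Qed.

Lemma cos_gt_m1 sigma : 0 <= sigma < PI -> -1 < cos sigma.
Proof. by move=> hs; rewrite -cos_PI; apply: cos_decreasing_1; lra. Qed.

Lemma sector_plus_neq0 sigma z b : 0 < sigma < PI -> 0 < b -> sector sigma z ->
  Cplus z (RtoC b) <> RtoC 0.
Proof.
move=> hs b0 hz; apply: plus_real_neq0 => //; exists (cos sigma); first by apply: cos_gt_m1; lra.
exact: sector_Re.
Qed.

Lemma cdiff_cauchy_kernel b z : Cplus z (RtoC b) <> RtoC 0 ->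
  exists l, cdiff (cauchy_kernel b : C -> C_NormedModule) z l.
Proof.
move=> h.
have h1 := cdiff_plus (cdiff_id z) (@cdiff_const C_NormedModule (RtoC b) z).
eexists; exact: (cdiff_comp h1 (cdiff_Cinv h)).
Qed.

Lemma cauchy_kernel_bound sigma : 0 < sigma < PI -> exists2 k, 0 < k & forall z b,
  0 < b -> sector sigma z -> Cmod (cauchy_kernel b z) <= k / b /\
  Cmod (Cmult z (cauchy_kernel b z)) <= k /\
  Cmod (cauchy_kernel b z) <= k / Cmod z.
Proof.
move=> hs; have [k k0 hk] := sector_plus_ge hs; exists (/ k); first exact: Rinv_0_lt_compat.
move=> z b b0 hz; have h0 := sector_plus_neq0 hs b0 hz.
have := hk z b ltac:(lra) (sector_Re hs hz).
have m0 : 0 < Cmod z by apply/Cmod_gt_0; case: hz.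
have p0 := proj1 (Cmod_gt_0 _) h0.
rewrite Cmod_mult /cauchy_kernel Cmod_inv //.
set m := Cmod z in m0 *; set p := Cmod (Cplus z (RtoC b)) in p0 * => h.
have ik : 0 < / k by exact: Rinv_0_lt_compat.
have h1 : / p <= / (k * (m + b)).
  by apply: Rinv_le_contravar => //; apply: Rmult_lt_0_compat; lra.
have h2 : / (k * (m + b)) <= / k / b.
  rewrite /Rdiv -Rinv_mult; apply: Rinv_le_contravar; first exact: Rmult_lt_0_compat.
  by apply: Rmult_le_compat_l; lra.
have h3 : / (k * (m + b)) <= / k / m.
  rewrite /Rdiv -Rinv_mult; apply: Rinv_le_contravar; first exact: Rmult_lt_0_compat.
  by apply: Rmult_le_compat_l; lra.
split; first lra; split; last lra.
have := Rmult_le_compat_l m _ _ ltac:(lra) (Rle_trans _ _ _ h1 h3).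
by rewrite (_ : m * (/ k / m) = / k) //; field; lra.
Qed.

End rational_functions.

(** For a scalar function holomorphic on the whole sector the contour may be rotated across the
    positive axis. The rays of angle [nu] and [- nu] thus give the same value, and such a term drops
    out of a Dunford integral. *)
Lemma line_int_sector (X : CompleteNormedModule C_AbsRing) sigma eps K (h : C -> C) (x : X) :
  0 < sigma < PI -> holo_decay sigma eps K h -> exists l, forall th, Rabs th < sigma ->
    is_line_int (fun s => scal (h (cexp (s, th))) x) l.
Proof.
move=> hs hh; have K0 := holo_decay_K_ge0 hs hh; have [e0 h1 h2] := hh.
pose F w := scal (h (cexp w)) x.
have dF w : Rabs (snd w) < sigma -> exists d, cdiff F w d.
  case: w => s th hw; have [l hl] := h1 _ (sector_cexp s (proj2 hs) hw).
  eexists; exact: (cdiff_scal (cdiff_comp (cdiff_cexp (s, th)) hl) (@cdiff_const X x (s, th))).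
have nF s th : Rabs th < sigma -> norm (F (s, th)) <= K * norm x * decay eps s.
  move=> hth; rewrite /F norm_scalC_eq.
  have := h2 _ (sector_cexp s (proj2 hs) hth); rewrite Cmod_cexp ln_exp /= => h3.
  rewrite (_ : K * norm x * _ = K * decay eps s * norm x); last by ring.
  by apply: Rmult_le_compat_r => //; exact: norm_ge_0.
have R0 : Rabs 0 < sigma by rewrite Rabs_R0; lra.
have dec : decays eps (K * norm x) (fun s => F (s, 0)).
  split => // s; last exact: nF.
  by have [d /cdiff_ccont /ccont_hor] := dF (s, 0) R0.
have [l hl] := is_line_int_ex dec; exists l => th hth.
have rot th1 th2 : th1 <= th2 -> Rabs th1 < sigma -> Rabs th2 < sigma ->
    is_line_int (fun s => F (s, th1)) l <-> is_line_int (fun s => F (s, th2)) l.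
  move=> h12 /Rabs_def2 a1 /Rabs_def2 a2.
  apply: (is_line_int_rotate (F := F) (eps := eps) (M := K * norm x) l) => //.
  - by move=> s t ht; apply: dF; apply: Rabs_def1 => /=; lra.
  - by move=> s t ht; apply: nF; apply: Rabs_def1; lra.
have [t0|/Rlt_le t0] := Rle_lt_dec 0 th.
  by apply/(rot 0 th).
by apply/(rot th 0).
Qed.

(** * Multiplying by a Cauchy kernel *)

Section calculus.
Context (X : CompleteNormedModule C_AbsRing) (A : operator X).
Local Notation V := (restr_scalars X).
Context (omega sigma nu : R) (hA : sectorial A omega).
Context (hnu : omega < nu < sigma) (hsigma : sigma < PI).
Context (M : R) (M0 : 0 <= M)
  (hM : forall z, outside nu z -> is_resolvent A z (resolvent A z) /\
    forall x, Cmod z * norm (resolvent A z x) <= M * norm x).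

Let ho : 0 < omega < PI. Proof. exact: omega_bound hA. Qed.
Let hnu' : 0 < nu < PI. Proof. lra. Qed.
Let hs' : 0 < sigma < PI. Proof. lra. Qed.

(** This is [(b + A)^(-1)], the operator belonging to [cauchy_kernel b]; the sign turns the
    resolvent [(- b - A)^(-1)] into it. *)
Definition neg_resolvent (b : R) (x : X) : X := opp (resolvent A (RtoC (- b)) x).
Local Notation Q := neg_resolvent.

Lemma outside_neg b : 0 < b -> outside nu (RtoC (- b)).
Proof.
move=> b0; split; first by move/RtoC_inj; lra.
rewrite Cmod_R Rabs_Ropp Rabs_pos_eq; last lra.
by rewrite /Re /=; have := cos_ge_m1 nu; nra.
Qed.

Lemma neg_resolvent_linear b : 0 < b -> is_linear (Q b).
Proof.
move=> b0; have [hp hs [N [N0 hN]]] := resolvent_linear hM (outside_neg b0).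
split.
- by move=> x y; rewrite /neg_resolvent hp; module X.
- by move=> k x; rewrite /neg_resolvent hs; module X.
- by exists N; split => // x; rewrite /neg_resolvent norm_opp.
Qed.

Lemma neg_resolvent_norm b x : 0 < b -> norm (Q b x) <= M / b * norm x.
Proof.
move=> b0; rewrite /neg_resolvent norm_opp.
have := resolvent_norm hM x (outside_neg b0).
by rewrite Cmod_R Rabs_Ropp Rabs_pos_eq //; lra.
Qed.

Lemma neg_resolvent_A b x : 0 < b -> op_dom A x -> Q b (A x) = minus x (scal (RtoC b) (Q b x)).
Proof.
move=> b0 hx; rewrite /neg_resolvent (resolvent_A hM (outside_neg b0) hx) RtoC_opp.
by module X.
Qed.

Lemma A_neg_resolvent b x : 0 < b -> A (Q b x) = minus x (scal (RtoC b) (Q b x)).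
Proof.
move=> b0; have hd := resolvent_dom hM x (outside_neg b0).
rewrite /neg_resolvent (_ : opp (resolvent A (RtoC (- b)) x) = scal (RtoC (-1)) (resolvent A (RtoC (- b)) x)); last by module X.
rewrite op_fun_scal // (resolvent_eq hM x (outside_neg b0)) RtoC_opp.
by module X.
Qed.

Lemma neg_resolvent_dom b x : 0 < b -> op_dom A (Q b x).
Proof.
move=> b0; have hd := resolvent_dom hM x (outside_neg b0).
rewrite /neg_resolvent (_ : opp (resolvent A (RtoC (- b)) x) = scal (RtoC (-1)) (resolvent A (RtoC (- b)) x)); last by module X.
exact: op_dom_scal.
Qed.

(** Partial fractions, from the resolvent identity at [- b] and [z]. One order of the factors serves
    to pull [Q b] into a contour integral, the other to resolve [R(z) (Q b x)] inside one. *)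
Lemma neg_resolvent_mul b z x : 0 < b -> outside nu z -> Cplus z (RtoC b) <> RtoC 0 ->
  Q b (resolvent A z x) = scal (cauchy_kernel b z) (plus (resolvent A z x) (Q b x)) /\
  resolvent A z (Q b x) = scal (cauchy_kernel b z) (plus (resolvent A z x) (Q b x)).
Proof.
move=> b0 hz h0; have hb := outside_neg b0.
have e1 := resolvent_identity hM x hb hz; have e2 := resolvent_identity hM x hz hb.
rewrite /neg_resolvent /cauchy_kernel; split.
- rewrite (_ : resolvent A (RtoC (- b)) (resolvent A z x) =
    scal (Cinv (Cplus z (RtoC b))) (scal (Cminus z (RtoC (- b))) (resolvent A (RtoC (- b)) (resolvent A z x)))).
    by rewrite -e1; module X.
  by module X; rewrite RtoC_opp; field.
- have hl := resolvent_linear hM hz.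
  rewrite (_ : opp (resolvent A (RtoC (- b)) x) = scal (RtoC (-1)) (resolvent A (RtoC (- b)) x)); last by module X.
  rewrite (linear_scal _ hl).
  rewrite (_ : resolvent A z (resolvent A (RtoC (- b)) x) =
    scal (Cinv (Cplus z (RtoC b))) (scal (Copp (Cminus (RtoC (- b)) z)) (resolvent A z (resolvent A (RtoC (- b)) x)))).
    rewrite (_ : scal (Copp (Cminus (RtoC (- b)) z)) (resolvent A z (resolvent A (RtoC (- b)) x)) =
      opp (minus (resolvent A z x) (resolvent A (RtoC (- b)) x))); last by rewrite e2; module X.
    by module X.
  by module X; rewrite RtoC_opp; field.
Qed.

Lemma outside_ray s th : Rabs th = nu -> outside nu (cexp (s, th)).
Proof. by move=> h; apply: outside_cexp; rewrite -(cos_Rabs th) h; lra. Qed.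

Lemma sector_ray s th : Rabs th = nu -> sector sigma (cexp (s, th)).
Proof. by move=> h; apply: sector_cexp; rewrite ?h; lra. Qed.

(** Pulling [Q b] under the integral and using partial fractions gives the integrand of
    [cauchy_kernel b * v] plus a scalar function times [Q b x]. The latter is holomorphic in the
    sector, so its value [l3] is the same on both rays and cancels. *)
Lemma is_dunford_neg_resolvent eps K v b x y : 0 < b -> holo_decay sigma eps K v ->
  is_dunford A nu v x y -> is_dunford A nu (fun z => Cmult (cauchy_kernel b z) (v z)) x (Q b y).
Proof.
move=> b0 hv [l1 [l2 [h1 h2 ->]]].
have hQ := neg_resolvent_linear b0.
have [k k0 hk] := cauchy_kernel_bound hs'.
have hh : holo_decay sigma eps (k * K) (fun z => Cmult (Cmult z (cauchy_kernel b z)) (v z)).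
  apply: holo_decay_mult hv => z hz; last by case: (hk z b b0 hz) => _ [].
  have [l hl] := cdiff_cauchy_kernel (sector_plus_neq0 hs' b0 hz).
  eexists; exact: (cdiff_scal (cdiff_id z) hl).
have [l3 h3] := line_int_sector (Q b x) hs' hh.
have key th l : Rabs th = nu -> is_line_int (fun s => dunford_integrand A v x (s, th)) l ->
    is_line_int (fun s => dunford_integrand A (fun z => Cmult (cauchy_kernel b z) (v z)) x (s, th))
      (minus (Q b l) l3).
  move=> hth hl; have := is_line_int_minus (is_line_int_lin hQ hl) (h3 th ltac:(lra)).
  apply: is_line_int_ext => s; rewrite /dunford_integrand (linear_scal _ hQ).
  have [-> _] := neg_resolvent_mul x b0 (outside_ray s hth)
    (sector_plus_neq0 hs' b0 (sector_ray s hth)).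
  by module X.
exists (minus (Q b l1) l3), (minus (Q b l2) l3); split.
- by apply: key h1; rewrite Rabs_Ropp Rabs_pos_eq; lra.
- by apply: key h2; rewrite Rabs_pos_eq; lra.
- by rewrite (linear_scal _ hQ) (linear_minus _ l1 l2 hQ); module X.
Qed.

End calculus.

(** * Contour integrals outside the sector *)

Section approximate_identity.
Context (X : CompleteNormedModule C_AbsRing).
Local Notation V := (restr_scalars X).

Lemma is_line_int_decay eps (p : X) : 0 < eps ->
  is_line_int (fun s => scal (RtoC (decay eps s)) p) (scal (RtoC (PI / (2 * eps))) p).
Proof.
move=> e0.
have hc s : continuous ((fun s => scal (RtoC (decay eps s)) p) : R -> V) s.
  by apply: (continuous_scal_l (V := V) (decay eps) p); exact: continuous_decay.
have hi a b : is_RInt (V := V) (fun s => scal (RtoC (decay eps s)) p) a b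
    (scal (RtoC (decay_primitive eps b - decay_primitive eps a)) p).
  have -> : (scal (RtoC (decay_primitive eps b - decay_primitive eps a)) p : V) =
      minus (scal (decay_primitive eps b) (p : V)) (scal (decay_primitive eps a) (p : V)).
    by module X; rewrite RtoC_minus; ring.
  apply: (is_RInt_derive (V := V) (fun s => scal (decay_primitive eps s) (p : V))) => s _ //.
  apply: (is_derive_scal_l (V := V) (decay_primitive eps)).
  exact: is_derive_decay_primitive.
split; first by move=> a b; eexists; exact: hi.
move=> eta eta0; have np := norm_ge_0 p.
have e1 : 0 < eta / (2 * (norm p + 1)) by apply: Rdiv_lt_0_compat; lra.
have [L [L0 hL]] := decay_primitive_tail e0 e1; exists L => a b ha hb.
rewrite (is_RInt_unique (V := V) _ _ _ _ (hi a b)).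
rewrite (_ : minus _ _ = scal (RtoC (decay_primitive eps b - decay_primitive eps a - PI / (2 * eps))) p); last first.
  by module X; rewrite !RtoC_minus; ring.
rewrite norm_scalC_eq Cmod_R.
have t1 := hL (- a) ltac:(lra); have t2 := hL b hb.
rewrite Ropp_involutive in t1; rewrite decay_primitive_opp // in t2.
have t3 := decay_primitive_ge0 a e0; have t4 := decay_primitive_lt b e0.
apply: Rle_lt_trans (_ : 2 * (eta / (2 * (norm p + 1))) * norm p < _).
  by apply: Rmult_le_compat_r => //; apply: Rabs_le; lra.
rewrite (_ : _ * _ = eta * (norm p / (norm p + 1))); last by field; lra.
rewrite -[X in _ < X]Rmult_1_r; apply: Rmult_lt_compat_l => //.
by apply/Rlt_div_l; lra.
Qed.

Lemma decay1 r : 0 < r -> decay 1 (ln r) = r / (1 + r ^ 2).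
Proof.
move=> r0; rewrite /decay Rmult_1_l exp_Ropp exp_ln //.
field; split; last lra; nra.
Qed.

Lemma double_kernel_decay sigma : 0 < sigma < PI -> exists2 k, 0 < k & forall b c, 0 < b -> 0 < c ->
  holo_decay sigma 1 (k * (1 + / (b * c)))
    (fun z => Cmult z (Cmult (cauchy_kernel b z) (cauchy_kernel c z))).
Proof.
move=> hs; have [k k0 hk] := sector_plus_ge hs.
exists (/ k ^ 2); first by apply: Rinv_0_lt_compat; nra.
move=> b c b0 c0; split; first lra.
  move=> z hz.
  have [lb hlb] := cdiff_cauchy_kernel (sector_plus_neq0 hs b0 hz).
  have [lc hlc] := cdiff_cauchy_kernel (sector_plus_neq0 hs c0 hz).
  eexists; exact: (cdiff_scal (cdiff_id z) (cdiff_scal hlb hlc)).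
move=> z hz.
have r0 : 0 < Cmod z by apply/Cmod_gt_0; case: hz.
have nb := sector_plus_neq0 hs b0 hz; have nc := sector_plus_neq0 hs c0 hz.
have hb := hk z b ltac:(lra) (sector_Re hs hz); have hc := hk z c ltac:(lra) (sector_Re hs hz).
rewrite decay1 // !Cmod_mult /cauchy_kernel !Cmod_inv //.
move: hb hc (proj1 (Cmod_gt_0 _) nb) (proj1 (Cmod_gt_0 _) nc).
set r := Cmod z in r0 *; set pb := Cmod _; set pc := Cmod _ => hb hc pb0 pc0.
have kb : 0 < k * (r + b) by apply: Rmult_lt_0_compat; lra.
have kc : 0 < k * (r + c) by apply: Rmult_lt_0_compat; lra.
have i1 : / pb * / pc <= / (k * (r + b)) * / (k * (r + c)).
  by apply: Rmult_le_compat; try (apply: Rlt_le; exact: Rinv_0_lt_compat); apply: Rinv_le_contravar.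
apply: Rle_trans (Rmult_le_compat_l _ _ _ (Rlt_le _ _ r0) i1) _.
have bc0 : 0 < b * c by exact: Rmult_lt_0_compat.
have q0 : 0 < (r + b) * (r + c) by apply: Rmult_lt_0_compat; lra.
have ib : 0 < / (b * c) by exact: Rinv_0_lt_compat.
(* Since [(r + b)(r + c) >= r^2 + b c], the factor [1 + 1 / (b c)] suffices to dominate
   [1 + r^2]. *)
have i2 : / ((r + b) * (r + c)) <= (1 + / (b * c)) / (1 + r ^ 2).
  have pr : 0 < 1 + r ^ 2 by have := pow2_ge_0 r; lra.
  apply/Rle_div_r => //.
  rewrite Rmult_comm; apply/Rle_div_l => //.
  have : / (b * c) * (b * c) = 1 by rewrite Rinv_l; lra.
  have : 0 <= / (b * c) * (r * r + r * (b + c)) by apply: Rmult_le_pos; nra.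
  have : 0 <= r * (b + c) by nra.
  rewrite /=; nra.
rewrite (_ : r * _ = / k ^ 2 * (r * / ((r + b) * (r + c)))); last by field; lra.
rewrite (_ : / k ^ 2 * _ * _ = / k ^ 2 * (r * ((1 + / (b * c)) / (1 + r ^ 2)))); last first.
  by field; repeat split; try lra; have := pow2_ge_0 r; rewrite /=; lra.
apply: Rmult_le_compat_l; first by apply: Rlt_le; apply: Rinv_0_lt_compat; nra.
by apply: Rmult_le_compat_l; lra.
Qed.

(** [Cmod_plus_ge] for [z] and [-1], whose angle has cosine [- Re z / |z| >= - cos nu] outside the
    sector: the pole 1 lies inside the sector, at a distance proportional to [|z| + 1]. *)
Lemma outside_minus1_ge nu : 0 < nu < PI -> exists2 k, 0 < k & forall z,
  outside nu z -> k * (Cmod z + 1) <= Cmod (Cplus z (RtoC (-1))).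
Proof.
move=> hnu.
have hc : -1 < - cos nu <= 1.
  have := cos_ge_m1 nu.
  have : cos nu < 1 by rewrite -cos_0; apply: cos_decreasing_1; lra.
  lra.
have [k k0 hk] := Cmod_plus_ge hc; exists k => // z [_ hz].
have := hk z (RtoC (-1)); rewrite Cmod_R Rabs_Ropp Rabs_R1; apply.
rewrite (_ : Re _ = - Re z); last by rewrite /Re /=; ring.
lra.
Qed.

Context (A : operator X).
Context (omega sigma nu : R) (hA : sectorial A omega).
Context (hnu : omega < nu < sigma) (hsigma : sigma < PI).
Context (M : R) (M0 : 0 <= M)
  (hM : forall z, outside nu z -> is_resolvent A z (resolvent A z) /\
    forall x, Cmod z * norm (resolvent A z x) <= M * norm x).

Let ho : 0 < omega < PI. Proof. exact: omega_bound hA. Qed.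
Let hnu' : 0 < nu < PI. Proof. lra. Qed.
Let hs' : 0 < sigma < PI. Proof. lra. Qed.
Local Notation Q := (neg_resolvent A).

(** For [y] both in the domain and in the range of [A] the integrand decays at both ends: it is
    [R(z) A y - y / (z - 1)], hence [O(1 / |z|)], and [y = A w] makes it [O(|z|)]. Subtracting
    [z / (z - 1)] removes the limit [y] of [z R(z) y] at infinity without a pole outside the sector.
    The contour can therefore be rotated through the complement of the sector, from the angle [nu]
    to [2 PI - nu], which is the ray of angle [- nu]. *)
Lemma line_int_outer (y w : X) : op_dom A y -> op_dom A w -> y = A w ->
  exists g, forall th, Rabs th = nu -> is_line_int (fun s =>
    let z := cexp (s, th) in
    minus (scal z (resolvent A z y)) (scal (Cmult z (cauchy_kernel (-1) z)) y)) g.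
Proof.
move=> hy hw e.
pose G (v : C) := minus (dunford_integrand A (fun=> RtoC 1) y v)
  (scal (Cmult (cexp v) (cauchy_kernel (-1) (cexp v))) y).
have [k k0 hk] := outside_minus1_ge hnu'.
have nz z : outside nu z -> Cplus z (RtoC (-1)) <> RtoC 0.
  move=> hz; apply/Cmod_gt_0; apply: Rlt_le_trans (hk z hz).
  by apply: Rmult_lt_0_compat => //; have := Cmod_ge_0 z; lra.
have dG v : outside nu (cexp v) -> exists d, cdiff G v d.
  move=> hv.
  have [d1 h1] := @dunford_integrand_cdiff X A omega hA nu (fun=> RtoC 1) y v ltac:(lra) hv
    (ex_intro _ _ (@cdiff_const C_NormedModule (RtoC 1) _)).
  have [l hl] := cdiff_cauchy_kernel (nz _ hv).
  have h2 := cdiff_comp (cdiff_cexp v) (cdiff_scal (cdiff_id (cexp v)) hl).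
  have h3 := cdiff_scal h2 (@cdiff_const X y v).
  have h4 := cdiff_scal (@cdiff_const C_NormedModule (RtoC (-1)) v) h3.
  eexists; apply: cdiff_ext (cdiff_plus h1 h4) => u.
  by rewrite /G; module X.
(* These give [|G| <= a1 / |z|] and [|G| <= a2 |z|]; together they yield the decay since the smaller
   of [r] and [1 / r] is at most [2 r / (1 + r^2)]. *)
pose a1 := M * norm (A y) + / k * norm y.
pose a2 := (M + 1) * norm w + / k * norm y.
have ik : 0 < / k by exact: Rinv_0_lt_compat.
have a10 : 0 <= a1.
  by apply: Rplus_le_le_0_compat; apply: Rmult_le_pos; try lra; exact: norm_ge_0.
have a20 : 0 <= a2.
  by apply: Rplus_le_le_0_compat; apply: Rmult_le_pos; try lra; exact: norm_ge_0.
have nG v : outside nu (cexp v) -> norm (G v) <= 2 * (a1 + a2) * decay 1 (fst v).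
  move=> hv; set z := cexp v in hv *.
  have r0 : 0 < Cmod z by apply/Cmod_gt_0; case: hv.
  have eA := resolvent_A hM hv hy; have eW := resolvent_A hM hv hw.
  have mk : Cmod (cauchy_kernel (-1) z) <= / k / (Cmod z + 1).
    rewrite /cauchy_kernel Cmod_inv; last exact: nz.
    rewrite (_ : / k / (Cmod z + 1) = / (k * (Cmod z + 1))); last by field; lra.
    by apply: Rinv_le_contravar; [apply: Rmult_lt_0_compat; lra|exact: hk].
  have mk1 : Cmod (cauchy_kernel (-1) z) <= / k / Cmod z.
    apply: Rle_trans mk _; apply: Rmult_le_compat_l; first lra.
    by apply: Rinv_le_contravar; lra.
  have mk2 : Cmod (cauchy_kernel (-1) z) <= / k.
    apply: Rle_trans mk _; rewrite -[X in _ <= X]Rmult_1_r; apply: Rmult_le_compat_l; first lra.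
    by rewrite -Rinv_1; apply: Rinv_le_contravar; lra.
  have e1 : G v = minus (resolvent A z (A y)) (scal (cauchy_kernel (-1) z) y).
    rewrite eA /G /dunford_integrand -/z; module X; rewrite /cauchy_kernel.
    by field; exact: nz.
  have e2 : G v = scal z (minus (resolvent A z (A w)) (scal (cauchy_kernel (-1) z) y)).
    by rewrite -e /G /dunford_integrand -/z; module X.
  have b1 : norm (G v) <= a1 / Cmod z.
    rewrite e1; apply: Rle_trans (norm_minus_le _ _) _.
    have h1 := resolvent_norm hM (A y) hv; have h2 := norm_scalC (cauchy_kernel (-1) z) y.
    have h3 := Rmult_le_compat_r (norm y) _ _ (norm_ge_0 y) mk1.
    rewrite (_ : a1 / Cmod z = M / Cmod z * norm (A y) + / k / Cmod z * norm y); last first.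
      by rewrite /a1; field; lra.
    norm_lra.
  have b2 : norm (G v) <= a2 * Cmod z.
    rewrite e2 norm_scalC_eq Rmult_comm; apply: Rmult_le_compat_r; first lra.
    apply: Rle_trans (norm_minus_le _ _) _; rewrite eW.
    have h1 := norm_minus_le (scal z (resolvent A z w)) w.
    have [_ /(_ w) h2] := hM hv; rewrite -norm_scalC_eq in h2.
    have h3 := norm_scalC (cauchy_kernel (-1) z) y.
    have h4 := Rmult_le_compat_r (norm y) _ _ (norm_ge_0 y) mk2.
    rewrite /a2; norm_lra.
  have er : Cmod z = exp (fst v) by exact: Cmod_cexp.
  have -> : decay 1 (fst v) = Cmod z / (1 + Cmod z ^ 2) by rewrite -decay1 // er ln_exp.
  set r := Cmod z in r0 b1 b2 *.
  have pr : 0 < 1 + r ^ 2 by have := pow2_ge_0 r; lra.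
  have [r1|r1] := Rle_lt_dec r 1.
    apply: Rle_trans b2 _.
    have : r <= 2 * (r / (1 + r ^ 2)).
      rewrite (_ : 2 * (r / (1 + r ^ 2)) = r * (2 / (1 + r ^ 2))); last by field; lra.
      rewrite -{1}(Rmult_1_r r); apply: Rmult_le_compat_l; first lra.
      by apply/Rle_div_r => //; rewrite /=; nra.
    have : 0 <= r / (1 + r ^ 2) by apply: Rdiv_le_0_compat; lra.
    nra.
  apply: Rle_trans b1 _.
  have : / r <= 2 * (r / (1 + r ^ 2)).
    rewrite (_ : / r = 1 / r); last by field; lra.
    apply/Rle_div_l => //.
    rewrite (_ : 2 * (r / (1 + r ^ 2)) * r = 2 * r ^ 2 / (1 + r ^ 2)); last by field; lra.
    by apply/Rle_div_r => //; rewrite /=; nra.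
  have : 0 <= r / (1 + r ^ 2) by apply: Rdiv_le_0_compat; lra.
  rewrite /Rdiv; nra.
have out s th : nu <= th <= 2 * PI - nu -> outside nu (cexp (s, th)).
  by move=> hth; apply: outside_cexp; apply: cos_le_outer; lra.
have dec : decays 1 (2 * (a1 + a2)) (fun s => G (s, nu)).
  split; first lra.
  - by move=> s; have [d /cdiff_ccont /ccont_hor] := dG (s, nu) (out s nu ltac:(lra)).
  - by move=> s; exact: nG (out s nu ltac:(lra)).
have [g hg] := is_line_int_ex dec.
have hg' : is_line_int (fun s => G (s, 2 * PI - nu)) g.
  apply/(is_line_int_rotate (F := G) (eps := 1) (M := 2 * (a1 + a2)) (th1 := nu) g) => //; try lra.
  - by move=> s th hth; apply: dG; exact: out.
  - by move=> s th hth; apply: (nG (s, th)); exact: out.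
have eqG s th : G (s, th) = (let z := cexp (s, th) in
    minus (scal z (resolvent A z y)) (scal (Cmult z (cauchy_kernel (-1) z)) y)).
  by rewrite /G /dunford_integrand /=; module X.
exists g => th hth; have [th0|th0] := Rle_lt_dec 0 th.
  have <- : nu = th by rewrite -hth Rabs_pos_eq.
  by apply: is_line_int_ext hg => s; rewrite eqG.
have -> : th = - nu by rewrite -hth Rabs_left //; lra.
apply: is_line_int_ext hg' => s.
have -> : G (s, 2 * PI - nu) = G (s, - nu).
  rewrite /G /dunford_integrand; congr (_ _ _); rewrite /cexp /=;
    by rewrite cos_minus sin_minus cos_2PI sin_2PI cos_neg sin_neg !Rmult_0_l !Rmult_1_l Rplus_0_r Rminus_0_l.
by rewrite eqG.
Qed.

End approximate_identity.

(** * A residue on the imaginary axis *)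

Section residue.
Context (X : CompleteNormedModule C_AbsRing).

(** [\int (1/(z-1) - 1/(z+1)) dz] is computed on the imaginary axis. *)
Lemma line_int_residue nu (p : X) : 0 < nu < PI ->
  exists j1 j2, [/\ is_line_int (fun s => let z := cexp (s, - nu) in
      scal (Cminus (Cmult z (cauchy_kernel (-1) z)) (Cmult z (cauchy_kernel 1 z))) p) j1,
    is_line_int (fun s => let z := cexp (s, nu) in
      scal (Cminus (Cmult z (cauchy_kernel (-1) z)) (Cmult z (cauchy_kernel 1 z))) p) j2 &
    scal dunford_const (minus j1 j2) = p].
Proof.
move=> hnu; have pi0 := PI_RGT_0.
pose h z := Cminus (Cmult z (cauchy_kernel (-1) z)) (Cmult z (cauchy_kernel 1 z)).
pose F w := scal (h (cexp w)) p.
(* A band of angles containing [nu] and [PI / 2] and staying inside [(0, PI)], so that neither pole,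
   1 or -1, is met when rotating to the axis. *)
pose t1 := Rmin nu (PI / 2); pose t2 := Rmax nu (PI / 2).
have t1a : 0 < t1 by apply: Rmin_pos; lra.
have t1b : t1 <= nu by exact: Rmin_l.
have t1c : t1 <= PI / 2 by exact: Rmin_r.
have t2a : t2 < PI by apply: Rmax_lub_lt; lra.
have t2b : nu <= t2 by exact: Rmax_l.
have t2c : PI / 2 <= t2 by exact: Rmax_r.
have [k k0 hk] := outside_minus1_ge (nu := t1) ltac:(lra).
have [k' k'0 hk'] := sector_plus_ge (sigma := t2) ltac:(lra).
have low s th : t1 <= Rabs th <= t2 -> outside t1 (cexp (s, th)) /\
    cos t2 * Cmod (cexp (s, th)) <= Re (cexp (s, th)).
  move=> hth; split.
    by apply: outside_cexp; rewrite -(cos_Rabs th); apply: cos_decr_1; lra.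
  rewrite Cmod_cexp /= Rmult_comm; apply: Rmult_le_compat_l; first exact: Rlt_le (exp_pos s).
  by rewrite -(cos_Rabs th); apply: cos_decr_1; lra.
have nz1 s th : t1 <= Rabs th <= t2 -> Cplus (cexp (s, th)) (RtoC (-1)) <> RtoC 0.
  move=> /(low s th) [hz _]; apply/Cmod_gt_0; apply: Rlt_le_trans (hk _ hz).
  by apply: Rmult_lt_0_compat => //; have := Cmod_ge_0 (cexp (s, th)); lra.
have nz2 s th : t1 <= Rabs th <= t2 -> Cplus (cexp (s, th)) (RtoC 1) <> RtoC 0.
  move=> /(low s th) [_ hz]; apply/Cmod_gt_0; apply: Rlt_le_trans (hk' _ 1 ltac:(lra) hz).
  by apply: Rmult_lt_0_compat => //; have := Cmod_ge_0 (cexp (s, th)); lra.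
have dF s th : t1 <= Rabs th <= t2 -> exists d, cdiff F (s, th) d.
  move=> hth; have [l hl] := cdiff_cauchy_kernel (nz1 s th hth).
  have [m hm] := cdiff_cauchy_kernel (nz2 s th hth).
  have c1 := cdiff_scal (cdiff_id _) hl; have c2 := cdiff_scal (cdiff_id _) hm.
  have c3 := cdiff_scal (@cdiff_const C_NormedModule (RtoC (-1)) _) c2.
  have c4 := cdiff_comp (cdiff_cexp (s, th)) (cdiff_plus c1 c3).
  eexists; apply: cdiff_ext (cdiff_scal c4 (@cdiff_const X p _)) => w.
  by rewrite /F /h; module X.
have hE z : Cplus z (RtoC (-1)) <> RtoC 0 -> Cplus z (RtoC 1) <> RtoC 0 ->
    h z = Cmult (RtoC 2) (Cmult z (Cmult (cauchy_kernel (-1) z) (cauchy_kernel 1 z))).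
  by move=> h1 h2; rewrite /h /cauchy_kernel; field.
have nF s th : t1 <= Rabs th <= t2 ->
    norm (F (s, th)) <= 2 / (k * k') * norm p * decay 1 s.
  move=> hth; have [hz1 hz2] := low s th hth.
  rewrite /F norm_scalC_eq hE; [|exact: nz1|exact: nz2].
  have b1 := hk _ hz1; have b2 := hk' _ 1 ltac:(lra) hz2.
  rewrite !Cmod_mult /cauchy_kernel !Cmod_inv; [|exact: nz2|exact: nz1].
  have r0 : 0 < exp s by exact: exp_pos.
  have -> : decay 1 s = exp s / (1 + exp s ^ 2) by rewrite -decay1 // ln_exp.
  move: b1 b2; rewrite Cmod_cexp /= Cmod_R Rabs_pos_eq; last lra.
  set r := exp s in r0 *; set q1 := Cmod _; set q2 := Cmod _ => b1 b2.
  have kb : 0 < k * (r + 1) by apply: Rmult_lt_0_compat; lra.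
  have kc : 0 < k' * (r + 1) by apply: Rmult_lt_0_compat; lra.
  have i1 : / q1 * / q2 <= / (k * (r + 1)) * / (k' * (r + 1)).
    by apply: Rmult_le_compat; try (apply: Rlt_le; apply: Rinv_0_lt_compat; lra); apply: Rinv_le_contravar.
  rewrite (_ : 2 / (k * k') * norm p * _ = 2 / (k * k') * (r / (1 + r * (r * 1))) * norm p); last by ring.
  apply: Rmult_le_compat_r; first exact: norm_ge_0.
  rewrite (_ : 2 / (k * k') * _ = 2 * (r * (/ (k * k') / (1 + r ^ 2)))); last first.
    by field; repeat split; try lra; nra.
  apply: Rmult_le_compat_l; first lra.
  apply: Rmult_le_compat_l; first lra.
  apply: Rle_trans i1 _.
  rewrite -Rinv_mult /Rdiv -Rinv_mult; apply: Rinv_le_contravar.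
    by repeat apply: Rmult_lt_0_compat => //; have := pow2_ge_0 r; lra.
  rewrite (_ : k * (r + 1) * _ = k * k' * ((r + 1) * (r + 1))); last by ring.
  apply: Rmult_le_compat_l; first by apply: Rlt_le; exact: Rmult_lt_0_compat.
  by rewrite /=; nra.
have rot th1 th2 l : th1 <= th2 -> (forall th, th1 <= th <= th2 -> t1 <= Rabs th <= t2) ->
    is_line_int (fun s => F (s, th1)) l <-> is_line_int (fun s => F (s, th2)) l.
  move=> h12 hth.
  apply: (is_line_int_rotate (eps := 1) (M := 2 / (k * k') * norm p) l) => //; first lra.
  - by move=> s th /hth; exact: dF.
  - by move=> s th /hth; exact: nF.
have rot' th1 th2 l : 0 < th1 * th2 -> t1 <= Rabs th1 <= t2 -> t1 <= Rabs th2 <= t2 ->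
    is_line_int (fun s => F (s, th1)) l -> is_line_int (fun s => F (s, th2)) l.
  move=> pos h1 h2; have sgn th : Rmin th1 th2 <= th <= Rmax th1 th2 -> t1 <= Rabs th <= t2.
    move: h1 h2; rewrite /Rmin /Rmax /Rabs.
    by case: Rle_dec => ? /=; do 3 case: Rcase_abs => ? /=; nra.
  have [h12|/Rlt_le h12] := Rle_lt_dec th1 th2.
    by move=> hl; apply/(rot th1 th2) => // th hth; apply: sgn; rewrite Rmin_left // Rmax_right.
  by move=> hl; apply/(rot th2 th1) => // th hth; apply: sgn; rewrite Rmin_right // Rmax_left.
(* At [z = sg i e^s] the function [2 z / (z^2 - 1)] equals [- 2 sg i] times [decay 1 s], and
   [decay 1] has integral [PI / 2]. *)
have axis (sg : R) : sg = 1 \/ sg = -1 ->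
    is_line_int (fun s => F (s, sg * (PI / 2))) (scal (Cmult (RtoC (- sg * PI)) Ci) p).
  move=> hsg.
  have := is_line_int_scal (Cmult (RtoC (- sg * 2)) Ci) (is_line_int_decay p Rlt_0_1).
  rewrite (_ : scal _ (scal _ p) = scal (Cmult (RtoC (- sg * PI)) Ci) p); last first.
    by module X; apply: injective_projections; rewrite /=; field.
  apply: is_line_int_ext => s.
  have ab : Rabs (sg * (PI / 2)) = PI / 2.
    by case: hsg => ->; [rewrite Rmult_1_l Rabs_pos_eq; lra|rewrite Rabs_left; lra].
  have n1 := nz1 s (sg * (PI / 2)) ltac:(rewrite ab; lra).
  have n2 := nz2 s (sg * (PI / 2)) ltac:(rewrite ab; lra).
  rewrite /F hE // (_ : decay 1 s = exp s / (1 + exp s ^ 2)); last first.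
    by rewrite -decay1 ?ln_exp //; exact: exp_pos.
  have pr : 1 + exp s ^ 2 <> 0 by have := pow2_ge_0 (exp s); lra.
  have ez : cexp (s, sg * (PI / 2)) = Cmult (RtoC (sg * exp s)) Ci.
    case: hsg => ->; rewrite /cexp /= ?Rmult_1_l.
      by rewrite cos_PI2 sin_PI2; apply: injective_projections; rewrite /=; ring.
    rewrite (_ : -1 * (PI / 2) = - (PI / 2)); last by ring.
    by rewrite cos_neg sin_neg cos_PI2 sin_PI2; apply: injective_projections; rewrite /=; ring.
  have ek : Cmult (cauchy_kernel (-1) (cexp (s, sg * (PI / 2)))) (cauchy_kernel 1 (cexp (s, sg * (PI / 2)))) =
      RtoC (- / (1 + exp s ^ 2)).
    rewrite /cauchy_kernel.
    rewrite (_ : Cmult (Cinv _) (Cinv _) = Cinv (Cmult (Cplus (cexp (s, sg * (PI / 2))) (RtoC (-1))) (Cplus (cexp (s, sg * (PI / 2))) (RtoC 1)))); last by field.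
    rewrite (_ : Cmult _ _ = RtoC (- (1 + exp s ^ 2))).
      by rewrite -RtoC_inv; [congr RtoC; field|lra].
    rewrite ez; apply: injective_projections; rewrite /=; last by ring.
    have e2 : sg * sg = 1 by case: hsg => ->; ring.
    by ring_simplify; rewrite (_ : sg ^ 2 = 1); [ring|rewrite -e2; ring].
  rewrite ek ez; module X; apply: injective_projections; rewrite /=; field; rewrite /= in pr; lra.
have i2 : is_line_int (fun s => F (s, nu)) (scal (Cmult (RtoC (- PI)) Ci) p).
  have := axis 1 (or_introl erefl); rewrite Rmult_1_l (_ : - (1) * PI = - PI); last by ring.
  by apply: rot'; rewrite ?Rabs_pos_eq; nra.
have i1 : is_line_int (fun s => F (s, - nu)) (scal (Cmult (RtoC PI) Ci) p).
  have := axis (-1) (or_intror erefl).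
  have e1 : - -1 * PI = PI by ring.
  have e2 : -1 * (PI / 2) = - (PI / 2) by ring.
  rewrite e1 e2.
  by apply: rot'; rewrite ?Rabs_Ropp ?Rabs_pos_eq; nra.
exists (scal (Cmult (RtoC PI) Ci) p), (scal (Cmult (RtoC (- PI)) Ci) p); split => //.
module X; rewrite /dunford_const RtoC_opp RtoC_mult; field; split.
- by move/(f_equal snd) => /=; lra.
- by move/RtoC_inj; lra.
Qed.

End residue.

(** * Rational functions of the operator *)

Section rational_calculus.
Context (X : CompleteNormedModule C_AbsRing) (A : operator X).
Context (omega sigma nu : R) (hA : sectorial A omega).
Context (hnu : omega < nu < sigma) (hsigma : sigma < PI).
Context (M : R) (M0 : 0 <= M)
  (hM : forall z, outside nu z -> is_resolvent A z (resolvent A z) /\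
    forall x, Cmod z * norm (resolvent A z x) <= M * norm x).

Let ho : 0 < omega < PI. Proof. exact: omega_bound hA. Qed.
Let hnu' : 0 < nu < PI. Proof. lra. Qed.
Let hs' : 0 < sigma < PI. Proof. lra. Qed.
Local Notation Q := (neg_resolvent A).

(** The function [e_b = b / (z + b) - b^(-1) / (z + b^(-1))]. The product form shows its decay at 0
    and infinity, the difference form of [approx_funE] its bound uniform in [b]. *)
Definition approx_fun (b : R) (z : C) : C :=
  Cmult (RtoC (b - / b)) (Cmult z (Cmult (cauchy_kernel b z) (cauchy_kernel (/ b) z))).

Definition approx_op (b : R) (x : X) : X :=
  minus (scal (RtoC b) (Q b x)) (scal (RtoC (/ b)) (Q (/ b) x)).

Lemma approx_funE b z : Cplus z (RtoC b) <> RtoC 0 -> Cplus z (RtoC (/ b)) <> RtoC 0 ->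
  approx_fun b z = Cminus (Cmult (RtoC b) (cauchy_kernel b z)) (Cmult (RtoC (/ b)) (cauchy_kernel (/ b) z)).
Proof.
by move=> h1 h2; rewrite /approx_fun /cauchy_kernel RtoC_minus; field.
Qed.

(** Replacing the pole [-1] by [- b] adds [(b - 1) z / ((z + 1)(z + b))], which is holomorphic in
    the sector and contributes equally on both rays. *)
Lemma line_int_kernel b (p : X) : 0 < b ->
  exists j1 j2, [/\ is_line_int (fun s => let z := cexp (s, - nu) in
      scal (Cminus (Cmult z (cauchy_kernel (-1) z)) (Cmult z (cauchy_kernel b z))) p) j1,
    is_line_int (fun s => let z := cexp (s, nu) in
      scal (Cminus (Cmult z (cauchy_kernel (-1) z)) (Cmult z (cauchy_kernel b z))) p) j2 &
    scal dunford_const (minus j1 j2) = p].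
Proof.
move=> b0; have [j1 [j2 [h1 h2 e]]] := line_int_residue p hnu'.
have [k k0 hk] := double_kernel_decay hs'.
have hh := holo_decay_scal (RtoC (b - 1)) (hk 1 b Rlt_0_1 b0).
have [l hl] := line_int_sector p hs' hh.
have key th j : Rabs th = nu -> is_line_int (fun s => let z := cexp (s, th) in
      scal (Cminus (Cmult z (cauchy_kernel (-1) z)) (Cmult z (cauchy_kernel 1 z))) p) j ->
    is_line_int (fun s => let z := cexp (s, th) in
      scal (Cminus (Cmult z (cauchy_kernel (-1) z)) (Cmult z (cauchy_kernel b z))) p) (plus j l).
  move=> hth hj; apply: is_line_int_ext (is_line_int_plus hj (hl th ltac:(lra))) => s /=.
  have hz := sector_ray hnu hsigma s hth.
  have n1 := sector_plus_neq0 hs' Rlt_0_1 hz; have n2 := sector_plus_neq0 hs' b0 hz.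
  by module X; set q := cauchy_kernel (-1) _; rewrite /cauchy_kernel RtoC_minus; field.
exists (plus j1 l), (plus j2 l); split.
- by apply: key h1; rewrite Rabs_Ropp Rabs_pos_eq; lra.
- by apply: key h2; rewrite Rabs_pos_eq; lra.
- by rewrite -[RHS]e; module X.
Qed.

(** With [p = b Q_b x] and [q = c Q_c x], [c = 1 / b], partial fractions split [e_b(z) z R(z) x]
    into [z R(z) (p - q) - z / (z - 1) (p - q)], plus [z / (z - 1) - z / (z + b)] applied to [p],
    minus the same with [c] applied to [q]. As [p - q = A (Q_c x - Q_b x)] also lies in the domain,
    the first part takes the same value on both rays; the other two are residues and give [p] and
    [q]. *)
Lemma is_dunford_approx b x : 0 < b -> is_dunford A nu (approx_fun b) x (approx_op b x).
Proof.
move=> b0; have c0 : 0 < / b by exact: Rinv_0_lt_compat.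
set c := / b in c0 *; set p := scal (RtoC b) (Q b x); set q := scal (RtoC c) (Q c x).
have ey : minus p q = A (minus (Q c x) (Q b x)).
  rewrite (_ : minus (Q c x) (Q b x) = plus (Q c x) (scal (RtoC (-1)) (Q b x))); last by module X.
  have hb := neg_resolvent_dom hM x b0; have hc := neg_resolvent_dom hM x c0.
  rewrite op_fun_plus //; last exact: op_dom_scal.
  rewrite op_fun_scal // (A_neg_resolvent hM x b0) (A_neg_resolvent hM x c0) /p /q.
  by module X.
have dQ : op_dom A (minus (Q c x) (Q b x)).
  rewrite (_ : minus (Q c x) (Q b x) = plus (Q c x) (scal (RtoC (-1)) (Q b x))); last by module X.
  apply: op_dom_plus; first exact (neg_resolvent_dom hM x c0).
  by apply: op_dom_scal; exact (neg_resolvent_dom hM x b0).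
have dpq : op_dom A (minus p q).
  rewrite (_ : minus p q = plus p (scal (RtoC (-1)) q)); last by module X.
  apply: op_dom_plus; first by apply: op_dom_scal; exact (neg_resolvent_dom hM x b0).
  by do 2 apply: op_dom_scal; exact (neg_resolvent_dom hM x c0).
have [g hg] := line_int_outer hA hnu hsigma M0 hM dpq dQ ey.
have [j1 [j2 [hj1 hj2 ej]]] := line_int_kernel p b0.
have [i1 [i2 [hi1 hi2 ei]]] := line_int_kernel q c0.
have key th j i : Rabs th = nu ->
    is_line_int (fun s => let z := cexp (s, th) in
      scal (Cminus (Cmult z (cauchy_kernel (-1) z)) (Cmult z (cauchy_kernel b z))) p) j ->
    is_line_int (fun s => let z := cexp (s, th) in
      scal (Cminus (Cmult z (cauchy_kernel (-1) z)) (Cmult z (cauchy_kernel c z))) q) i ->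
    is_line_int (fun s => dunford_integrand A (approx_fun b) x (s, th)) (plus g (minus j i)).
  move=> hth hj hi.
  apply: is_line_int_ext (is_line_int_plus (hg th hth) (is_line_int_minus hj hi)) => s /=.
  have hz := sector_ray hnu hsigma s hth; have oz := outside_ray s hth.
  have nb := sector_plus_neq0 hs' b0 hz; have nc := sector_plus_neq0 hs' c0 hz.
  set z := cexp (s, th) in hz oz nb nc *.
  have lR := resolvent_linear hM oz.
  rewrite (linear_minus _ p q lR) /p /q !(linear_scal _ lR).
  have [_ ->] := neg_resolvent_mul hM x b0 oz nb.
  have [_ ->] := neg_resolvent_mul hM x c0 oz nc.
  rewrite /dunford_integrand -/z approx_funE // -/c.
  by module X.
exists (plus g (minus j1 i1)), (plus g (minus j2 i2)); split.
- by apply: key => //; rewrite Rabs_Ropp Rabs_pos_eq; lra.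
- by apply: key => //; rewrite Rabs_pos_eq; lra.
- by rewrite /approx_op -/p -/q -{1}ej -{1}ei; module X.
Qed.

(** For [x'] in the domain, [b Q_b x' - x' = - Q_b (A x')] is [O(1 / b)]; for [y = A w], [b^(-1)
    Q_(1/b) y = b^(-1) (w - b^(-1) Q_(1/b) w)] is [O(1 / b)] too. Density of the domain and of the
    range extends both limits to every [x], as [b Q_b] is bounded by [M] for all [b > 0]. *)
Lemma approx_op_cvg x eta : 0 < eta ->
  exists2 B, 0 < B & forall b, B <= b -> norm (minus (approx_op b x) x) < eta.
Proof.
move=> eta0; have [_ [hD [_ [hR _]]]] := hA.
pose e1 := eta / (4 * (M + 1)).
have e10 : 0 < e1 by apply: Rdiv_lt_0_compat; lra.
have e1M : M * e1 <= eta / 4.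
  rewrite (_ : M * e1 = eta / 4 * (M / (M + 1))); last by rewrite /e1; field; lra.
  rewrite -[X in _ <= X]Rmult_1_r; apply: Rmult_le_compat_l; first lra.
  by apply/Rle_div_l; lra.
have e1e : e1 <= eta / 4.
  rewrite /e1 /Rdiv; apply: Rmult_le_compat_l; first lra.
  by apply: Rinv_le_contravar; lra.
have [x' [hx' dx']] := hD x _ (locally_ball_norm (V := X) x (mkposreal _ e10)).
have [y [hy [w dw ey]]] := hR x _ (locally_ball_norm (V := X) x (mkposreal _ e10)).
rewrite /ball_norm /= in hx' hy.
have nA := norm_ge_0 (A x'); have nw := norm_ge_0 w.
pose N := M * norm (A x') + (1 + M) * norm w + 1.
have N0 : 0 < N.
  have : 0 <= M * norm (A x') by exact: Rmult_le_pos.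
  have : 0 <= (1 + M) * norm w by apply: Rmult_le_pos; lra.
  by rewrite /N; lra.
exists (4 * N / eta); first by apply: Rdiv_lt_0_compat; lra.
move=> b hb.
have b0 : 0 < b by apply: Rlt_le_trans hb; apply: Rdiv_lt_0_compat; lra.
have c0 : 0 < / b by exact: Rinv_0_lt_compat.
have Nb : / b * N <= eta / 4.
  rewrite Rmult_comm; apply/Rle_div_l => //.
  by move/Rle_div_l: hb => /(_ eta0); lra.
have lb := neg_resolvent_linear hM b0; have lc := neg_resolvent_linear hM c0.
have bQ u : norm (scal (RtoC b) (Q b u)) <= M * norm u.
  rewrite norm_scalC_eq Cmod_R Rabs_pos_eq; last lra.
  have := Rmult_le_compat_l b _ _ (Rlt_le _ _ b0) (neg_resolvent_norm hM u b0).
  by rewrite (_ : b * (M / b * norm u) = M * norm u) //; field; lra.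
have cQ u : norm (scal (RtoC (/ b)) (Q (/ b) u)) <= M * norm u.
  rewrite norm_scalC_eq Cmod_R Rabs_pos_eq; last lra.
  have := Rmult_le_compat_l (/ b) _ _ (Rlt_le _ _ c0) (neg_resolvent_norm hM u c0).
  by rewrite (_ : / b * (M / / b * norm u) = M * norm u) //; field; lra.
have t1 : norm (minus (scal (RtoC b) (Q b x')) x') <= / b * (M * norm (A x')).
  have := neg_resolvent_A hM b0 dx' => e.
  rewrite norm_minus_sym (_ : minus x' _ = Q b (A x')) //.
  apply: Rle_trans (neg_resolvent_norm hM _ b0) _.
  by apply: Req_le; field; lra.
have t2 : norm (scal (RtoC (/ b)) (Q (/ b) y)) <= / b * ((1 + M) * norm w).
  rewrite ey (neg_resolvent_A hM c0 dw) norm_scalC_eq Cmod_R Rabs_pos_eq; last lra.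
  apply: Rmult_le_compat_l; first lra.
  apply: Rle_trans (norm_minus_le _ _) _; have := cQ w; lra.
have h1 : norm (scal (RtoC b) (Q b (minus x x'))) <= M * e1.
  apply: Rle_trans (bQ _) _; apply: Rmult_le_compat_l => //.
  by rewrite norm_minus_sym; lra.
have h2 : norm (scal (RtoC (/ b)) (Q (/ b) (minus x y))) <= M * e1.
  apply: Rle_trans (cQ _) _; apply: Rmult_le_compat_l => //.
  by rewrite norm_minus_sym; lra.
rewrite (_ : minus (approx_op b x) x = minus (plus (plus (minus (scal (RtoC b) (Q b x')) x') (scal (RtoC b) (Q b (minus x x')))) (minus x' x))
   (plus (scal (RtoC (/ b)) (Q (/ b) y)) (scal (RtoC (/ b)) (Q (/ b) (minus x y))))); last first.
  by rewrite /approx_op (linear_minus _ x x' lb) (linear_minus _ x y lc); module X.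
apply: Rle_lt_trans (norm_minus_le _ _) _.
apply: Rle_lt_trans (Rplus_le_compat _ _ _ _ (norm_triangle _ _) (norm_triangle _ _)) _.
apply: Rle_lt_trans (Rplus_le_compat _ _ _ _ (Rplus_le_compat_r _ _ _ (norm_triangle _ _)) (Rle_refl _)) _.
have : / b * (M * norm (A x')) + / b * ((1 + M) * norm w) <= / b * N - / b.
  by rewrite /N; lra.
norm_lra.
Qed.

Lemma approx_fun_bound : exists2 E, 0 < E & forall b z, 0 < b -> sector sigma z ->
  Cmod (approx_fun b z) <= E.
Proof.
have [k k0 hk] := cauchy_kernel_bound hs'; exists (2 * k); first lra.
move=> b z b0 hz; have c0 : 0 < / b by exact: Rinv_0_lt_compat.
rewrite approx_funE; [|exact: (sector_plus_neq0 hs')|exact: (sector_plus_neq0 hs')].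
have bk a : 0 < a -> Cmod (Cmult (RtoC a) (cauchy_kernel a z)) <= k.
  move=> a0; have [h _] := hk z a a0 hz.
  rewrite Cmod_mult Cmod_R Rabs_pos_eq; last lra.
  have := Rmult_le_compat_l a _ _ (Rlt_le _ _ a0) h.
  by rewrite (_ : a * (k / a) = k) //; field; lra.
apply: Rle_trans (Cmod_triangle _ _) _; rewrite Cmod_opp.
have := bk b b0; have := bk (/ b) c0; lra.
Qed.

Lemma approx_fun_decay b : 0 < b -> exists K, holo_decay sigma 1 K (approx_fun b).
Proof.
move=> b0; have c0 : 0 < / b by exact: Rinv_0_lt_compat.
have [k k0 hk] := double_kernel_decay hs'.
by eexists; apply: holo_decay_scal; exact: (hk b (/ b) b0 c0).
Qed.

(** A relation following the construction of the function: the operator is attached to an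
    expression, so it does not have to be shown that it depends on the function alone. *)
Inductive rational_calculus : (C -> C) -> (X -> X) -> Prop :=
| rational_const c : rational_calculus (fun=> c) (fun x => scal c x)
| rational_kernel b : 0 < b -> rational_calculus (cauchy_kernel b) (Q b)
| rational_plus u U v W : rational_calculus u U -> rational_calculus v W ->
    rational_calculus (fun z => Cplus (u z) (v z)) (fun x => plus (U x) (W x))
| rational_mult u U v W : rational_calculus u U -> rational_calculus v W ->
    rational_calculus (fun z => Cmult (u z) (v z)) (fun x => U (W x)).

Lemma rational_linear u U : rational_calculus u U -> is_linear U.
Proof.
elim=> {u U} [c|b b0|u U v W _ hU _ hW|u U v W _ hU _ hW].
- exact: is_linear_scalC.
- exact (neg_resolvent_linear hM b0).
- have [p1 s1 [N1 [N10 n1]]] := hU; have [p2 s2 [N2 [N20 n2]]] := hW; split.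
  + by move=> x y; rewrite p1 p2; module X.
  + by move=> k x; rewrite s1 s2; module X.
  + exists (N1 + N2); split; first lra.
    move=> x; apply: Rle_trans (norm_triangle _ _) _; have := n1 x; have := n2 x; lra.
- have [p1 s1 [N1 [N10 n1]]] := hU; have [p2 s2 [N2 [N20 n2]]] := hW; split.
  + by move=> x y; rewrite p2 p1.
  + by move=> k x; rewrite s2 s1.
  + exists (N1 * N2); split; first exact: Rmult_lt_0_compat.
    move=> x; apply: Rle_trans (n1 _) _; rewrite Rmult_assoc.
    by apply: Rmult_le_compat_l; [lra|exact: n2].
Qed.

Lemma rational_holo u U : rational_calculus u U ->
  (forall z, sector sigma z -> exists l, cdiff (u : C -> C_NormedModule) z l) /\
  (exists B, forall z, sector sigma z -> Cmod (u z) <= B).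
Proof.
elim=> {u U} [c|b b0|u U v W _ [hu [B1 b1]] _ [hv [B2 b2]]|u U v W _ [hu [B1 b1]] _ [hv [B2 b2]]].
- split; last by exists (Cmod c) => z _; lra.
  by move=> z _; eexists; exact: (@cdiff_const C_NormedModule c z).
- split; first by move=> z hz; apply: cdiff_cauchy_kernel; exact: (sector_plus_neq0 hs').
  have [k k0 hk] := cauchy_kernel_bound hs'.
  by exists (k / b) => z hz; have [] := hk z b b0 hz.
- split.
    move=> z hz; have [l hl] := hu z hz; have [m hm] := hv z hz.
    eexists; exact: cdiff_plus hl hm.
  exists (B1 + B2) => z hz; apply: Rle_trans (Cmod_triangle _ _) _.
  by have := b1 z hz; have := b2 z hz; lra.
- split.
    move=> z hz; have [l hl] := hu z hz; have [m hm] := hv z hz.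
    eexists; exact: cdiff_scal hl hm.
  exists (B1 * B2) => z hz; rewrite Cmod_mult.
  by apply: Rmult_le_compat; try exact: Cmod_ge_0; [exact: b1|exact: b2].
Qed.

Lemma rational_dunford u U : rational_calculus u U -> forall eps K v x y,
  holo_decay sigma eps K v -> is_dunford A nu v x y ->
  is_dunford A nu (fun z => Cmult (u z) (v z)) x (U y).
Proof.
elim=> {u U} [c|b b0|u U v W hu IHu hv IHv|u U v W hu IHu hv IHv] eps K f x y hf hy.
- exact: is_dunford_scal.
- exact: (is_dunford_neg_resolvent hA hnu hsigma hM b0 hf hy).
- apply: is_dunford_ext (is_dunford_plus (IHu _ _ _ _ _ hf hy) (IHv _ _ _ _ _ hf hy)) => z.
  by ring.
- have [h1 [B hB]] := rational_holo hv.
  apply: is_dunford_ext (IHu _ _ _ _ _ (holo_decay_mult h1 hB hf) (IHv _ _ _ _ _ hf hy)) => z.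
  by ring.
Qed.

Context (Kc : R) (Kc0 : 0 <= Kc)
  (hK : forall v eps K B x y, holo_decay sigma eps K v ->
    (forall z, sector sigma z -> Cmod (v z) <= B) -> is_dunford A nu v x y ->
    norm y <= Kc * B * norm x).

(** For rational [u], [u(A)] is only defined algebraically; it is bounded
    because [u(A) e_b(A) = (u e_b)(A)], where [e_b(A)] tends to the identity. *)
Lemma rational_bound : exists2 K, 0 <= K & forall u U B x, rational_calculus u U ->
  (forall z, sector sigma z -> Cmod (u z) <= B) -> norm (U x) <= K * B * norm x.
Proof.
have [E E0 hE] := approx_fun_bound; exists (Kc * E); first by apply: Rmult_le_pos; lra.
move=> u U B x hu hB; have hl := rational_linear hu; have [_ _ [N [N0 hN]]] := hl.
have B0 : 0 <= B.
  apply: Rle_trans (Cmod_ge_0 (u (cexp (0, 0)))) (hB _ _).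
  by apply: sector_cexp => //; rewrite Rabs_R0; lra.
apply: le_epsilon => eta eta0.
(* The norm [N] of [U] is not controlled by [B], but it enters only through
   [|U (x - e_b(A) x)| <= N |x - e_b(A) x|], which is small for this [b]. *)
have [b b0 hb] := approx_op_cvg x (Rdiv_lt_0_compat _ _ eta0 N0).
have {}hb := hb b (Rle_refl b).
have [Ka ha] := approx_fun_decay b0.
have [h1 _] := rational_holo hu.
have hd := rational_dunford hu ha (is_dunford_approx x b0).
have hue : forall z, sector sigma z -> Cmod (Cmult (u z) (approx_fun b z)) <= B * E.
  move=> z hz; rewrite Cmod_mult.
  by apply: Rmult_le_compat; try exact: Cmod_ge_0; [exact: hB|exact: hE].
have i1 := hK (holo_decay_mult h1 hB ha) hue hd.
have i2 := hN (minus (approx_op b x) x).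
have i3 := norm_le_minus (U x) (U (approx_op b x)).
rewrite norm_minus_sym -(linear_minus _ _ _ hl) in i3.
have i4 := Rmult_lt_compat_l N _ _ N0 hb.
rewrite (_ : N * (eta / N) = eta) in i4; last by field; lra.
rewrite (_ : Kc * E * B = Kc * (B * E)); last by ring.
norm_lra.
Qed.

End rational_calculus.

(** The decay condition in [Hinf0] has constant 1, so [v] is divided by [L + 1] first and the bound
    follows by homogeneity. Replacing the supremum norm by an upper bound [B] requires a nonnegative
    constant, hence [Rmax K 0]. *)
Lemma calculus_bound (X : CompleteNormedModule C_AbsRing) (A : operator X) omega sigma nu K :
  sectorial A omega -> omega < nu < sigma -> sigma < PI ->
  (forall (v : C -> C) (x : X), Hinf0 sigma v ->
    norm (dunford A nu v x) <= K * Hinf_norm sigma v * norm x) ->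
  forall v eps L B x y, holo_decay sigma eps L v ->
    (forall z, sector sigma z -> Cmod (v z) <= B) -> is_dunford A nu v x y ->
    norm y <= Rmax K 0 * B * norm x.
Proof.
move=> hA hnu hs hK v eps L B x y hv hB hy.
have ho := omega_bound hA.
have hs' : 0 < sigma < PI by lra.
have L0 := holo_decay_K_ge0 hs' hv.
pose N := L + 1; have N0 : 0 < N by rewrite /N; lra.
have iN : 0 < / N by exact: Rinv_0_lt_compat.
have hv' : holo_decay sigma eps 1 (fun z => Cmult (RtoC (/ N)) (v z)).
  apply: holo_decay_ub (holo_decay_scal (RtoC (/ N)) hv).
  rewrite Cmod_R Rabs_pos_eq; last lra.
  rewrite Rmult_comm; apply/Rle_div_l => //; rewrite /N; lra.
have := hK _ x (holo_decay_Hinf0 (Rle_refl 1) hv').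
have -> : dunford A nu (fun z => Cmult (RtoC (/ N)) (v z)) x = scal (RtoC (/ N)) y.
  apply: (is_dunford_fun (is_dunford_dunford hA x hs hnu hv')).
  exact: is_dunford_scal.
have hB' : forall z, sector sigma z -> Cmod (Cmult (RtoC (/ N)) (v z)) <= / N * B.
  move=> z hz; rewrite Cmod_mult Cmod_R Rabs_pos_eq; last lra.
  by apply: Rmult_le_compat_l; [lra|exact: hB].
have [n0 nB] := Hinf_norm_le hs' hB'.
rewrite norm_scalC_eq Cmod_R Rabs_pos_eq; last lra.
set H := Hinf_norm _ _ in n0 nB * => h.
have nx := norm_ge_0 x; have ny := norm_ge_0 y.
have k0 : 0 <= Rmax K 0 by exact: Rmax_r.
apply: (Rmult_le_reg_l (/ N)) => //; apply: Rle_trans h _.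
rewrite (_ : / N * (Rmax K 0 * B * norm x) = Rmax K 0 * (/ N * B) * norm x); last by ring.
apply: Rmult_le_compat_r => //.
apply: Rle_trans (_ : Rmax K 0 * H <= _); last exact: Rmult_le_compat_l.
by apply: Rmult_le_compat_r => //; exact: Rmax_l.
Qed.

(** * A reproducing function *)

Section peak.

(** [1 / cosh^2 (s/2)], the restriction to a ray of [4 b z / (z + b)^2]. *)
Definition peak (s : R) : R := 4 / (exp s + exp (- s) + 2).

Lemma cosh_mono s t : 0 <= s -> s < t -> exp s + exp (- s) < exp t + exp (- t).
Proof.
move=> s0 st; have h1 := exp_increasing _ _ st.
have es := exp_pos s; have et := exp_pos t.
have h2 : exp (- t) = exp s * (exp (- s) * exp (- t)) by rewrite -Rmult_assoc -exp_plus Rplus_opp_r exp_0; ring.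
have h3 : exp (- s) = exp t * (exp (- s) * exp (- t)).
  by rewrite (Rmult_comm (exp (- s))) -Rmult_assoc -exp_plus Rplus_opp_r exp_0; ring.
have h4 : exp (- s) * exp (- t) < 1.
  by rewrite -exp_plus -exp_0; apply: exp_increasing; lra.
have h5 : 0 < exp (- s) * exp (- t) by apply: Rmult_lt_0_compat; exact: exp_pos.
set q := exp (- s) * exp (- t) in h2 h3 h4 h5.
have := Rmult_lt_0_compat (exp t - exp s) (1 - q) ltac:(lra) ltac:(lra).
by rewrite h2 h3; lra.
Qed.

Lemma peak_den s : 0 < exp s + exp (- s) + 2.
Proof. by have := exp_pos s; have := exp_pos (- s); lra. Qed.

Lemma peak_gt0 s : 0 < peak s.
Proof. by apply: Rdiv_lt_0_compat; [lra|exact: peak_den]. Qed.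

Lemma peak_opp s : peak (- s) = peak s.
Proof. by rewrite /peak Ropp_involutive (Rplus_comm (exp (- s))). Qed.

Lemma peak_Rabs s : peak (Rabs s) = peak s.
Proof. by rewrite /Rabs; case: Rcase_abs => _ //; rewrite peak_opp. Qed.

Lemma peak_decr s t : 0 <= s -> s < t -> peak t < peak s.
Proof.
move=> s0 st; have := cosh_mono s0 st => h; have := peak_den s; have := peak_den t => h1 h2.
by apply: Rmult_lt_compat_l; [lra|apply: Rinv_lt_contravar; [exact: Rmult_lt_0_compat|lra]].
Qed.

Lemma peak_decr_le s t : 0 <= s -> s <= t -> peak t <= peak s.
Proof. by move=> s0 [st|->]; [exact: Rlt_le (peak_decr s0 st)|lra]. Qed.

Lemma peak_le1 s : peak s <= 1.
Proof.
rewrite -peak_Rabs; apply: Rle_trans (peak_decr_le (Rle_refl 0) (Rabs_pos s)) _.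
by rewrite /peak Ropp_0 exp_0; lra.
Qed.

Lemma peak_decay s : peak s <= 4 * decay 1 s.
Proof.
rewrite /peak /decay !Rmult_1_l; apply: Rmult_le_compat_l; first lra.
by apply: Rinv_le_contravar; have := exp_pos s; have := exp_pos (- s); lra.
Qed.

Lemma continuous_peak n s : continuous (fun s => peak s ^ n) s.
Proof.
apply: (ex_derive_continuous (K := R_AbsRing) (V := R_NormedModule)).
by rewrite /peak; auto_derive; have := peak_den s; lra.
Qed.

Context (X : CompleteNormedModule C_AbsRing).
Local Notation V := (restr_scalars X).

Lemma peak_pow_le1 n s : 0 <= peak s ^ n <= 1.
Proof.
have h1 := peak_gt0 s; have h2 := peak_le1 s.
by split; [apply: pow_le; lra|rewrite -(pow1 n); apply: pow_incr; lra].
Qed.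

Lemma continuous_scal_real (f : R -> R) (F : R -> X) s : continuous f s ->
  continuous (F : R -> V) s -> continuous ((fun s => scal (RtoC (f s)) (F s)) : R -> V) s.
Proof. by move=> hf hF; exact: (continuous_scal (V := V) f F s hf hF). Qed.

Lemma decays_peak eps K n (F : R -> X) : decays eps K F ->
  decays eps K (fun s => scal (RtoC (peak s ^ n)) (F s)).
Proof.
move=> [e0 hc hd]; split => // s.
  by apply: continuous_scal_real; [exact: continuous_peak|exact: hc].
rewrite norm_scalC_eq Cmod_R; have [h1 h2] := peak_pow_le1 n s.
rewrite Rabs_pos_eq //; apply: Rle_trans (hd s).
by rewrite -[X in _ <= X]Rmult_1_l; apply: Rmult_le_compat_r => //; exact: norm_ge_0.
Qed.

Lemma is_RInt_scal_const (f : R -> R) (v : X) x y : (forall s, continuous f s) ->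
  is_RInt (V := V) (fun s => scal (RtoC (f s)) v) x y (scal (RtoC (RInt f x y)) v).
Proof.
move=> hf.
have hd t : is_derive (fun t => RInt f x t) t (f t).
  apply: (is_derive_RInt (V := R_NormedModule) f (fun t => RInt f x t) x); last exact: hf.
  apply: filter_forall => u; apply: (RInt_correct (V := R_CompleteNormedModule)).
  by apply: (ex_RInt_continuous (V := R_CompleteNormedModule)) => s _; exact: hf.
have := is_RInt_derive (V := V) (fun t => scal (RInt f x t) (v : V)) (fun t => scal (f t) (v : V)) x y.
rewrite (RInt_point (V := R_CompleteNormedModule)).
rewrite (_ : minus (scal (RInt f x y) (v : V)) (scal zero (v : V)) = scal (RtoC (RInt f x y)) v :> X); last first.
  by rewrite scal_zero_l; module X.
apply.
- by move=> t _; apply: (is_derive_scal_l (V := V) (fun t => RInt f x t)); exact: hd.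
- by move=> t _; apply: (continuous_scal_l (V := V) f v); exact: hf.
Qed.

(** Laplace's method: high powers of [peak] concentrate the integral at [0]. *)
Lemma peak_nonzero eps K (F : R -> X) : decays eps K F -> F 0 <> zero ->
  exists n l, l <> zero /\ is_line_int (fun s => scal (RtoC (peak s ^ n.+1)) (F s)) l.
Proof.
move=> hF a0; have [e0 hc hd] := hF; have K0 := decays_M_ge0 hF.
set a := F 0 in a0; have na : 0 < norm a by apply: norm_gt_0.
have [d1 d10 hd1] := proj2 (continuousP F 0) (hc 0) (norm a / 2) ltac:(lra).
pose d := d1 / 2; have d0 : 0 < d by rewrite /d; lra.
have near s : Rabs s <= d -> norm (minus (F s) a) <= norm a / 2.
  move=> hs; apply: Rlt_le; apply: hd1; rewrite Rminus_0_r.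
  by apply: Rle_lt_trans hs _; rewrite /d; lra.
(* [kh] bounds the peak from below on [[- d/2, d/2]], [kd] from above off [[- d, d]]. With [J] the
   integral of [peak^(n+1)], replacing [F] by [a] costs at most [|a| J / 2] inside [[- d, d]] and
   [kd^n B] outside, where one factor [peak] is kept for integrability. As [J >= d kh^(n+1)] and
   [kh > kd], a large [n] leaves a positive lower bound. *)
pose kd := peak d; pose kh := peak (d / 2).
have kd0 : 0 < kd by exact: peak_gt0.
have kdh : kd < kh by apply: peak_decr; lra.
pose B := (K + norm a) * (2 * PI).
have pi0 := PI_RGT_0.
have B0 : 0 <= B by apply: Rmult_le_pos; lra.
have [n hn] : exists n, B < norm a / 2 * d * kd * (kh / kd) ^ n.+1.
  pose q := norm a / 2 * d * kd.
  have q0 : 0 < q by apply: Rmult_lt_0_compat => //; apply: Rmult_lt_0_compat => //; lra.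
  have r1 : 1 < kh / kd by apply/Rlt_div_r => //; lra.
  have [n hn] := Pow_x_infinity (kh / kd) ltac:(rewrite Rabs_pos_eq; lra) (B / q + 1).
  exists n; have := hn n.+1 ltac:(by apply/leP).
  rewrite Rabs_pos_eq; last by apply: pow_le; lra.
  move=> /Rge_le h.
  have : B / q < (kh / kd) ^ n.+1 by lra.
  by move/(Rlt_div_l _ _ _ q0); rewrite Rmult_comm.
have hp := decays_peak n.+1 hF.
have [l hl] := is_line_int_ex hp.
exists n, l; split => // l0.
pose low := norm a / 2 * (d * kh ^ n.+1) - kd ^ n * B.
have low0 : 0 < low.
  have : (kh / kd) ^ n.+1 * kd ^ n.+1 = kh ^ n.+1.
    by rewrite -Rpow_mult_distr; congr pow; field; lra.
  rewrite /= => e; have p0 : 0 < kd ^ n by exact: pow_lt.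
  have := Rmult_lt_compat_l (kd ^ n) _ _ p0 hn; rewrite /low /=.
  rewrite (_ : kd ^ n * (norm a / 2 * d * kd * (kh / kd * (kh / kd) ^ n)) = norm a / 2 * (d * (kh * kh ^ n))).
    lra.
  by rewrite -e; ring.
have [L0 hL0] := proj2 hl low low0.
pose L := Rmax L0 d.
have Ld : d <= L by exact: Rmax_r.
have := hL0 (- L) L ltac:(have := Rmax_l L0 d; rewrite -/L; lra) (Rmax_l _ _).
rewrite l0 (_ : minus _ zero = RInt (V := V) (fun s => scal (RtoC (peak s ^ n.+1)) (F s)) (- L) L); last by module X.
apply: Rle_not_lt.
have LL : - L <= L by lra.
have exk m : ex_RInt (fun s => peak s ^ m) (- L) L.
  by apply: (ex_RInt_continuous (V := R_CompleteNormedModule)) => s _; exact: continuous_peak.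
pose J := RInt (fun s => peak s ^ n.+1) (- L) L.
have ck m s : continuous (fun s => peak s ^ m) s by exact: continuous_peak.
have ea := @is_RInt_scal_const (fun s => peak s ^ n.+1) a (- L) L (ck n.+1).
have J1 : J >= d * kh ^ n.+1.
  have exI x y : ex_RInt (fun s => peak s ^ n.+1) x y.
    by apply: (ex_RInt_continuous (V := R_CompleteNormedModule)) => s _; exact: ck.
  have pos x y : x <= y -> 0 <= RInt (fun s => peak s ^ n.+1) x y.
    by move=> xy; apply: RInt_ge_0 => // s _; have [] := peak_pow_le1 n.+1 s.
  rewrite /J -(RInt_Chasles (V := R_CompleteNormedModule) _ (- L) (- (d / 2)) L) //.
  rewrite -(RInt_Chasles (V := R_CompleteNormedModule) _ (- (d / 2)) (d / 2) L) //.
  have p1 := pos (- L) (- (d / 2)) ltac:(lra); have p2 := pos (d / 2) L ltac:(lra).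
  have : RInt (fun=> kh ^ n.+1) (- (d / 2)) (d / 2) <= RInt (fun s => peak s ^ n.+1) (- (d / 2)) (d / 2).
    apply: RInt_le => //; first lra.
      exact: (ex_RInt_const (V := R_NormedModule)).
    move=> s hs; apply: pow_incr; split; first exact: Rlt_le (peak_gt0 _).
    by rewrite -(peak_Rabs s) /kh; apply: peak_decr_le; [exact: Rabs_pos|apply: Rabs_le; lra].
  rewrite (RInt_const (V := R_CompleteNormedModule)) /scal /= /mult /= /plus /=.
  set r1 := RInt _ _ _ in p1 *; set r2 := RInt _ _ _; set r3 := RInt _ _ _ in p2 *.
  have -> : d / 2 - - (d / 2) = d by field.
  rewrite /=; lra.
have J2 : RInt peak (- L) L <= 2 * PI.
  have h1 := is_RInt_scal (V := R_NormedModule) (decay 1) (- L) L 4 _ (is_RInt_decay (eps := 1) (a := - L) (b := L) Rlt_0_1).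
  have h2 : ex_RInt peak (- L) L.
    apply: (ex_RInt_continuous (V := R_CompleteNormedModule)) => s _.
    by have := ck 1%nat s; apply: continuous_ext => t; rewrite pow_1.
  have h3 : RInt peak (- L) L <= RInt (fun s => scal 4 (decay 1 s)) (- L) L.
    apply: RInt_le => //; first by eexists; exact: h1.
    by move=> s _; exact: peak_decay.
  rewrite (is_RInt_unique (V := R_CompleteNormedModule) _ _ _ _ h1) in h3.
  apply: Rle_trans h3 _; rewrite /scal /= /mult /=.
  have := decay_primitive_lt L Rlt_0_1; have := decay_primitive_ge0 (- L) Rlt_0_1; lra.
pose q := kd ^ n * (K + norm a).
have q0 : 0 <= q by apply: Rmult_le_pos; [apply: pow_le|]; lra.
have hrest : is_RInt (V := V) (fun s => minus (scal (RtoC (peak s ^ n.+1)) (F s)) (scal (RtoC (peak s ^ n.+1)) a)) (- L) L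
    (minus (RInt (V := V) (fun s => scal (RtoC (peak s ^ n.+1)) (F s)) (- L) L) (scal (RtoC J) a : V)).
  apply: (is_RInt_minus (V := V)) ea.
  by apply: (RInt_correct (V := V)); apply: decays_ex_RInt hp.
have hdom : is_RInt (fun s => norm a / 2 * peak s ^ n.+1 + q * peak s) (- L) L (norm a / 2 * J + q * RInt peak (- L) L).
  apply: (is_RInt_plus (V := R_NormedModule) (fun s => norm a / 2 * peak s ^ n.+1) (fun s => q * peak s)).
    apply: (is_RInt_scal (V := R_NormedModule) (fun s => peak s ^ n.+1)).
    by apply: (RInt_correct (V := R_CompleteNormedModule)); exact: exk.
  apply: (is_RInt_scal (V := R_NormedModule) peak).
  apply: (RInt_correct (V := R_CompleteNormedModule)).
  apply: (ex_RInt_continuous (V := R_CompleteNormedModule)) => s _.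
  by have := ck 1%nat s; apply: continuous_ext => t; rewrite pow_1.
have := @norm_RInt_le V _ _ _ _ _ _ LL _ hrest hdom.
have pw s : - L <= s <= L ->
    @norm C_AbsRing X (minus (scal (RtoC (peak s ^ n.+1)) (F s)) (scal (RtoC (peak s ^ n.+1)) a)) <= norm a / 2 * peak s ^ n.+1 + q * peak s.
  move=> _; rewrite (_ : minus _ _ = scal (RtoC (peak s ^ n.+1)) (minus (F s) a)); last by module X.
  have [k1 k2] := peak_pow_le1 n.+1 s; have k3 := peak_gt0 s.
  rewrite norm_scalC_eq Cmod_R Rabs_pos_eq //.
  have [hs|hs] := Rle_lt_dec (Rabs s) d.
    have := Rmult_le_compat_l _ _ _ k1 (near s hs).
    have : 0 <= q * peak s by apply: Rmult_le_pos; lra.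
    lra.
  have b1 : norm (minus (F s) a) <= K + norm a.
    apply: Rle_trans (norm_minus_le _ _) _; have := hd s.
    have := decay_le_half eps s; have := decay_gt0 eps s; nra.
  have b2 : peak s ^ n <= kd ^ n.
    apply: pow_incr; split; first lra.
    by rewrite -(peak_Rabs s) /kd; apply: peak_decr_le; lra.
  have [k4 k5] := peak_pow_le1 n s.
  have : peak s ^ n * norm (minus (F s) a) <= q.
    by apply: Rmult_le_compat => //; exact: norm_ge_0.
  move=> /(Rmult_le_compat_l (peak s) _ _ ltac:(lra)) b3.
  have : 0 <= norm a / 2 * peak s ^ n.+1 by apply: Rmult_le_pos; lra.
  rewrite /= in b3 *; lra.
move=> /(_ pw) b4.
have b5 : norm (scal (RtoC J) a) = J * norm a.
  rewrite norm_scalC_eq Cmod_R Rabs_pos_eq //.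
  have : 0 < d * kh ^ n.+1 by apply: Rmult_lt_0_compat => //; apply: pow_lt; lra.
  lra.
have b6 := norm_le_minus (scal (RtoC J) a) (RInt (V := V) (fun s => scal (RtoC (peak s ^ n.+1)) (F s)) (- L) L : X).
rewrite norm_minus_sym b5 in b6.
have b7 : q * RInt peak (- L) L <= kd ^ n * B.
  rewrite (_ : kd ^ n * B = q * (2 * PI)); last by rewrite /q /B; ring.
  exact: Rmult_le_compat_l.
have b8 : norm a / 2 * (d * kh ^ n.+1) <= norm a / 2 * J by apply: Rmult_le_compat_l; lra.
move: b4; rewrite -[@norm R_AbsRing _ _]/(norm (minus (RInt (V := V) (fun s => scal (RtoC (peak s ^ n.+1)) (F s)) (- L) L : X) (scal (RtoC J) a))) => b4.
rewrite /low; norm_lra.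
Qed.

End peak.

Section reproducing.
Local Notation CV := C_CompleteNormedModule.

(** The centre [b] may be complex; on the ray through [b] the value is [peak] of the logarithmic
    distance to [b], so the concentration argument applies at any point of the sector. *)
Definition peak_fun (b z : C) : C :=
  Cmult (Cmult (RtoC 4) b) (Cmult z (Cmult (Cinv (Cplus z b)) (Cinv (Cplus z b)))).

Lemma peak_fun_ray s0 th s :
  peak_fun (cexp (s0, th)) (cexp (s0 + s, th)) = RtoC (peak s).
Proof.
have h0 := @cexp_neq0 (s0, th).
have e : cexp (s0 + s, th) = Cmult (cexp (s0, th)) (RtoC (exp s)).
  by rewrite -cexp_real -cexp_plus /Cplus /= Rplus_0_r.
have es := exp_pos s.
have e1 : Cplus (RtoC (exp s)) (RtoC 1) <> RtoC 0.
  by rewrite -RtoC_plus => /RtoC_inj; lra.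
rewrite /peak_fun e.
rewrite (_ : Cmult (Cmult (RtoC 4) _) _ =
  Cmult (RtoC 4) (Cmult (RtoC (exp s)) (Cmult (Cinv (Cplus (RtoC (exp s)) (RtoC 1))) (Cinv (Cplus (RtoC (exp s)) (RtoC 1)))))); last first.
  by field; split => //; rewrite (_ : Cplus _ _ = Cmult (cexp (s0, th)) (Cplus (RtoC (exp s)) (RtoC 1))); [exact: Cmult_neq_0|ring].
rewrite -RtoC_plus -RtoC_inv; last lra.
rewrite -!RtoC_mult; congr RtoC; rewrite /peak exp_Ropp.
by field; repeat split; nra.
Qed.

Lemma peak_fun_bound c : -1 < c <= 1 -> exists2 B, 0 < B & forall z b,
  z <> RtoC 0 -> b <> RtoC 0 -> c * (Cmod z * Cmod b) <= Re (Cmult z (Cconj b)) ->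
  Cplus z b <> RtoC 0 /\ Cmod (peak_fun b z) <= B.
Proof.
move=> hc; have [k k0 hk] := Cmod_plus_ge hc; exists (/ k ^ 2).
  by apply: Rinv_0_lt_compat; nra.
move=> z b z0 b0 h; have {}hk := hk z b h.
have mz := proj1 (Cmod_gt_0 z) z0; have mb := proj1 (Cmod_gt_0 b) b0.
have nz : Cplus z b <> RtoC 0.
  by apply/Cmod_gt_0; apply: Rlt_le_trans hk; apply: Rmult_lt_0_compat; lra.
split => //; rewrite /peak_fun !Cmod_mult !Cmod_inv // Cmod_R Rabs_pos_eq; last lra.
move: hk; set m := Cmod z in mz *; set n := Cmod b in mb *; set q := Cmod (Cplus z b) => hk.
have kq : 0 < k * (m + n) by apply: Rmult_lt_0_compat; lra.
have q0 : 0 < q by lra.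
have h1 : (k * (m + n)) ^ 2 <= q ^ 2 by apply: pow_incr; lra.
have h2 : 4 * (m * n) <= (m + n) ^ 2 by have := pow2_ge_0 (m - n); rewrite /=; lra.
rewrite (_ : 4 * n * _ = 4 * (m * n) / q ^ 2); last by field; lra.
apply/Rle_div_l; first by apply: pow_lt.
apply: Rle_trans h2 _.
apply: (Rmult_le_reg_l (k ^ 2)); first by nra.
rewrite (_ : k ^ 2 * (/ k ^ 2 * q ^ 2) = q ^ 2); last by field; lra.
by rewrite Rpow_mult_distr in h1.
Qed.

Lemma cdiff_Cpow (u : C -> C) n z l : cdiff (u : C -> C_NormedModule) z l ->
  exists m, cdiff ((fun w => Cpow (u w) n) : C -> C_NormedModule) z m.
Proof.
move=> h; elim: n => [|n [m hm]].
  by exists zero; exact: (@cdiff_const C_NormedModule (RtoC 1) z).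
by eexists; exact: (cdiff_scal h hm).
Qed.

Lemma cdiff_peak_fun b z : Cplus z b <> RtoC 0 ->
  exists l, cdiff (peak_fun b : C -> C_NormedModule) z l.
Proof.
move=> h.
have h1 := cdiff_comp (cdiff_plus (cdiff_id z) (@cdiff_const C_NormedModule b z)) (cdiff_Cinv h).
have h2 := cdiff_scal (cdiff_id z) (cdiff_scal h1 h1).
eexists; exact: (cdiff_scal (@cdiff_const C_NormedModule (Cmult (RtoC 4) b) z) h2).
Qed.

Lemma Cmod_Cpow (c : C) n : Cmod (Cpow c n) = Cmod c ^ n.
Proof. by elim: n => [|n IH]; rewrite /= ?Cmod_1 // Cmod_mult IH. Qed.

Lemma Cpow_RtoC r n : Cpow (RtoC r) n = RtoC (r ^ n).
Proof. by elim: n => [|n IH] //=; rewrite IH RtoC_mult. Qed.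

Context (phi eps K : R) (hphi : 0 < phi < PI) (f : C -> C) (hf : holo_decay phi eps K f).

Lemma ray_decays s0 th : Rabs th < phi -> decays (X := CV) eps (K * exp (eps * Rabs s0)) (fun s => f (cexp (s0 + s, th))).
Proof.
move=> hth; have K0 := holo_decay_K_ge0 hphi hf; have [e0 h1 h2] := hf.
split => // s.
- have [l hl] := h1 _ (sector_cexp (s0 + s) (proj2 hphi) hth).
  have hc := cdiff_ccont (X := CV) (cdiff_comp (cdiff_cexp (s0 + s, th)) hl).
  apply/(continuousP (X := CV)) => eta eta0.
  have [d d0 hd] := proj2 (continuousP (X := CV) (fun s => f (cexp (s, th))) (s0 + s)) (ccont_hor hc) eta eta0.
  by exists d => // t ht; apply: hd; rewrite (_ : s0 + t - (s0 + s) = t - s); [|ring].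
- apply: Rle_trans (h2 _ (sector_cexp (s0 + s) (proj2 hphi) hth)) _.
  rewrite Cmod_cexp ln_exp /= Rmult_assoc; apply: Rmult_le_compat_l => //.
  by rewrite Rplus_comm; apply: decay_shift; lra.
Qed.

Lemma Re_cexp_conj s s0 th th0 : Re (Cmult (cexp (s, th)) (Cconj (cexp (s0, th0)))) =
  exp s * exp s0 * cos (th - th0).
Proof. by rewrite cos_minus /Re /=; ring. Qed.

(** The integrals of [k f], [k] a power of a peak centred at [z0], over the ray
    through [z0] and over the positive axis agree by Cauchy's theorem. *)
Lemma nonzero_positive_axis z0 : sector phi z0 -> f z0 <> RtoC 0 ->
  exists s, f (cexp (s, 0)) <> RtoC 0.
Proof.
move=> hz fz0; have [s0 [th0 [ez hth _]]] := sector_polar hz.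
apply: NNPP => hn.
have fz s : f (cexp (s, 0)) = RtoC 0 by apply: NNPP => h; apply: hn; exists s.
have K0 := holo_decay_K_ge0 hphi hf; have [e0 h1 h2] := hf.
have fc : f (cexp (s0 + 0, th0)) <> zero by rewrite Rplus_0_r -ez.
have [n [l [l0 hl]]] := peak_nonzero (ray_decays s0 hth) fc.
pose F w : CV := Cmult (Cpow (peak_fun z0 (cexp w)) n.+1) (f (cexp w)).
have hF : is_line_int (fun s => F (s, th0)) l.
  apply: is_line_int_ext (is_line_int_shift (- s0) hl) => s.
  have e : s0 + (s + - s0) = s by ring.
  have := peak_fun_ray s0 th0 (s + - s0); rewrite e => ep.
  by rewrite /F ez ep Cpow_RtoC.
have hc : -1 < cos phi <= 1.
  by split; [apply: cos_gt_m1; lra|exact: (proj2 (COS_bound phi))].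
have [B B0 hB] := peak_fun_bound hc.
have strip s th : Rmin 0 th0 <= th <= Rmax 0 th0 ->
    Rabs th < phi /\ Cplus (cexp (s, th)) z0 <> RtoC 0 /\ Cmod (peak_fun z0 (cexp (s, th))) <= B.
  (* For angles between 0 and [th0], both [th] and [th - th0] stay below [phi] in absolute value:
     [f] is holomorphic there, and [z] never comes near [- z0]. *)
  move=> ht; have [a1 a2] : Rabs th < phi /\ Rabs (th - th0) < phi.
    move: ht hth; rewrite /Rmin /Rmax /Rabs; case: Rle_dec => ? /= ? ;
    by do 3 case: Rcase_abs => ? /=; lra.
  split => //; apply: hB; [exact: cexp_neq0|by case: hz|].
  rewrite ez Re_cexp_conj !Cmod_cexp /= Rmult_comm; apply: Rmult_le_compat_l.
    by apply: Rlt_le; apply: Rmult_lt_0_compat; exact: exp_pos.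
  rewrite -(cos_Rabs (th - th0)); apply: cos_decr_1; have := Rabs_pos (th - th0); lra.
have rot th1 th2 : th1 <= th2 -> (forall th, th1 <= th <= th2 -> Rmin 0 th0 <= th <= Rmax 0 th0) ->
    is_line_int (fun s => F (s, th1)) l <-> is_line_int (fun s => F (s, th2)) l.
  move=> h12 hst; apply: (is_line_int_rotate (eps := eps) (M := B ^ n.+1 * K) l) => //.
  - move=> s th /hst /(strip s) [b1 [b2 _]].
    have [l1 hl1] := cdiff_peak_fun b2.
    have [l2 hl2] := cdiff_Cpow n.+1 (cdiff_comp (cdiff_cexp (s, th)) hl1).
    have [l3 hl3] := h1 _ (sector_cexp s (proj2 hphi) b1).
    eexists; exact: (cdiff_scal hl2 (cdiff_comp (cdiff_cexp (s, th)) hl3)).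
  - move=> s th /hst /(strip s) [b1 [_ b3]].
    have := h2 _ (sector_cexp s (proj2 hphi) b1); rewrite Cmod_cexp ln_exp /= => b4.
    rewrite /F -[@norm _ _ _]/(Cmod (Cmult (Cpow (peak_fun z0 (cexp (s, th))) n.+1) (f (cexp (s, th))))).
    rewrite Cmod_mult Cmod_Cpow Rmult_assoc.
    apply: Rmult_le_compat => //; [by apply: pow_le; exact: Cmod_ge_0|exact: Cmod_ge_0|].
    by apply: pow_incr; split => //; exact: Cmod_ge_0.
have h0 : is_line_int (fun s => F (s, 0)) l.
  have [t0|/Rlt_le t0] := Rle_lt_dec 0 th0.
    by apply/(rot 0 th0) => // th; rewrite Rmin_left // Rmax_right.
  by apply/(rot th0 0) => // th; rewrite Rmin_right // Rmax_left.
apply: l0; apply: (is_line_int_unique h0).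
have := is_line_int_scal (RtoC 0) h0; rewrite (_ : scal (RtoC 0) l = zero); last exact: scal_zero_l.
apply: is_line_int_ext => s; rewrite /F fz.
by Cring.
Qed.

(** The peak is centred at a point [b > 0] of the axis where [f] does not vanish. Its pole [- b] is
    then off the whole sector, the integral is the same on all rays, and the peak is a polynomial in
    [cauchy_kernel b]. The constant [c] normalizes the integral. *)
Lemma reproducing_function z0 : sector phi z0 -> f z0 <> RtoC 0 ->
  exists b c n, 0 < b /\ forall th, Rabs th < phi ->
    is_line_int (X := CV) (fun s => Cmult (Cmult c (Cpow (peak_fun (RtoC b) (cexp (s, th))) n.+1)) (f (cexp (s, th)))) (RtoC 1).
Proof.
move=> hz fz0; have [s0 fs0] := nonzero_positive_axis hz fz0.
have R0 : Rabs 0 < phi by rewrite Rabs_R0; lra.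
have fc : f (cexp (s0 + 0, 0)) <> zero by rewrite Rplus_0_r.
have [n [l [l0 hl]]] := peak_nonzero (ray_decays s0 R0) fc.
exists (exp s0), (Cinv l), n; split; first exact: exp_pos.
have hc : -1 < cos phi <= 1.
  by split; [apply: cos_gt_m1; lra|exact: (proj2 (COS_bound phi))].
have [B B0 hB] := peak_fun_bound hc.
have hd : holo_decay phi eps (B ^ n.+1 * K) (fun z => Cmult (Cpow (peak_fun (RtoC (exp s0)) z) n.+1) (f z)).
  have cond z : sector phi z -> Cplus z (RtoC (exp s0)) <> RtoC 0 /\ Cmod (peak_fun (RtoC (exp s0)) z) <= B.
    move=> hz'; apply: hB; first by case: hz'.
      by move/RtoC_inj; have := exp_pos s0; lra.
    rewrite Cmod_R Rabs_pos_eq; last exact: Rlt_le (exp_pos s0).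
    rewrite (_ : Re _ = Re z * exp s0); last by rewrite /Re /=; ring.
    rewrite -Rmult_assoc; apply: Rmult_le_compat_r; first exact: Rlt_le (exp_pos s0).
    exact: sector_Re.
  apply: holo_decay_mult hf => z /cond [c1 c2].
    have [l1 hl1] := cdiff_peak_fun c1; exact: cdiff_Cpow hl1.
  by rewrite Cmod_Cpow; apply: pow_incr; split => //; exact: Cmod_ge_0.
have [l' hl'] := line_int_sector (X := CV) (RtoC 1) hphi hd.
have el : l' = l.
  apply: (is_line_int_unique (hl' 0 R0)).
  apply: is_line_int_ext (is_line_int_shift (- s0) hl) => s.
  have e : s0 + (s + - s0) = s by ring.
  have := peak_fun_ray s0 0 (s + - s0); rewrite e => ep.
  by rewrite -cexp_real ep Cpow_RtoC; Cring.
move=> th /hl' h; have := is_line_int_scal (Cinv l) h.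
rewrite el (_ : scal (Cinv l) l = RtoC 1); last by Cfield.
by apply: is_line_int_ext => s; Cring.
Qed.

End reproducing.

(** * Riemann sums on rays *)

Section abelian_monoid_law.
Context (G : AbelianMonoid).

HB.instance Definition _ := Monoid.isComLaw.Build G (@zero G) (@plus G)
  (@plus_assoc G) (@plus_comm G) (@plus_zero_l G).

End abelian_monoid_law.

Fact CplusA : associative Cplus. Proof. by move=> x y z; rewrite Cplus_assoc. Qed.
Fact CplusC : commutative Cplus. Proof. exact: Cplus_comm. Qed.
Fact Cadd0c : left_id (RtoC 0) Cplus. Proof. exact: Cplus_0_l. Qed.
HB.instance Definition _ := Monoid.isComLaw.Build C (RtoC 0) Cplus CplusA CplusC Cadd0c.

Section riemann_sums.
Local Notation CV := C_CompleteNormedModule.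
Local Notation V := (restr_scalars C_CompleteNormedModule).

Lemma big_Rle (I : finType) (F G : I -> R) : (forall i, F i <= G i) ->
  \big[Rplus/0]_(i : I) F i <= \big[Rplus/0]_(i : I) G i.
Proof.
move=> h; elim/big_ind2: _ => //; first lra.
by move=> x1 x2 y1 y2 hx hy; apply: Rplus_le_compat.
Qed.

Lemma big_Rscal (I : finType) c (F : I -> R) :
  \big[Rplus/0]_(i : I) (c * F i) = c * \big[Rplus/0]_(i : I) F i.
Proof.
elim/big_ind2: _ => //; first by ring.
by move=> x1 x2 y1 y2 -> ->; ring.
Qed.

Lemma big_Rge0 (I : finType) (F : I -> R) : (forall i, 0 <= F i) -> 0 <= \big[Rplus/0]_(i : I) F i.
Proof.
move=> h; elim/big_ind: _ => //; first lra.
by move=> x y hx hy; lra.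
Qed.

Lemma norm_big_le (X : NormedModule C_AbsRing) n (F : 'I_n -> X) :
  norm (\big[plus/zero]_(i < n) F i) <= \big[Rplus/0]_(i < n) norm (F i).
Proof.
elim/big_ind2: _ => //; first by rewrite norm_zero; lra.
- move=> x1 x2 y1 y2 hx hy; apply: Rle_trans (norm_triangle _ _) _; lra.
- by move=> i _; lra.
Qed.

(** The increment of the primitive is [l] times [decay] at a point within distance [l] of [s], where
    [decay] is smaller by a factor of at most [exp (eps * l)]. Summed over the steps, the right
    sides telescope. *)
Lemma decay_step eps l s : 0 < eps -> 0 < l ->
  decay eps s <= exp (eps * l) / l * (decay_primitive eps (s + l) - decay_primitive eps s).
Proof.
move=> e0 l0.
have [c [h hc]] := MVT_cor2 (decay_primitive eps) (decay eps) s (s + l) ltac:(lra)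
  (fun c _ => proj1 (is_derive_Reals _ _ _) (is_derive_decay_primitive c e0)).
rewrite h (_ : s + l - s = l); last by ring.
rewrite (_ : exp (eps * l) / l * (decay eps c * l) = exp (eps * l) * decay eps c); last by field; lra.
have := @decay_shift eps c (s - c) ltac:(lra).
rewrite (_ : c + (s - c) = s); last by ring.
move/Rle_trans; apply; apply: Rmult_le_compat_r; first exact: Rlt_le (decay_gt0 _ _).
rewrite Rabs_left1; last lra.
have : eps * - (s - c) <= eps * l by apply: Rmult_le_compat_l; lra.
by case=> [/exp_increasing /Rlt_le //|->]; lra.
Qed.

Lemma sum_decay eps l s n : 0 < eps -> 0 < l ->
  \big[Rplus/0]_(i < n) decay eps (s + INR i * l) <=
  exp (eps * l) / l * (decay_primitive eps (s + INR n * l) - decay_primitive eps s).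
Proof.
move=> e0 l0; elim: n => [|n IH].
  by rewrite big_ord0 /= Rmult_0_l Rplus_0_r Rminus_diag Rmult_0_r; lra.
rewrite big_ord_recr /=; have := decay_step (s + INR n * l) e0 l0.
rewrite -[match n with O => 1 | _ => _ end]/(INR n.+1) S_INR.
rewrite (_ : s + INR n * l + l = s + (INR n + 1) * l); last by ring.
move=> h; apply: Rle_trans (Rplus_le_compat _ _ _ _ IH h) _; lra.
Qed.

Lemma sum_decay_bound eps l s n : 0 < eps -> 0 < l ->
  \big[Rplus/0]_(i < n) decay eps (s + INR i * l) <= exp (eps * l) / l * (PI / (2 * eps)).
Proof.
move=> e0 l0; apply: Rle_trans (sum_decay s n e0 l0) _.
apply: Rmult_le_compat_l.
  by apply: Rdiv_le_0_compat => //; exact: Rlt_le (exp_pos _).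
have := decay_primitive_lt (s + INR n * l) e0; have := decay_primitive_ge0 s e0; lra.
Qed.

(** Half of the exponent is traded for a small factor: [decay eps] is at most the square of
    [exp (- eps/2 * |s|)], and [decay (eps / 2)] is at least half of that exponential. *)
Lemma decay_half_dom eps eta : 0 < eps -> 0 < eta ->
  exists L, 0 <= L /\ forall s, L <= Rabs s -> decay eps s <= eta * decay (eps / 2) s.
Proof.
move=> e0 eta0.
pose L := Rmax 0 (- ln (eta / 2) / (eps / 2)).
exists L; split; first exact: Rmax_l.
move=> s hs.
have Rabs_decay d : decay d s = decay d (Rabs s).
  by rewrite /Rabs; case: Rcase_abs => // _; rewrite decay_opp.
rewrite !Rabs_decay; set r := Rabs s in hs *.
have r0 : 0 <= r by exact: Rabs_pos.
apply: Rle_trans (decay_le_exp eps r) _.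
have d1 : / 2 * exp (- (eps / 2 * r)) <= decay (eps / 2) r.
  rewrite /decay exp_Ropp -Rinv_mult; apply: Rinv_le_contravar.
    by rewrite -exp_Ropp; have := exp_pos (eps / 2 * r); have := exp_pos (- (eps / 2 * r)); lra.
  have h1 := exp_pos (eps / 2 * r).
  have : 1 <= exp (eps / 2 * r).
    have er0 : 0 <= eps / 2 * r by apply: Rmult_le_pos; lra.
    by have := exp_ineq1_le (eps / 2 * r); lra.
  move=> h2; have : / exp (eps / 2 * r) <= / 1 by apply: Rinv_le_contravar; lra.
  by rewrite Rinv_1; lra.
apply: Rle_trans (Rmult_le_compat_l eta _ _ (Rlt_le _ _ eta0) d1).
rewrite (_ : - (eps * r) = - (eps / 2 * r) + - (eps / 2 * r)); last by field.
rewrite exp_plus -Rmult_assoc; apply: Rmult_le_compat_r; first exact: Rlt_le (exp_pos _).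
rewrite -[X in _ <= X](exp_ln (eta * / 2)); last lra.
have : - (eps / 2 * r) <= ln (eta * / 2).
  have : - ln (eta / 2) / (eps / 2) <= r by apply: Rle_trans hs; exact: Rmax_r.
  move/(Rle_div_l _ _ (eps / 2) ltac:(lra)); rewrite /Rdiv; lra.
by case=> [/exp_increasing /Rlt_le //|->]; lra.
Qed.

Context (phi sigma eps K : R) (hphi : phi < PI) (hsigma : 0 < sigma < phi).
Context (h : C -> C) (hh : holo_decay phi eps K h).

Let hphi' : 0 < phi < PI. Proof. lra. Qed.

Lemma holo_strip_ccont s th : Rabs th < phi -> ccont (X := CV) (fun w => h (cexp w)) (s, th).
Proof.
move=> hth; have [_ h1 _] := hh; have [l hl] := h1 _ (sector_cexp s hphi hth).
exact: (cdiff_ccont (X := CV) (cdiff_comp (cdiff_cexp (s, th)) hl)).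
Qed.

(** Uniform continuity of a real function of two variables on a compact rectangle, with [p] the real
    or the imaginary part. The rectangle extends to [L + 1] so that [s + tau] stays in it. *)
Lemma unif_cont_component (p : C -> R) L eta :
  (forall z w, Rabs (p z - p w) <= Cmod (Cminus z w)) -> 0 < eta ->
  exists2 d, 0 < d & forall s tau th, Rabs s <= L -> 0 <= tau < d -> tau <= 1 -> Rabs th <= sigma ->
    Rabs (p (h (cexp (s + tau, th))) - p (h (cexp (s, th)))) < eta.
Proof.
move=> hp eta0.
have c2 x y : - L <= x <= L + 1 -> - sigma <= y <= sigma ->
    continuity_2d_pt (fun s th => p (h (cexp (s, th)))) x y.
  move=> _ hy e; have hy' : Rabs y < phi by apply: Rle_lt_trans (_ : sigma < phi); [apply: Rabs_le; lra|lra].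
  have [d d0 hd] := holo_strip_ccont x hy' (cond_pos e).
  have d20 : 0 < d / 2 by lra.
  exists (mkposreal _ d20) => u v /= hu hv.
  apply: Rle_lt_trans (hp _ _) _.
  have := hd (u - x, v - y); rewrite (_ : Cplus (x, y) (u - x, v - y) = (u, v)); last first.
    by rewrite /Cplus /=; congr pair; ring.
  apply; apply: Rle_lt_trans (Cmod_le_sum _) _; rewrite /=; lra.
have [d hd] := uniform_continuity_2d _ _ _ _ _ c2 (mkposreal _ eta0).
exists d; first exact: cond_pos.
move=> s tau th /Rabs_le_between hs ht t1 /Rabs_le_between hth.
apply: (hd s th (s + tau) th); try lra.
- by rewrite (_ : s + tau - s = tau) ?Rabs_pos_eq; [lra|lra|ring].
- by rewrite Rminus_diag Rabs_R0; exact: cond_pos.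
Qed.

(** The weight [decay (eps / 2)] makes the errors summable over infinitely many steps. For large
    [|s|] both values are small by decay; on the remaining compact set uniform continuity
    applies. *)
Lemma holo_unif_cont eta : 0 < eta ->
  exists2 d, 0 < d <= 1 & forall s tau th, 0 <= tau <= d -> Rabs th <= sigma ->
    Cmod (Cminus (h (cexp (s + tau, th))) (h (cexp (s, th)))) <= eta * decay (eps / 2) s.
Proof.
move=> eta0; have K0 := holo_decay_K_ge0 hphi' hh; have [e0 h1 h2] := hh.
pose q := K * (exp eps + 1) + 1.
have q0 : 0 < q.
  have : 0 <= K * (exp eps + 1) by apply: Rmult_le_pos => //; have := exp_pos eps; lra.
  rewrite /q; lra.
have [L [L0 hL]] := decay_half_dom e0 (Rdiv_lt_0_compat _ _ eta0 q0).
(* The least value of the weight on [[- L, L]] is at [L]; each of the two components may use half of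
   it. *)
pose mu := eta * decay (eps / 2) L / 2.
have mu0 : 0 < mu.
  by apply: Rdiv_lt_0_compat; [apply: Rmult_lt_0_compat => //; exact: decay_gt0|lra].
have [d1 d10 hd1] := unif_cont_component L (p := fst) (fun z w => Rabs_fst_le (Cminus z w)) mu0.
have [d2 d20 hd2] := unif_cont_component L (p := snd) (fun z w => Rabs_snd_le (Cminus z w)) mu0.
exists (Rmin 1 (Rmin d1 d2 / 2)).
  split; last exact: Rmin_l.
  by apply: Rmin_pos; [lra|have := Rmin_pos _ _ d10 d20; lra].
move=> s tau th [t0 ht] hth.
have t1 : tau <= 1 by apply: Rle_trans ht _; exact: Rmin_l.
have t2 : tau < Rmin d1 d2.
  have := Rmin_r 1 (Rmin d1 d2 / 2); have := Rmin_pos _ _ d10 d20; lra.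
have hth' : Rabs th < phi by lra.
have [hs|hs] := Rle_lt_dec L (Rabs s).
  have b s' : Cmod (h (cexp (s', th))) <= K * decay eps s'.
    by have := h2 _ (sector_cexp s' hphi hth'); rewrite Cmod_cexp ln_exp.
  apply: Rle_trans (Cmod_triangle _ _) _; rewrite Cmod_opp.
  apply: Rle_trans (Rplus_le_compat _ _ _ _ (b _) (b _)) _.
  have b1 : decay eps (s + tau) <= exp eps * decay eps s.
    apply: Rle_trans (decay_shift s tau (Rlt_le _ _ e0)) _.
    apply: Rmult_le_compat_r; first exact: Rlt_le (decay_gt0 _ _).
    rewrite Rabs_pos_eq //.
    have : eps * tau <= eps by rewrite -[X in _ <= X]Rmult_1_r; apply: Rmult_le_compat_l; lra.
    by case=> [/exp_increasing /Rlt_le //|->]; lra.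
  have dk := decay_gt0 eps s.
  apply: Rle_trans (_ : q * decay eps s <= _).
    have := Rmult_le_compat_l K _ _ K0 b1; rewrite /q; lra.
  have := Rmult_le_compat_l q _ _ (Rlt_le _ _ q0) (hL s hs).
  by rewrite (_ : q * (eta / q * decay (eps / 2) s) = eta * decay (eps / 2) s) //; field; lra.
have t3 := Rmin_l d1 d2; have t4 := Rmin_r d1 d2.
apply: Rle_trans (Cmod_le_sum _) _.
have := hd1 s tau th ltac:(lra) ltac:(lra) t1 hth.
have := hd2 s tau th ltac:(lra) ltac:(lra) t1 hth.
have : mu + mu <= eta * decay (eps / 2) s.
  rewrite (_ : mu + mu = eta * decay (eps / 2) L); last by rewrite /mu; field.
  apply: Rmult_le_compat_l; first lra.
  have -> : decay (eps / 2) s = decay (eps / 2) (Rabs s).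
    by rewrite /Rabs; case: Rcase_abs => // _; rewrite decay_opp.
  apply: Rinv_le_contravar.
    by have := exp_pos (eps / 2 * Rabs s); have := exp_pos (- (eps / 2 * Rabs s)); lra.
  have r0 := Rabs_pos s.
  have [e|lt] := Req_dec (Rabs s) L; first by rewrite e; lra.
  apply: Rlt_le; apply: cosh_mono; first by apply: Rmult_le_pos; lra.
  by apply: Rmult_lt_compat_l; lra.
have -> (z w : C) : Rabs (fst (Cminus z w)) + Rabs (snd (Cminus z w)) =
  Rabs (fst z - fst w) + Rabs (snd z - snd w) by [].
lra.
Qed.

Lemma ray_continuous th s : Rabs th < phi -> continuous ((fun s => h (cexp (s, th))) : R -> V) s.
Proof. by move=> hth; exact: (ccont_hor (X := CV) (holo_strip_ccont s hth)). Qed.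

Lemma ray_ex_RInt th a b : Rabs th < phi -> ex_RInt (V := V) (fun s => h (cexp (s, th))) a b.
Proof. by move=> hth; apply: (ex_RInt_continuous (V := V)) => s _; exact: ray_continuous. Qed.

Lemma riemann_step eta d s l th : 0 < l <= d -> Rabs th <= sigma ->
  (forall s tau, 0 <= tau <= d ->
    Cmod (Cminus (h (cexp (s + tau, th))) (h (cexp (s, th)))) <= eta * decay (eps / 2) s) ->
  Cmod (Cminus (RInt (V := V) (fun s => h (cexp (s, th))) s (s + l)) (Cmult (RtoC l) (h (cexp (s, th))))) <=
    l * (eta * decay (eps / 2) s).
Proof.
move=> hl hth osc; have hth' : Rabs th < phi by lra.
have h1 := RInt_correct (V := V) _ _ _ (ray_ex_RInt s (s + l) hth').
have h2 := is_RInt_const (V := V) s (s + l) (h (cexp (s, th))).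
have := @norm_RInt_le_const V _ s (s + l) _ (eta * decay (eps / 2) s) ltac:(lra) _ (is_RInt_minus (V := V) _ _ _ _ _ _ h1 h2).
rewrite (_ : s + l - s = l); last by ring.
have pw t : s <= t <= s + l -> @norm R_AbsRing V (minus (h (cexp (t, th)) : V) (h (cexp (s, th)))) <= eta * decay (eps / 2) s.
  move=> ht; have := osc s (t - s) ltac:(lra).
  by rewrite (_ : s + (t - s) = t); [|ring].
by move=> /(_ pw).
Qed.

Lemma riemann_sum_error eta d s l th n : 0 < l <= d -> Rabs th <= sigma ->
  (forall s tau, 0 <= tau <= d ->
    Cmod (Cminus (h (cexp (s + tau, th))) (h (cexp (s, th)))) <= eta * decay (eps / 2) s) ->
  Cmod (Cminus (RInt (V := V) (fun s => h (cexp (s, th))) s (s + INR n * l))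
      (Cmult (RtoC l) (\big[Cplus/RtoC 0]_(i < n) h (cexp (s + INR i * l, th))))) <=
    l * (eta * \big[Rplus/0]_(i < n) decay (eps / 2) (s + INR i * l)).
Proof.
move=> hl hth osc; have hth' : Rabs th < phi by lra.
elim: n => [|n IH].
  rewrite !big_ord0 /= Rmult_0_l Rplus_0_r (RInt_point (V := V)).
  rewrite (_ : Cminus _ _ = RtoC 0); last by Cring.
  by rewrite Cmod_0 !Rmult_0_r; lra.
rewrite !big_ord_recr S_INR.
have := riemann_step (s + INR n * l) hl hth osc.
rewrite (_ : s + INR n * l + l = s + (INR n + 1) * l); last by ring.
rewrite -(RInt_Chasles (V := V) _ s (s + INR n * l) (s + (INR n + 1) * l)); try exact: ray_ex_RInt.
move: IH; set i1 : C := RInt (V := V) _ _ _; set i2 : C := RInt (V := V) _ _ _.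
set S1 := \big[_/_]_(_ < n) _; set S2 := \big[_/_]_(_ < n) _ => h1 h2.
rewrite -[plus i1 i2]/(Cplus i1 i2).
rewrite (_ : Cminus _ _ = Cplus (Cminus i1 (Cmult (RtoC l) S1)) (Cminus i2 (Cmult (RtoC l) (h (cexp (s + INR n * l, th)))))); last by rewrite /=; ring.
by apply: Rle_trans (Cmod_triangle _ _) _; rewrite /= in h1 h2 *; lra.
Qed.

(** Since [PI / (2 * eps)] is the total integral of [decay eps], the bracket is its mass off
    [[a, b]]. *)
Lemma line_int_tail th (c : C) a b : Rabs th < phi -> a <= b ->
  is_line_int (X := CV) (fun s => h (cexp (s, th))) c ->
  Cmod (Cminus c (RInt (V := V) (fun s => h (cexp (s, th))) a b)) <=
    K * (PI / (2 * eps) - decay_primitive eps b + decay_primitive eps a).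
Proof.
move=> hth ab [_ hc]; have K0 := holo_decay_K_ge0 hphi' hh; have [e0 h1 h2] := hh.
have dec : decays (X := CV) eps K (fun s => h (cexp (s, th))).
  split => // s; first exact: ray_continuous.
  by have := h2 _ (sector_cexp s hphi hth); rewrite Cmod_cexp ln_exp.
apply: le_epsilon => eta /hc [L hL].
pose a' := Rmin a (- L); pose b' := Rmax b L.
have aa : a' <= a by exact: Rmin_l. have bb : b <= b' by exact: Rmax_l.
have := hL a' b' (Rmin_r _ _) (Rmax_r _ _).
have e := RInt_Chasles (V := V) (fun s => h (cexp (s, th))) a' a b (ray_ex_RInt _ _ hth) (ray_ex_RInt _ _ hth).
have e' := RInt_Chasles (V := V) (fun s => h (cexp (s, th))) a' b b' (ray_ex_RInt _ _ hth) (ray_ex_RInt _ _ hth).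
have n1 := decays_norm_RInt dec aa; have n2 := decays_norm_RInt dec bb.
rewrite -e' -e.
move: n1 n2; set i1 : C := RInt (V := V) _ _ _; set i2 : C := RInt (V := V) _ _ _; set i3 : C := RInt (V := V) _ _ _ => n1 n2.
rewrite -[minus _ _]/(Cminus (Cplus (Cplus i1 i3) i2) c) => n3.
rewrite (_ : Cminus c i3 = Cplus (Copp (Cminus (Cplus (Cplus i1 i3) i2) c)) (Cplus i1 i2)); last by ring.
apply: Rle_trans (Cmod_triangle _ _) _; rewrite Cmod_opp.
have n4 := Cmod_triangle i1 i2.
have p1 := decay_primitive_lt b' e0; have p2 := decay_primitive_ge0 a' e0.
have q1 : K * (decay_primitive eps a - decay_primitive eps a') <= K * decay_primitive eps a.
  by apply: Rmult_le_compat_l; lra.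
have q2 : K * (decay_primitive eps b' - decay_primitive eps b) <= K * (PI / (2 * eps) - decay_primitive eps b).
  by apply: Rmult_le_compat_l; lra.
rewrite /norm /= in n1 n2 n3; lra.
Qed.

(** The distance to 1 consists of the error of the Riemann sum and of the integral outside the range
    of the sum. The mesh [l] depends on [delta] alone, so the range can be enlarged afterwards. *)
Lemma reproducing_sum delta : 0 < delta ->
  (forall th, Rabs th <= sigma -> is_line_int (X := CV) (fun s => h (cexp (s, th))) (RtoC 1)) ->
  exists2 l, 0 < l <= 1 & forall n s th, Rabs th <= sigma ->
    Cmod (Cminus (RtoC 1) (Cmult (RtoC l) (\big[Cplus/RtoC 0]_(i < n) h (cexp (s + INR i * l, th))))) <=
    delta + K * (PI / (2 * eps) - decay_primitive eps (s + INR n * l) + decay_primitive eps s).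
Proof.
move=> delta0 h1; have [e0 _ _] := hh.
have pi0 := PI_RGT_0.
(* Bounds [l] times any sum of the weights [decay (eps / 2)] over steps of length [l <= 1]. *)
pose q := exp (eps / 2) * (PI / (2 * (eps / 2))).
have q0 : 0 < q by apply: Rmult_lt_0_compat; [exact: exp_pos|apply: Rdiv_lt_0_compat; lra].
have [l hl osc] := holo_unif_cont (Rdiv_lt_0_compat _ _ delta0 q0).
exists l => // n s th hth; have hth' : Rabs th < phi by lra.
have b1 := riemann_sum_error s n (conj (proj1 hl) (Rle_refl l)) hth (fun s tau ht => osc s tau th ht hth).
have nl : 0 <= INR n * l by apply: Rmult_le_pos; [exact: pos_INR|lra].
have b2 := line_int_tail hth' (a := s) (b := s + INR n * l) ltac:(lra) (h1 th hth).
move: b1 b2; set i1 : C := RInt (V := V) _ _ _; set S1 := \big[_/_]_(_ < n) _ => b1 b2.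
rewrite (_ : Cminus _ _ = Cplus (Cminus i1 (Cmult (RtoC l) S1)) (Cminus (RtoC 1) i1)); last by ring.
apply: Rle_trans (Cmod_triangle _ _) _.
apply: Rplus_le_compat b2; apply: Rle_trans b1 _.
have := sum_decay_bound s n (eps := eps / 2) ltac:(lra) (proj1 hl).
set S2 := \big[_/_]_(_ < n) _ => b3.
apply: Rle_trans (_ : l * (delta / q * (exp (eps / 2 * l) / l * (PI / (2 * (eps / 2))))) <= _).
  apply: Rmult_le_compat_l; first lra.
  by apply: Rmult_le_compat_l => //; apply: Rlt_le; apply: Rdiv_lt_0_compat.
rewrite (_ : l * _ = delta / q * (exp (eps / 2 * l) * (PI / (2 * (eps / 2))))); last by field; lra.
apply: Rle_trans (_ : delta / q * q <= _); last by apply: Req_le; field; lra.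
apply: Rmult_le_compat_l; first by apply: Rlt_le; apply: Rdiv_lt_0_compat.
apply: Rmult_le_compat_r; first by apply: Rlt_le; apply: Rdiv_lt_0_compat; lra.
have : eps / 2 * l <= eps / 2 by rewrite -[X in _ <= X]Rmult_1_r; apply: Rmult_le_compat_l; lra.
by case=> [/exp_increasing /Rlt_le //|->]; lra.
Qed.

End riemann_sums.

(** * Randomization *)

Definition rademacher_sign (b : bool) : R := if b then 1 else -1.

Section randomization.

Lemma rademacher_sign_abs b : Rabs (rademacher_sign b) = 1.
Proof. by case: b; rewrite /= ?Rabs_Ropp Rabs_R1. Qed.

Lemma big_sign_patterns N : \big[Rplus/0]_(e : {ffun 'I_N -> bool}) 1 = 2 ^ N.
Proof.
rewrite big_const card_ffun card_bool card_ord.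
rewrite -[LHS]/(iter (expn 2 N) (Rplus 1) 0).
have -> : iter (expn 2 N) (Rplus 1) 0 = INR (expn 2 N).
  by elim: (expn 2 N) => [//|n IH]; rewrite iterS IH S_INR; ring.
elim: N => [|N IH]; first by rewrite expn0.
by rewrite expnS mult_INR IH /=; ring.
Qed.

Lemma rademacher_mean_le N (g h : {ffun 'I_N -> bool} -> R) : (forall e, g e <= h e) ->
  rademacher_mean g <= rademacher_mean h.
Proof.
move=> gh; apply: Rmult_le_compat_r; last exact: big_Rle.
by apply: Rlt_le; apply: Rinv_0_lt_compat; apply: pow_lt; lra.
Qed.

Lemma rademacher_mean_affine N a b (g : {ffun 'I_N -> bool} -> R) :
  rademacher_mean (fun e => a + b * g e) = a + b * rademacher_mean g.
Proof.
rewrite /rademacher_mean big_split /= big_Rscal.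
rewrite (eq_bigr (fun e : {ffun 'I_N -> bool} => a * 1)); last by move=> e _; ring.
rewrite big_Rscal big_sign_patterns.
set S := \big[_/_]_(_ : _) _; have : 2 ^ N <> 0 by apply: pow_nonzero; lra.
by move: S (2 ^ N) => S t t0; field.
Qed.

(** For distinct indices, flipping the [i]-th sign permutes the patterns and negates every term. *)
Lemma rademacher_orthogonal N (i j : 'I_N) :
  \big[Rplus/0]_(e : {ffun 'I_N -> bool}) (rademacher_sign (e i) * rademacher_sign (e j)) =
  if i == j then 2 ^ N else 0.
Proof.
case: eqP => [->|/eqP ij].
  by rewrite -big_sign_patterns; apply: eq_bigr => e _; case: (e j) => /=; ring.
pose flip (e : {ffun 'I_N -> bool}) := [ffun k => if k == i then ~~ e k else e k].
have flipK : involutive flip.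
  by move=> e; apply/ffunP => k; rewrite !ffunE; case: (k == i) => //; rewrite negbK.
set S := \big[_/_]_(e : _) _.
suff : S = - S by lra.
rewrite {1}/S (reindex_inj (inv_inj flipK)) /=.
rewrite (eq_bigr (fun e : {ffun 'I_N -> bool} => -1 * (rademacher_sign (e i) * rademacher_sign (e j)))); last first.
  move=> e _; rewrite !ffunE eqxx eq_sym (negbTE ij).
  by case: (e i); case: (e j); rewrite /=; ring.
rewrite /S; elim/big_ind2: _ => [|x1 x2 y1 y2 -> ->|e _]; ring.
Qed.

Context (X : NormedModule C_AbsRing).

Lemma signed_sumE N (y : 'I_N -> X) e :
  signed_sum y e = \big[plus/zero]_(i < N) scal (RtoC (rademacher_sign (e i))) (y i).
Proof.
by apply: eq_bigr => i _; case: (e i); module X.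
Qed.

Lemma sum_scal (I : finType) (c : C) (F : I -> X) :
  \big[plus/zero]_(i : I) scal c (F i) = scal c (\big[plus/zero]_(i : I) F i).
Proof.
elim/big_ind2: _ => [|x1 x2 y1 y2 -> ->|//]; first by rewrite scal_zero_r.
by module X.
Qed.

Lemma sum_scal_l (I : finType) (r : I -> R) (x : X) :
  \big[plus/zero]_(i : I) scal (RtoC (r i)) x = scal (RtoC (\big[Rplus/0]_(i : I) r i)) x.
Proof.
elim/big_ind2: _ => [|x1 x2 y1 y2 -> ->|//].
  by symmetry; exact: scal_zero_l.
by module X; rewrite RtoC_plus; ring.
Qed.

Lemma linear_sum (I : finType) (T : X -> X) (F : I -> X) : is_linear T ->
  T (\big[plus/zero]_(i : I) F i) = \big[plus/zero]_(i : I) T (F i).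
Proof.
move=> hT; elim/big_ind2: _ => [|x1 x2 y1 y2 <- <-|//]; first exact: linear_zero.
exact: linear_plus.
Qed.

(** Inserting the same signs in front of the operators and of the vectors creates the terms
    [U i (y j)] with factor [eps_i eps_j]; in the mean only the diagonal survives. *)
Lemma decoupling N (U : 'I_N -> X -> X) (y : 'I_N -> X) : (forall i, is_linear (U i)) ->
  \big[plus/zero]_(i < N) U i (y i) =
  scal (RtoC (/ 2 ^ N)) (\big[plus/zero]_(e : {ffun 'I_N -> bool})
    \big[plus/zero]_(i < N) scal (RtoC (rademacher_sign (e i))) (U i (signed_sum y e))).
Proof.
move=> hU.
have -> : \big[plus/zero]_(e : {ffun 'I_N -> bool}) \big[plus/zero]_(i < N)
      scal (RtoC (rademacher_sign (e i))) (U i (signed_sum y e)) =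
    \big[plus/zero]_(i < N) \big[plus/zero]_(j < N)
      scal (RtoC (\big[Rplus/0]_(e : {ffun 'I_N -> bool}) (rademacher_sign (e i) * rademacher_sign (e j)))) (U i (y j)).
  rewrite exchange_big /=; apply: eq_bigr => i _.
  rewrite (eq_bigr (fun e : {ffun 'I_N -> bool} => \big[plus/zero]_(j < N)
      scal (RtoC (rademacher_sign (e i) * rademacher_sign (e j))) (U i (y j)))).
    by rewrite exchange_big /=; apply: eq_bigr => j _; rewrite sum_scal_l.
  move=> e _; rewrite signed_sumE (linear_sum _ (hU i)) -sum_scal; apply: eq_bigr => j _.
  by rewrite (linear_scal _ (hU i)); module X; rewrite RtoC_mult; ring.
rewrite -sum_scal; apply: eq_bigr => i _.
rewrite (bigD1 i) //= rademacher_orthogonal eqxx.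
rewrite big1 => [|j ji].
  rewrite plus_zero_r; module X; rewrite -!RtoC_mult; congr RtoC; field.
  by apply: pow_nonzero; lra.
by rewrite rademacher_orthogonal eq_sym (negbTE ji); exact: scal_zero_l.
Qed.

Lemma norm_decoupling N (U : 'I_N -> X -> X) (y : 'I_N -> X) B : (forall i, is_linear (U i)) ->
  (forall e : {ffun 'I_N -> bool}, forall x,
    norm (\big[plus/zero]_(i < N) scal (RtoC (rademacher_sign (e i))) (U i x)) <= B * norm x) ->
  norm (\big[plus/zero]_(i < N) U i (y i)) <=
  B * rademacher_mean (fun e => norm (signed_sum y e)).
Proof.
move=> hU hB; rewrite decoupling // norm_scalC_eq Cmod_R.
have p2 : 0 < 2 ^ N by apply: pow_lt; lra.
have ip : 0 < / 2 ^ N by exact: Rinv_0_lt_compat.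
rewrite Rabs_pos_eq; last lra.
rewrite /rademacher_mean /Rdiv -Rmult_assoc Rmult_comm; apply: Rmult_le_compat_r; first lra.
elim/big_rec2: _ => [|e x1 x2 _ h]; first by rewrite norm_zero; lra.
apply: Rle_trans (norm_triangle _ _) _; have := hB e (signed_sum y e); lra.
Qed.

End randomization.

(** * Square function estimates *)

Lemma dilate_cexp s u th : Cmult (RtoC (exp s)) (cexp (u, th)) = cexp (u + s, th).
Proof. by rewrite -cexp_real -cexp_plus /Cplus /= Rplus_0_l Rplus_comm. Qed.

Lemma holo_decay_sum phi eps n (v : 'I_n -> C -> C) : 0 < eps ->
  (forall i, exists K, holo_decay phi eps K (v i)) ->
  exists K, holo_decay phi eps K (fun z => \big[Cplus/RtoC 0]_(i < n) v i z).
Proof.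
move=> e0; elim: n v => [|n IH] v h.
  exists 0; apply: (holo_decay_ext (v := fun=> RtoC 0)); last exact: holo_decay0.
  by move=> z; rewrite big_ord0.
have [K1 h1] := IH _ (fun i => h (widen_ord (leqnSn n) i)).
have [K2 h2] := h ord_max.
exists (K1 + K2); apply: holo_decay_ext (holo_decay_plus h1 h2) => z.
by rewrite big_ord_recr.
Qed.

Section square_functions.
Context (X : CompleteNormedModule C_AbsRing) (A : operator X).
Context (omega sigma nu phi : R) (hA : sectorial A omega).
Context (hnu : omega < nu < sigma) (hsigma : sigma < phi) (hphi : phi < PI).
Context (M : R) (M0 : 0 <= M)
  (hM : forall z, outside nu z -> is_resolvent A z (resolvent A z) /\
    forall x, Cmod z * norm (resolvent A z x) <= M * norm x).
Context (Kc : R) (Kc0 : 0 <= Kc)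
  (hK : forall v eps K B x y, holo_decay sigma eps K v ->
    (forall z, sector sigma z -> Cmod (v z) <= B) -> is_dunford A nu v x y ->
    norm y <= Kc * B * norm x).
Context (eps Kf : R) (f : C -> C) (hf : holo_decay phi eps Kf f).

Let ho : 0 < omega < PI. Proof. exact: omega_bound hA. Qed.
Let hs' : 0 < sigma < PI. Proof. lra. Qed.
Let hs : sigma < PI. Proof. lra. Qed.
Let hp' : 0 < phi < PI. Proof. lra. Qed.
Let hsp : 0 < sigma < phi. Proof. lra. Qed.
Let e0 : 0 < eps. Proof. by case: hf. Qed.
Let Kf0 : 0 <= Kf. Proof. exact: holo_decay_K_ge0 hp' hf. Qed.

Definition dilate (s : R) (z : C) : C := f (Cmult (RtoC (exp s)) z).

(** [f(tA) x] at [t = e^s], a coordinate in which [dt/t] becomes [ds]. *)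
Definition calc_orbit (s : R) (x : X) : X := dunford A nu (dilate s) x.

Lemma dilate_decay s : exists K, holo_decay sigma eps K (dilate s).
Proof.
eexists; apply: holo_decay_dilate => //; first exact: exp_pos.
exact: (holo_decay_mono (Rlt_le _ _ hsigma) hf).
Qed.

Lemma dilate_dunford s x : is_dunford A nu (dilate s) x (calc_orbit s x).
Proof. by have [K hK'] := dilate_decay s; exact: (is_dunford_dunford hA x hs hnu hK'). Qed.

Lemma is_dunford0 x : is_dunford A nu (fun=> RtoC 0) x zero.
Proof.
have := is_dunford_scal (RtoC 0) (dilate_dunford 0 x).
rewrite (_ : scal (RtoC 0) _ = zero); last exact: scal_zero_l.
by apply: is_dunford_ext => z; ring.
Qed.

Lemma is_dunford_sum n (v : 'I_n -> C -> C) (y : 'I_n -> X) x :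
  (forall i, is_dunford A nu (v i) x (y i)) ->
  is_dunford A nu (fun z => \big[Cplus/RtoC 0]_(i < n) v i z) x (\big[plus/zero]_(i < n) y i).
Proof.
elim: n v y => [|n IH] v y h.
  by rewrite big_ord0; apply: is_dunford_ext (is_dunford0 x) => z; rewrite big_ord0.
rewrite big_ord_recr; have h1 := IH _ _ (fun i => h (widen_ord (leqnSn n) i)).
by apply: is_dunford_ext (is_dunford_plus h1 (h ord_max)) => z; rewrite big_ord_recr.
Qed.

Lemma is_dunford_ext_sector v w x y : (forall z, sector sigma z -> v z = w z) ->
  is_dunford A nu v x y -> is_dunford A nu w x y.
Proof.
move=> e [l1 [l2 [h1 h2 ey]]]; exists l1, l2; split => //.
- apply: is_line_int_ext h1 => s; rewrite /dunford_integrand e //.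
  by apply: (sector_ray hnu hs); rewrite Rabs_Ropp Rabs_pos_eq; lra.
- apply: is_line_int_ext h2 => s; rewrite /dunford_integrand e //.
  by apply: (sector_ray hnu hs); rewrite Rabs_pos_eq; lra.
Qed.

(** Dilation by [e^(t + i l)] translates [ln z], so the sum is dominated by values of [decay] at
    equally spaced points; the bound depends neither on their number nor on their position. *)
Lemma sum_dilate_bound n (r : 'I_n -> R) (G : C -> C) Kg epsg l t u th : 0 < l -> 0 < epsg ->
  0 <= Kg -> (forall i, Rabs (r i) <= 1) ->
  (forall s, Cmod (G (cexp (s, th))) <= Kg * decay epsg s) ->
  Cmod (\big[Cplus/RtoC 0]_(i < n) Cmult (RtoC (r i)) (G (Cmult (RtoC (exp (t + INR i * l))) (cexp (u, th))))) <=
    Kg * (exp (epsg * l) / l * (PI / (2 * epsg))).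
Proof.
move=> l0 eg0 Kg0 hr hG.
apply: Rle_trans (_ : Kg * \big[Rplus/0]_(i < n) decay epsg (u + t + INR i * l) <= _); last first.
  by apply: Rmult_le_compat_l => //; exact: sum_decay_bound.
rewrite -big_Rscal; apply: Rle_trans (@norm_big_le C_NormedModule n _) _.
apply: big_Rle => i; rewrite dilate_cexp.
rewrite -[@norm _ _ _]/(Cmod (Cmult (RtoC (r i)) (G (cexp (u + (t + INR i * l), th))))).
rewrite Cmod_mult Cmod_R (_ : u + (t + INR i * l) = u + t + INR i * l); last by ring.
rewrite -[X in _ <= X]Rmult_1_l.
by apply: Rmult_le_compat; [exact: Rabs_pos|exact: Cmod_ge_0|exact: hr|exact: hG].
Qed.

Lemma orbit_sum_bound : exists2 K, 0 <= K & forall n (r : 'I_n -> R) s x,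
  (forall i, Rabs (r i) <= 1) ->
  norm (\big[plus/zero]_(i < n) scal (RtoC (r i)) (calc_orbit (s + INR i * 1) x)) <= K * norm x.
Proof.
have pi0 := PI_RGT_0.
pose B := Kf * (exp (eps * 1) / 1 * (PI / (2 * eps))).
have B0 : 0 <= B.
  apply: Rmult_le_pos => //; apply: Rmult_le_pos.
    by apply: Rdiv_le_0_compat; [exact: Rlt_le (exp_pos _)|lra].
  by apply: Rdiv_le_0_compat; lra.
exists (Kc * B); first exact: Rmult_le_pos.
move=> n r s x hr.
have [K hv] : exists K, holo_decay sigma eps K
    (fun z => \big[Cplus/RtoC 0]_(i < n) Cmult (RtoC (r i)) (dilate (s + INR i * 1) z)).
  apply: holo_decay_sum => // i; have [K hv] := dilate_decay (s + INR i * 1).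
  by eexists; exact: holo_decay_scal hv.
apply: (hK hv).
- move=> z hz; have [u [th [-> hth _]]] := sector_polar hz.
  apply: sum_dilate_bound => //; first lra.
  move=> t; have [_ _ h] := hf.
  by have := h _ (@sector_cexp phi t th hphi ltac:(lra)); rewrite Cmod_cexp ln_exp.
- by apply: is_dunford_sum => i; apply: is_dunford_scal; exact: dilate_dunford.
Qed.

(** Uniform continuity of [f] in logarithmic coordinates makes two nearby dilates close in the
    supremum norm, and the bounded calculus transfers this to the orbit. Both the measurability of
    the orbit and the use of Riemann integrals rest on it. *)
Lemma orbit_continuous s x eta : 0 < eta -> exists2 d, 0 < d & forall s', Rabs (s' - s) < d ->
  norm (minus (calc_orbit s' x) (calc_orbit s x)) < eta.
Proof.
move=> eta0; have nx := norm_ge_0 x.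
pose q := Kc * norm x + 1.
have q0 : 0 < q by have : 0 <= Kc * norm x by [exact: Rmult_le_pos]; rewrite /q; lra.
have [d [d0 d1] hd] := holo_unif_cont hphi hsp hf (Rdiv_lt_0_compat _ _ eta0 q0).
exists d => // s' hs1.
have [K1 v1] := dilate_decay s'; have [K2 v2] := dilate_decay s.
have hv := holo_decay_plus v1 (holo_decay_scal (RtoC (-1)) v2).
have hD := is_dunford_plus (dilate_dunford s' x) (is_dunford_scal (RtoC (-1)) (dilate_dunford s x)).
have hB : forall z, sector sigma z ->
    Cmod (Cplus (dilate s' z) (Cmult (RtoC (-1)) (dilate s z))) <= eta / q * / 2.
  move=> z hz; have [u [th [-> hth _]]] := sector_polar hz.
  have eq0 : 0 < eta / q by exact: Rdiv_lt_0_compat.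
  rewrite /dilate !dilate_cexp.
  have [h|h] := Rle_lt_dec s s'.
    have := hd (u + s) (s' - s) th ltac:(rewrite Rabs_pos_eq in hs1; lra) ltac:(lra).
    rewrite (_ : u + s + (s' - s) = u + s'); last by ring.
    rewrite (_ : Cplus _ _ = Cminus (f (cexp (u + s', th))) (f (cexp (u + s, th)))); last by ring.
    move/Rle_trans; apply; apply: Rmult_le_compat_l; [lra|exact: decay_le_half].
  have := hd (u + s') (s - s') th ltac:(rewrite Rabs_left in hs1; lra) ltac:(lra).
  rewrite (_ : u + s' + (s - s') = u + s); last by ring.
  rewrite (_ : Cplus _ _ = Copp (Cminus (f (cexp (u + s, th))) (f (cexp (u + s', th))))); last by ring.
  rewrite Cmod_opp.
  move/Rle_trans; apply; apply: Rmult_le_compat_l; [lra|exact: decay_le_half].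
have := hK hv hB hD.
rewrite (_ : plus _ _ = minus (calc_orbit s' x) (calc_orbit s x)); last by module X.
move=> h; apply: Rle_lt_trans h _.
rewrite (_ : Kc * _ * norm x = eta * ((Kc * norm x) / q) * / 2); last by field; lra.
have : (Kc * norm x) / q <= 1 by apply/Rle_div_l => //; rewrite /q; lra.
move=> /(Rmult_le_compat_l eta _ _ (Rlt_le _ _ eta0)); lra.
Qed.

End square_functions.

Lemma holo_decay_bounded phi eps K v : 0 < phi < PI -> holo_decay phi eps K v ->
  forall z, sector phi z -> Cmod (v z) <= K.
Proof.
move=> hp hv z hz; have K0 := holo_decay_K_ge0 hp hv; have [_ _ h] := hv.
apply: Rle_trans (h z hz) _; have := decay_le_half eps (ln (Cmod z)).
have := decay_gt0 eps (ln (Cmod z)); nra.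
Qed.

Lemma holo_decay_Cpow phi eps K v n : 0 < phi < PI -> holo_decay phi eps K v ->
  exists L, holo_decay phi eps L (fun z => Cpow (v z) n.+1).
Proof.
move=> hp hv; elim: n => [|n [L hL]].
  by exists K; apply: holo_decay_ext hv => z; rewrite /=; ring.
have [_ h1 _] := hv.
by eexists; exact: (holo_decay_mult h1 (holo_decay_bounded hp hv) hL).
Qed.

(** * Peaks as rational functions of the operator *)

Section rational_peaks.
Context (X : CompleteNormedModule C_AbsRing) (A : operator X) (sigma : R) (hs : 0 < sigma < PI).
Local Notation Q := (neg_resolvent A).

Lemma rational_sum n (u : 'I_n -> C -> C) (U : 'I_n -> X -> X) :
  (forall i, rational_calculus A (u i) (U i)) ->
  rational_calculus A (fun z => \big[Cplus/RtoC 0]_(i < n) u i z)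
    (fun x => \big[plus/zero]_(i < n) U i x).
Proof.
elim: n u U => [|n IH] u U h.
  have := rational_const A (RtoC 0).
  rewrite (_ : (fun x : X => scal (RtoC 0) x) = (fun x => \big[plus/zero]_(i < 0) U i x)); last first.
    by apply: functional_extensionality => x; rewrite big_ord0; exact: scal_zero_l.
  rewrite (_ : (fun _ : C => RtoC 0) = (fun z => \big[Cplus/RtoC 0]_(i < 0) u i z)) //.
  by apply: functional_extensionality => z; rewrite big_ord0.
have := rational_plus (IH _ _ (fun i => h (widen_ord (leqnSn n) i))) (h ord_max).
set v := (fun z => _); set W := (fun x => _).
rewrite (_ : v = (fun z => \big[Cplus/RtoC 0]_(i < n.+1) u i z)); last first.
  by apply: functional_extensionality => z; rewrite big_ord_recr.
rewrite (_ : W = (fun x => \big[plus/zero]_(i < n.+1) U i x)) //.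
by apply: functional_extensionality => x; rewrite big_ord_recr.
Qed.

(** The partial fraction form [4 tau (1 / (z + tau) - tau / (z + tau)^2)] of
    [4 tau z / (z + tau)^2], which involves kernels and constants only. *)
Definition rational_peak (tau : R) (z : C) : C :=
  Cmult (RtoC (4 * tau)) (Cplus (cauchy_kernel tau z)
    (Cmult (RtoC (- tau)) (Cmult (cauchy_kernel tau z) (cauchy_kernel tau z)))).

Definition peak_op (tau : R) (x : X) : X :=
  scal (RtoC (4 * tau)) (plus (Q tau x) (scal (RtoC (- tau)) (Q tau (Q tau x)))).

(** The power zero is [scal (RtoC 1)], so that it is an instance of [rational_const] as it
    stands. *)
Fixpoint peak_op_pow (tau : R) n (x : X) : X :=
  match n with O => scal (RtoC 1) x | S n => peak_op tau (peak_op_pow tau n x) end.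

Lemma rational_peak_pow tau n : 0 < tau ->
  rational_calculus A (fun z => Cpow (rational_peak tau z) n) (peak_op_pow tau n).
Proof.
move=> t0; have hk := rational_kernel A t0.
have hp : rational_calculus A (rational_peak tau) (peak_op tau).
  exact: (rational_mult (rational_const A (RtoC (4 * tau)))
    (rational_plus hk (rational_mult (rational_const A (RtoC (- tau))) (rational_mult hk hk)))).
elim: n => [|n IH]; first exact: (rational_const A (RtoC 1)).
exact: (rational_mult hp IH).
Qed.

Lemma rational_peak_dilate b t z : 0 < b -> sector sigma z ->
  rational_peak (b / exp t) z = peak_fun (RtoC b) (Cmult (RtoC (exp t)) z).
Proof.
move=> b0 hz; have et := exp_pos t.
have t0 : 0 < b / exp t by exact: Rdiv_lt_0_compat.
have h1 := sector_plus_neq0 hs t0 hz.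
have et0 : RtoC (exp t) <> RtoC 0 by move/RtoC_inj; lra.
have h2 := sector_plus_neq0 hs b0 (sector_dilate et hz).
rewrite /rational_peak /peak_fun /cauchy_kernel.
have eb : RtoC b = Cmult (RtoC (exp t)) (RtoC (b / exp t)).
  by rewrite -RtoC_mult; congr RtoC; field; lra.
move: h1 h2; rewrite eb; set tau := b / exp t => h1 h2.
rewrite RtoC_mult RtoC_opp; field; split => //.
Qed.

(** A sum of kernels that falls under [rational_calculus]; it need only agree with [approx_fun b]
    away from the poles, hence on the sector. *)
Lemma rational_approx b : 0 < b -> exists2 u, rational_calculus A u (approx_op A b) &
  forall z, sector sigma z -> u z = approx_fun b z.
Proof.
move=> b0; have c0 : 0 < / b by exact: Rinv_0_lt_compat.
exists (fun z => Cplus (Cmult (RtoC b) (cauchy_kernel b z)) (Cmult (RtoC (- / b)) (cauchy_kernel (/ b) z))).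
  have := rational_plus (rational_mult (rational_const A (RtoC b)) (rational_kernel A b0))
    (rational_mult (rational_const A (RtoC (- / b))) (rational_kernel A c0)).
  set W : X -> X := (W in rational_calculus _ _ W).
  rewrite (_ : W = approx_op A b) //.
  apply: functional_extensionality => x; rewrite /W /approx_op; module X.
  by rewrite RtoC_opp; ring.
move=> z hz; rewrite approx_funE ?RtoC_opp; [ring|exact: (sector_plus_neq0 hs)|exact: (sector_plus_neq0 hs)].
Qed.

End rational_peaks.

(** * The lower estimate for finite sums *)

Section lower_bound.
Context (X : CompleteNormedModule C_AbsRing) (A : operator X).
Context (omega sigma nu phi : R) (hA : sectorial A omega).
Context (hnu : omega < nu < sigma) (hsigma : sigma < phi) (hphi : phi < PI).
Context (M : R) (M0 : 0 <= M)
  (hM : forall z, outside nu z -> is_resolvent A z (resolvent A z) /\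
    forall x, Cmod z * norm (resolvent A z x) <= M * norm x).
Context (Kc : R) (Kc0 : 0 <= Kc)
  (hK : forall v eps K B x y, holo_decay sigma eps K v ->
    (forall z, sector sigma z -> Cmod (v z) <= B) -> is_dunford A nu v x y ->
    norm y <= Kc * B * norm x).
Context (eps Kf : R) (f : C -> C) (hf : holo_decay phi eps Kf f).
Context (z0 : C) (hz0 : sector phi z0) (fz0 : f z0 <> RtoC 0).

Let ho : 0 < omega < PI. Proof. exact: omega_bound hA. Qed.
Let hs' : 0 < sigma < PI. Proof. lra. Qed.
Let hs : sigma < PI. Proof. lra. Qed.
Let hp' : 0 < phi < PI. Proof. lra. Qed.
Let hsp : 0 < sigma < phi. Proof. lra. Qed.
Local Notation calc_orbit := (calc_orbit A nu f).

(** With [S] the sum of the dilates of [h = g f], the function [(1 - l S) e_b] is uniformly small on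
    the sector, so the calculus bounds the norm of [e_b(A) (x - l w)] by [|x| / 2], where [w] is the
    sum of the [g(tA) f(tA) x]. The vector [w] is controlled by decoupling, and [eta] absorbs
    [x - e_b(A) x]. The range of the sum depends on [b], hence on [x] and [eta], but the mesh [l]
    and the constant [K] do not. *)
Lemma orbit_lower : exists l K, [/\ 0 < l <= 1, 0 <= K &
  forall x eta, 0 < eta -> exists n T, forall s, 0 <= s <= l ->
    norm x / 2 - eta <= K * rademacher_mean (fun e =>
      norm (signed_sum (fun i : 'I_n => calc_orbit (s - T + INR i * l) x) e))].
Proof.
have e0 : 0 < eps by case: hf.
have pi0 := PI_RGT_0.
have [b [c [m [b0 hrep]]]] := reproducing_function hp' hf hz0 fz0.
pose g z := Cmult c (Cpow (peak_fun (RtoC b) z) m.+1).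
have [Kg hg] : exists Kg, holo_decay phi 1 Kg g.
  have [k k0 hk] := double_kernel_decay hp'.
  have hp : holo_decay phi 1 (Cmod (Cmult (RtoC 4) (RtoC b)) * (k * (1 + / (b * b)))) (peak_fun (RtoC b)).
    exact: (holo_decay_scal (Cmult (RtoC 4) (RtoC b)) (hk b b b0 b0)).
  have [L hL] := holo_decay_Cpow m hp' hp.
  by eexists; exact: holo_decay_scal hL.
have Kg0 := holo_decay_K_ge0 hp' hg.
pose h z := Cmult (g z) (f z).
have [g1 g2 g3] := hg.
have hh : holo_decay phi eps (Kg * Kf) h.
  exact: (holo_decay_mult g2 (holo_decay_bounded hp' hg) hf).
set Kh := Kg * Kf in hh.
have Kh0 := holo_decay_K_ge0 hp' hh.
have [E E0 hE] := approx_fun_bound hA hnu hs.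
have [Kr Kr0 hr] := rational_bound hA hnu hs M0 hM Kc0 hK.
(* Chosen so that [Kc * (2 * kap) <= / 2]. The mesh below is taken for [kap / E] because its error
   is multiplied by [e_b], which is at most [E]. *)
pose kap := / (4 * (Kc + 1)).
have kap0 : 0 < kap by apply: Rinv_0_lt_compat; lra.
have Ekap : 0 < kap / E by exact: Rdiv_lt_0_compat.
have [l hl hsum] := reproducing_sum hphi hsp hh Ekap (fun th hth => hrep th ltac:(lra)).
pose Bg := Kg * (exp (1 * l) / l * (PI / (2 * 1))).
have Bg0 : 0 <= Bg.
  apply: Rmult_le_pos => //; apply: Rmult_le_pos; last lra.
  by apply: Rdiv_le_0_compat; [exact: Rlt_le (exp_pos _)|lra].
exists l, (Kr * E * l * (Kr * Bg)); split => //.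
  by repeat apply: Rmult_le_pos => //; lra.
move=> x eta eta0.
have [b1 b10 hb1] := approx_op_cvg hA M0 hM x eta0.
have {}hb1 := hb1 b1 (Rle_refl b1).
have [Ka ha] := approx_fun_decay hA hnu hs b10.
have Ka0 := holo_decay_K_ge0 hs' ha.
have [ur hur eur] := rational_approx A hs' b10.
pose q1 := Ka * (Kh * (PI / eps)) + 1.
have q10 : 0 < q1.
  have : 0 <= Ka * (Kh * (PI / eps)).
    by apply: Rmult_le_pos => //; apply: Rmult_le_pos => //; apply: Rdiv_le_0_compat; lra.
  by rewrite /q1; lra.
have [L [L0 hL]] := decay_half_dom Rlt_0_1 (Rdiv_lt_0_compat _ _ kap0 q10).
pose q2 := 2 * (E * Kh + 1).
have q20 : 0 < q2 by have : 0 <= E * Kh by [apply: Rmult_le_pos; lra]; rewrite /q2; lra.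
have [L' [L'0 hL']] := decay_primitive_tail e0 (Rdiv_lt_0_compat _ _ kap0 q20).
(* The [2 N] steps start at [s - N l]. For [|u| <= L] they reach at least [L'] beyond [- u] on both
   sides, the 1 covering [s <= l <= 1]; both tails are then below [kap / q2]. *)
have [N hN] : exists N, L' + L + 1 <= INR N * l.
  have [N hN] := nfloor_ex ((L' + L + 1) / l) ltac:(apply: Rdiv_le_0_compat; lra).
  exists N.+1; rewrite S_INR; apply/Rle_div_l; lra.
exists (N + N)%nat, (INR N * l) => s hsl.
set t0 := s - INR N * l.
pose y (i : 'I_(N + N)) := calc_orbit (t0 + INR i * l) x.
pose G (i : 'I_(N + N)) (u : X) : X := scal c (peak_op_pow A (b / exp (t0 + INR i * l)) m.+1 u).
pose gr (i : 'I_(N + N)) z := Cmult c (Cpow (rational_peak (b / exp (t0 + INR i * l)) z) m.+1).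
have hG i : rational_calculus A (gr i) (G i).
  apply: (rational_mult (rational_const A c)); apply: rational_peak_pow.
  by apply: Rdiv_lt_0_compat => //; exact: exp_pos.
have egr i z : sector sigma z -> gr i z = g (Cmult (RtoC (exp (t0 + INR i * l))) z).
  by move=> hz; rewrite /gr (rational_peak_dilate hs').
have hy (i : 'I_(N + N)) : is_dunford A nu (dilate f (t0 + INR i * l)) x (y i).
  exact: (dilate_dunford hA hnu hsigma hphi hf).
have hEGy (i : 'I_(N + N)) : is_dunford A nu (fun z => Cmult (ur z) (Cmult (gr i z) (dilate f (t0 + INR i * l) z))) x
    (approx_op A b1 (G i (y i))).
  have [K1 h1] := dilate_decay hA hnu hsigma hphi hf (t0 + INR i * l).
  have [r1 [B1 r2]] := rational_holo hA hnu hs (hG i).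
  apply: (rational_dunford hA hnu hs hM hur (holo_decay_mult r1 r2 h1)).
  exact: (rational_dunford hA hnu hs hM (hG i) h1 (hy i)).
pose S z := \big[Cplus/RtoC 0]_(i < N + N) h (Cmult (RtoC (exp (t0 + INR i * l))) z).
have hD : is_dunford A nu (fun z => Cmult (Cminus (RtoC 1) (Cmult (RtoC l) (S z))) (approx_fun b1 z)) x
    (plus (approx_op A b1 x) (scal (RtoC (- l)) (\big[plus/zero]_(i < N + N) approx_op A b1 (G i (y i))))).
  have := is_dunford_plus (is_dunford_approx hA hnu hs M0 hM x b10)
    (is_dunford_scal (RtoC (- l)) (is_dunford_sum hA hnu hsigma hphi hf hEGy)).
  apply: (is_dunford_ext_sector hA hnu hsigma hphi) => z hz.
  have -> : \big[Cplus/RtoC 0]_(i < N + N) Cmult (ur z) (Cmult (gr i z) (dilate f (t0 + INR i * l) z)) =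
      Cmult (approx_fun b1 z) (S z).
    rewrite eur // /S.
    rewrite (eq_bigr (fun i : 'I_(N + N) => scal (approx_fun b1 z) (h (Cmult (RtoC (exp (t0 + INR i * l))) z) : C_NormedModule))).
      exact: (@sum_scal C_NormedModule).
    by move=> i _; rewrite egr.
  by rewrite RtoC_opp; ring.
have hdec : exists K1, holo_decay sigma 1 K1 (fun z => Cmult (Cminus (RtoC 1) (Cmult (RtoC l) (S z))) (approx_fun b1 z)).
  have [KS hS] : exists KS, holo_decay sigma eps KS S.
    apply: holo_decay_sum => // i.
    eexists; apply: (holo_decay_dilate hs' (exp_pos _)).
    exact: (holo_decay_mono (Rlt_le _ _ hsigma) hh).
  have [_ dS _] := hS; have bS := holo_decay_bounded hs' hS.
  have u1 z : sector sigma z -> exists d, cdiff ((fun z => Cminus (RtoC 1) (Cmult (RtoC l) (S z))) : C -> C_NormedModule) z d.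
    move=> /dS [d hd]; eexists.
    apply: cdiff_ext (cdiff_plus (@cdiff_const C_NormedModule (RtoC 1) z)
      (cdiff_scal (@cdiff_const C_NormedModule (RtoC (- l)) z) hd)) => w.
    by rewrite RtoC_opp; Cring.
  have u2 z : sector sigma z -> Cmod (Cminus (RtoC 1) (Cmult (RtoC l) (S z))) <= 1 + l * KS.
    move=> hz; apply: Rle_trans (Cmod_triangle _ _) _.
    rewrite Cmod_opp Cmod_1 Cmod_mult Cmod_R Rabs_pos_eq; last lra.
    by apply: Rplus_le_compat_l; apply: Rmult_le_compat_l; [lra|exact: bS].
  by eexists; exact: (holo_decay_mult u1 u2 ha).
have hB : forall z, sector sigma z ->
    Cmod (Cmult (Cminus (RtoC 1) (Cmult (RtoC l) (S z))) (approx_fun b1 z)) <= 2 * kap.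
  move=> z hz; have eb := hE b1 z b10 hz.
  have [_ _ /(_ z hz) ea] := ha.
  have [u [th [ez hth eu]]] := sector_polar hz; rewrite -eu in ea.
  have := hsum (N + N)%nat (u + t0) th ltac:(lra).
  have -> : \big[Cplus/RtoC 0]_(i < N + N) h (cexp (u + t0 + INR i * l, th)) = S z.
    by apply: eq_bigr => i _; rewrite ez dilate_cexp; congr (h (cexp (_, _))); ring.
  set T := PI / (2 * eps) - _ + _ => hT.
  have ae := Cmod_ge_0 (approx_fun b1 z).
  have P1 := decay_primitive_lt (u + t0) e0.
  have P2 := decay_primitive_ge0 (u + t0 + INR (N + N) * l) e0.
  have T2 : T <= PI / eps.
    rewrite /T (_ : PI / eps = PI / (2 * eps) + PI / (2 * eps)); last by field; lra.
    lra.
  rewrite Cmod_mult; apply: Rle_trans (Rmult_le_compat_r _ _ _ ae hT) _.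
  rewrite Rmult_plus_distr_r (_ : 2 * kap = kap + kap); last by ring.
  apply: Rplus_le_compat.
    apply: Rle_trans (Rmult_le_compat_l _ _ _ (Rlt_le _ _ Ekap) eb) _.
    by apply: Req_le; field; lra.
  (* Far out, the error of the sum is only bounded by the whole mass of [decay], but [e_b] is small;
     in the middle [e_b] is merely bounded by [E], but the sum covers almost all of the mass. *)
  have [hu|hu] := Rle_lt_dec L (Rabs u).
    have d1 := hL u hu; have d2 := decay_le_half (1 / 2) u.
    have d3 : decay 1 u <= kap / q1.
      apply: Rle_trans d1 _; have : 0 < kap / q1 by exact: Rdiv_lt_0_compat.
      nra.
    have d4 := decay_gt0 1 u.
    apply: Rle_trans (_ : Kh * (PI / eps) * (Ka * (kap / q1)) <= _).
      apply: Rmult_le_compat => //.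
      - rewrite /T; have := decay_primitive_lt (u + t0 + INR (N + N) * l) e0.
        have := decay_primitive_ge0 (u + t0) e0 => p1 p2.
        by apply: Rmult_le_pos => //; lra.
      - exact: Rmult_le_compat_l.
      - by apply: Rle_trans ea _; exact: Rmult_le_compat_l.
    rewrite (_ : _ * _ = kap * ((Ka * (Kh * (PI / eps))) / q1)); last by field; lra.
    rewrite -[X in _ <= X]Rmult_1_r; apply: Rmult_le_compat_l; first lra.
    by apply/Rle_div_l => //; rewrite /q1; lra.
  move/Rabs_def2: hu => hu.
  have eN : INR (N + N) * l = INR N * l + INR N * l.
    by rewrite -[INR (N + N)]/(INR (N + N)%coq_nat) plus_INR; ring.
  have p1 : decay_primitive eps (u + t0) < kap / q2.
    by have := hL' (- (u + t0)) ltac:(rewrite /t0; lra); rewrite Ropp_involutive.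
  have p2 := hL' (u + t0 + INR (N + N) * l) ltac:(rewrite eN /t0; lra).
  rewrite decay_primitive_opp // in p2.
  have T3 : T <= 2 * (kap / q2) by rewrite /T; lra.
  apply: Rle_trans (_ : Kh * (2 * (kap / q2)) * E <= _).
    apply: Rmult_le_compat => //.
    - rewrite /T; have := decay_primitive_lt (u + t0 + INR (N + N) * l) e0.
      have := decay_primitive_ge0 (u + t0) e0 => p3 p4.
      by apply: Rmult_le_pos => //; lra.
    - exact: Rmult_le_compat_l.
  rewrite (_ : _ * E = kap * ((2 * (E * Kh)) / q2)); last by field; lra.
  rewrite -[X in _ <= X]Rmult_1_r; apply: Rmult_le_compat_l; first lra.
  by apply/Rle_div_l => //; rewrite /q2; lra.
have [K1 hK1] := hdec.
have j1 := hK hK1 hB hD.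
have lE := rational_linear hM hur.
have lG i := rational_linear hM (hG i).
(* Taking [e_b(A)] out of the sum leaves the terms [G i (y i)] for decoupling; it is bounded
   separately by [Kr * E]. *)
rewrite -(linear_sum (fun i => G i (y i)) lE) in j1.
set w := \big[plus/zero]_(i < N + N) G i (y i) in j1.
set mean := rademacher_mean _.
have mE : rademacher_mean (fun e => norm (signed_sum y e)) = mean by [].
have j2 : norm w <= Kr * Bg * mean.
  rewrite -mE; apply: norm_decoupling => // e u.
  have hsg : rational_calculus A (fun z => \big[Cplus/RtoC 0]_(i < N + N) Cmult (RtoC (rademacher_sign (e i))) (gr i z))
      (fun u => \big[plus/zero]_(i < N + N) scal (RtoC (rademacher_sign (e i))) (G i u)).
    by apply: rational_sum => i; exact: (rational_mult (rational_const A (RtoC (rademacher_sign (e i)))) (hG i)).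
  apply: (hr _ _ Bg u hsg) => z hz.
  rewrite (eq_bigr (fun i : 'I_(N + N) => Cmult (RtoC (rademacher_sign (e i))) (g (Cmult (RtoC (exp (t0 + INR i * l))) z)))); last first.
    by move=> i _; rewrite egr.
  have [v [th [-> hth _]]] := sector_polar hz.
  apply: sum_dilate_bound => //; first lra.
    by move=> i; rewrite rademacher_sign_abs; lra.
  by move=> t; have := g3 _ (@sector_cexp phi t th hphi ltac:(lra)); rewrite Cmod_cexp ln_exp.
have j3 : norm (approx_op A b1 w) <= Kr * E * norm w.
  by apply: (hr _ _ E w hur) => z hz; rewrite eur //; exact: hE.
have kk : Kc * (2 * kap) <= / 2.
  rewrite /kap (_ : Kc * _ = / 2 * (Kc / (Kc + 1))); last by field; lra.
  rewrite -[X in _ <= X]Rmult_1_r; apply: Rmult_le_compat_l; first lra.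
  by apply/Rle_div_l; lra.
have nx := norm_ge_0 x.
have j4 := Rmult_le_compat_r _ _ _ nx kk.
have j5 := norm_le_minus x (approx_op A b1 x).
rewrite norm_minus_sym in j5.
have j6 := norm_le_minus (approx_op A b1 x) (scal (RtoC l) (approx_op A b1 w)).
rewrite norm_scalC_eq Cmod_R Rabs_pos_eq in j6; last lra.
have ej : minus (approx_op A b1 x) (scal (RtoC l) (approx_op A b1 w)) =
    plus (approx_op A b1 x) (scal (RtoC (- l)) (approx_op A b1 w)).
  by module X; rewrite RtoC_opp; ring.
rewrite ej in j6.
have j7 : l * norm (approx_op A b1 w) <= l * (Kr * E * (Kr * Bg * mean)).
  apply: Rmult_le_compat_l; first lra.
  apply: Rle_trans j3 _; apply: Rmult_le_compat_l => //.
  by apply: Rmult_le_pos; lra.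
rewrite (_ : Kr * E * l * (Kr * Bg) * mean = l * (Kr * E * (Kr * Bg * mean))); last by ring.
norm_lra.
Qed.

End lower_bound.

(** * The measure dt/t *)

(** An additive function of intervals lying between the bounds of [g] times the length has
    derivative [g] at each point by continuity, so it is the Riemann integral of [g]. This is the
    bridge from Lebesgue to Riemann integrals. *)
Lemma interval_function_RInt (J : R -> R -> R) (g : R -> R) c a b : c < a <= b ->
  (forall x y z, c < x <= y -> y <= z -> J x z = J x y + J y z) ->
  (forall x y lo hi, c < x <= y -> (forall t, x <= t <= y -> lo <= g t <= hi) ->
    lo * (y - x) <= J x y <= hi * (y - x)) ->
  (forall t, c < t -> continuous g t) ->
  is_RInt g a b (J a b).
Proof.
(* A base point strictly between [c] and [a], so that difference quotients exist on both sides of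
   [a]. *)
move=> [ca ab] hadd hJ hg; pose a0 := (c + a) / 2.
have -> : J a b = J a0 b - J a0 a by rewrite (hadd a0 a b); rewrite /a0; lra.
apply: (is_RInt_derive (J a0)) => x; rewrite Rmin_left ?Rmax_right // => hx.
  apply/is_derive_Reals => eps eps0.
  have cx : c < x by lra.
  have [d hd] : exists d : posreal, forall t, Rabs (t - x) < d -> Rabs (g t - g x) < eps / 2.
    have e2 : 0 < eps / 2 by lra.
    have [d h] := hg x cx _ (locally_ball (g x) (mkposreal _ e2)).
    by exists d => t ht; exact: h.
  have d0 := cond_pos d.
  pose d' := Rmin d (x - a0).
  have d'0 : 0 < d' by apply: Rmin_pos => //; rewrite /a0; lra.
  exists (mkposreal _ d'0) => h h0 /= hh.
  have [h1 h2] : Rabs h < d /\ Rabs h < x - a0.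
    by move: hh; rewrite /d' /Rmin; case: Rle_dec; lra.
  have ax : c < a0 by rewrite /a0; lra.
  have key y z : a0 <= y <= z -> (forall t, y <= t <= z -> Rabs (t - x) < d) ->
      Rabs (J y z - g x * (z - y)) <= eps / 2 * (z - y).
    move=> hyz hz.
    have := hJ y z (g x - eps / 2) (g x + eps / 2) ltac:(lra).
    case=> [t ht|j1 j2]; first by have /Rabs_def2 := hd t (hz t ht); lra.
    by apply: Rabs_le; lra.
  have [hpos|hneg] : 0 < h \/ h < 0 by lra.
    rewrite (hadd a0 x (x + h)); [|rewrite /a0; lra|lra].
    have := key x (x + h) ltac:(rewrite /a0; lra).
    rewrite (_ : _ / h - g x = (J x (x + h) - g x * (x + h - x)) / h); last by field; lra.
    move=> /(_ _) k; rewrite Rabs_div; last lra.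
    rewrite (Rabs_pos_eq h); last lra.
    apply: (Rle_lt_trans _ (eps / 2)); last lra.
    apply/Rle_div_l; first lra.
    apply: Rle_trans (k _) _; last by apply: Req_le; ring.
    move=> t ht; rewrite Rabs_pos_eq; last lra.
    by rewrite Rabs_pos_eq in h1; lra.
  rewrite (hadd a0 (x + h) x); [|have := Rabs_def2 _ _ h2; rewrite /a0; lra|lra].
  have := key (x + h) x ltac:(have := Rabs_def2 _ _ h2; lra).
  rewrite (_ : _ / h - g x = (J (x + h) x - g x * (x - (x + h))) / - h); last by field; lra.
  move=> /(_ _) k; rewrite Rabs_div; last lra.
  rewrite (Rabs_pos_eq (- h)); last lra.
  apply: (Rle_lt_trans _ (eps / 2)); last lra.
  apply/Rle_div_l; first lra.
  apply: Rle_trans (k _) _; last by apply: Req_le; ring.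
  move=> t ht; have := Rabs_def2 _ _ h1; move=> ?; apply: Rabs_def1; lra.
apply: hg; lra.
Qed.

Section haar_intervals.
Local Open Scope classical_set_scope.
Import Order.TTheory GRing.Theory Num.Theory.
Local Notation Ico x y := ([set` Interval (BLeft x) (BLeft y)] : set R).

Lemma in_Ico (x y t : R) : Ico x y t <-> x <= t < y.
Proof.
rewrite /= in_itv /=; split; first by case/andP => /RleP h1 /RltP h2.
by case=> h1 h2; apply/andP; split; [exact/RleP|exact/RltP].
Qed.

Lemma Ico_cat (x y z : R) : x <= y -> y <= z -> Ico x z = Ico x y `|` Ico y z.
Proof.
move=> xy yz; apply/seteqP; split => t.
  move/in_Ico => h; have [ty|yt] := Rlt_le_dec t y.
    by left; apply/in_Ico; lra.
  by right; apply/in_Ico; lra.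
by case => /in_Ico h; apply/in_Ico; lra.
Qed.

Lemma Ico_disjoint (x y z : R) : [disjoint Ico x y & Ico y z].
Proof.
rewrite disj_set2E; apply/eqP/seteqP; split => t // [/in_Ico h /in_Ico h'].
lra.
Qed.

Lemma measurable_pos_continuous (g : R -> R) : (forall t, 0 < t -> continuity_pt g t) ->
  @measurable_fun _ _ (measurableTypeR R) (measurableTypeR R) `]0%R, +oo[ g.
Proof.
move=> hg; apply: open_continuous_measurable_fun; first exact: interval_open.
move=> t; rewrite inE /= in_itv /= andbT => /RltP t0.
by apply/continuity_pt_cvg; exact: hg.
Qed.

Lemma Ico_sub_pos (x y : R) : 0 < x -> Ico x y `<=` `]0%R, +oo[.
Proof.
move=> x0 t /in_Ico h; rewrite /= in_itv /= andbT; apply/RltP; lra.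
Qed.

Context (mu : measure (measurableTypeR R) R).

Lemma integral_Ico_bounds (g : R -> R) (x y lo hi m : R) : 0 < x ->
  (forall t, 0 < t -> 0 <= g t) -> (forall t, 0 < t -> continuity_pt g t) ->
  mu (Ico x y) = m%:E -> 0 <= hi ->
  (forall t, x <= t < y -> lo <= g t <= hi) ->
  (\int[mu]_(t in Ico x y) (g t)%:E)%E \is a fin_num /\
  lo * m <= fine (\int[mu]_(t in Ico x y) (g t)%:E)%E <= hi * m.
Proof.
move=> x0 g0 gc hm hi0 hg.
have mI : measurable (Ico x y : set (measurableTypeR R)) by exact: measurable_itv.
have mg : measurable_fun (Ico x y : set (measurableTypeR R)) (fun t => (g t)%:E).
  apply/measurable_EFinP; apply: measurable_funS (measurable_pos_continuous gc) => //.
  exact: Ico_sub_pos.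
have ge t : Ico x y t -> (0 <= (g t)%:E)%E.
  by move=> /in_Ico ht; rewrite lee_fin; apply/RleP; apply: g0; lra.
have m0 : 0 <= m by apply/RleP; rewrite -lee_fin -hm; exact: measure_ge0.
have I0 : (0 <= \int[mu]_(t in Ico x y) (g t)%:E)%E by exact: integral_ge0.
have up : (\int[mu]_(t in Ico x y) (g t)%:E <= (hi * m)%:E)%E.
  rewrite (_ : (hi * m)%:E = hi%:E * mu (Ico x y))%E; last by rewrite hm.
  rewrite -integral_cst //; apply: ge0_le_integral => //.
  by move=> t /in_Ico ht; rewrite lee_fin; apply/RleP; case: (hg t ht).
have lo1 : ((lo * m)%:E <= \int[mu]_(t in Ico x y) (g t)%:E)%E.
  have [l0|l0] := Rle_lt_dec lo 0.
    apply: le_trans I0; rewrite lee_fin; apply/RleP.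
    apply: (Rle_trans _ (0 * m)); first exact: Rmult_le_compat_r.
    by rewrite Rmult_0_l; exact: Rle_refl.
  rewrite (_ : (lo * m)%:E = lo%:E * mu (Ico x y))%E; last by rewrite hm.
  rewrite -integral_cst //; apply: ge0_le_integral => //.
  - by move=> t _; rewrite lee_fin; apply/RleP; exact: Rlt_le.
  - by move=> t /in_Ico ht; rewrite lee_fin; apply/RleP; case: (hg t ht).
have fn : (\int[mu]_(t in Ico x y) (g t)%:E)%E \is a fin_num.
  by rewrite ge0_fin_numE //; apply: le_lt_trans up (ltry _).
split => //; move: up lo1; rewrite -(fineK fn) !lee_fin => /RleP u /RleP l.
by split.
Qed.

Lemma integral_Ico_cat (g : R -> R) (x y z : R) : 0 < x -> x <= y -> y <= z ->
  (forall t, 0 < t -> 0 <= g t) -> (forall t, 0 < t -> continuity_pt g t) ->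
  (\int[mu]_(t in Ico x z) (g t)%:E =
   \int[mu]_(t in Ico x y) (g t)%:E + \int[mu]_(t in Ico y z) (g t)%:E)%E.
Proof.
move=> x0 xy yz g0 gc; rewrite (Ico_cat xy yz) ge0_integral_setU //.
- apply/measurable_EFinP; apply: measurable_funS (measurable_pos_continuous gc) => //.
  by move=> t [] /in_Ico h; rewrite /= in_itv /= andbT; apply/RltP; lra.
- by move=> t [] /in_Ico h; rewrite lee_fin; apply/RleP; apply: g0; lra.
- exact: Ico_disjoint.
Qed.

(** Used twice: for Lebesgue measure with [h] the identity, which computes [dt/t] of an interval,
    and then for [dt/t] with [h = exp], which turns integrals against [dt/t] into Riemann integrals
    in [s]. *)
Lemma integral_Ico_RInt (h : R -> R) c (g : R -> R) a b :
  (forall t, c < t -> 0 < h t) -> (forall t, c < t -> continuous h t) ->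
  (forall x y, c < x <= y -> h x <= h y) ->
  (forall x y u, c < x <= y -> h x <= u < h y -> exists2 t, x <= t <= y & u = h t) ->
  (forall x y, c < x <= y -> mu (Ico (h x) (h y)) = (y - x)%:E) ->
  (forall t, 0 < t -> 0 <= g t) -> (forall t, 0 < t -> continuity_pt g t) ->
  c < a <= b ->
  exists2 v, is_RInt (fun t => g (h t)) a b v & (\int[mu]_(t in Ico (h a) (h b)) (g t)%:E = v%:E)%E.
Proof.
move=> h0 hc hm hi hmu g0 gc cab.
pose J x y := fine (\int[mu]_(t in Ico (h x) (h y)) (g t)%:E)%E.
have gh t : c < t -> continuous (fun t => g (h t)) t.
  move=> ct; apply: continuous_comp; first exact: hc.
  by apply/continuity_pt_filterlim; apply: gc; exact: h0.
have fn x y : c < x <= y -> (\int[mu]_(t in Ico (h x) (h y)) (g t)%:E)%E \is a fin_num.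
  move=> hxy; have [M hM] : exists M, forall t, x <= t <= y -> g (h t) <= M.
    have [|M [hM _]] := continuity_ab_maj (fun t => g (h t)) x y ltac:(lra).
      by move=> t ht; apply/continuity_pt_filterlim; apply: gh; lra.
    by exists (g (h M)).
  have [||||||//] // := @integral_Ico_bounds g (h x) (h y) 0 (Rmax M 0) (y - x).
  - by apply: h0; lra.
  - exact: hmu.
  - exact: Rmax_r.
  - move=> u hu; have [t ht ->] := hi x y u hxy hu; split.
      by apply: g0; apply: h0; lra.
    by apply: Rle_trans (hM t ht) _; exact: Rmax_l.
exists (J a b); last by rewrite /J fineK //; exact: fn.
apply: (@interval_function_RInt J _ c) => //.
- move=> x y z hxy hyz; rewrite /J (@integral_Ico_cat g (h x) (h y) (h z)) //.
  + by rewrite fineD //; apply: fn; lra.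
  + by apply: h0; lra.
  + exact: hm.
  + by apply: hm; lra.
- move=> x y lo hi' hxy hlh.
  have [||||||//] // := @integral_Ico_bounds g (h x) (h y) lo hi' (y - x).
  - by apply: h0; lra.
  - exact: hmu.
  - have := hlh x ltac:(lra); have := g0 (h x) (h0 x ltac:(lra)); lra.
  - by move=> u hu; have [t ht ->] := hi x y u hxy hu; exact: hlh.
Qed.

End haar_intervals.

Section haar_integral.
Local Open Scope classical_set_scope.
Import Order.TTheory GRing.Theory Num.Theory.
Local Notation Ico x y := ([set` Interval (BLeft x) (BLeft y)] : set R).
Local Notation haar := (@dt_over_t R : measure (measurableTypeR R) R).

Lemma dt_over_t_Ico (x y : R) : 0 < x <= y -> haar (Ico x y) = (ln y - ln x)%:E.
Proof.
move=> hxy; have [x0 xy] := hxy; rewrite /= /dt_over_t.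
have -> : Ico x y `&` `]0%R, +oo[ = Ico x y.
  by apply: setIidl; apply: Ico_sub_pos; lra.
have [||||||||v hv ev] // := @integral_Ico_RInt lebesgue_measure (fun t => t) 0 Rinv x y.
- by move=> t _; exact: continuous_id.
- by move=> u v [].
- by move=> u v w huv hw; exists w => //; lra.
- move=> u v [u0 uv]; apply: (etrans (lebesgue_measure_itv (Interval (BLeft u) (BLeft v)))).
  rewrite /= lte_fin.
  case: ifP => [//|/negbT]; rewrite -leNgt => /RleP vu.
  by congr EFin; apply/esym; rewrite (Rle_antisym _ _ uv vu); exact: Rminus_diag.
- by move=> t t0; apply: Rlt_le; exact: Rinv_0_lt_compat.
- move=> t t0; apply/continuity_pt_filterlim; apply: continuous_Rinv; lra.
- rewrite ev; congr EFin.
  have hl : is_RInt Rinv x y (ln y - ln x).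
    apply: (is_RInt_derive ln Rinv) => t; rewrite Rmin_left ?Rmax_right // => ht.
      by apply/is_derive_ln; lra.
    by apply: continuous_Rinv; lra.
  by rewrite -(is_RInt_unique _ _ _ _ hv) (is_RInt_unique _ _ _ _ hl).
Qed.
End haar_integral.

Section haar_bounds.
Local Open Scope classical_set_scope.
Import Order.TTheory GRing.Theory Num.Theory.
Local Notation Ico x y := ([set` Interval (BLeft x) (BLeft y)] : set R).
Local Notation haar := (@dt_over_t R : measure (measurableTypeR R) R).

Lemma dt_over_t_RInt (g : R -> R) a b : a <= b ->
  (forall t, 0 < t -> 0 <= g t) -> (forall t, 0 < t -> continuity_pt g t) ->
  (\int[haar]_(t in Ico (exp a) (exp b)) (g t)%:E = (RInt (fun s => g (exp s)) a b)%:E)%E.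
Proof.
move=> ab g0 gc.
have [||||||||v hv ->] // := @integral_Ico_RInt haar exp (a - 1) g a b.
- by move=> t _; exact: exp_pos.
- by move=> t _; exact: continuous_exp.
- move=> x y [_ [xy|->]]; last exact: Rle_refl.
  by apply: Rlt_le; exact: exp_increasing.
- move=> x y u hxy [h1 h2]; have u0 : 0 < u by have := exp_pos x; lra.
  exists (ln u); last by rewrite exp_ln.
  split; first by rewrite -(ln_exp x); apply: ln_le => //; exact: exp_pos.
  by rewrite -(ln_exp y); apply: ln_le => //; exact: Rlt_le.
- move=> x y [_ xy]; rewrite dt_over_t_Ico ?ln_exp //; split; first exact: exp_pos.
  by case: xy => [xy|->]; [apply: Rlt_le; exact: exp_increasing|exact: Rle_refl].
- by lra.
- by rewrite (is_RInt_unique _ _ _ _ hv).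
Qed.

Context (g : R -> R) (g0 : forall t, 0 < t -> 0 <= g t)
  (gc : forall t, 0 < t -> continuity_pt g t).
Local Notation G t := (if Rlt_dec 0 t then g t else 0).

Lemma measurable_pos_extension : measurable_fun setT (fun t : measurableTypeR R => (G t)%:E).
Proof.
have mP : measurable (`]0%R, +oo[ : set (measurableTypeR R)) by exact: measurable_itv.
have := measurable_pos_continuous gc.
move/(measurable_restrictT _ mP)/measurable_EFinP.
apply: eq_measurable_fun => t _ /=; congr EFin; rewrite /patch.
case: Rlt_dec => ht.
  by rewrite mem_set //= in_itv /= andbT; apply/RltP.
by rewrite memNset //= in_itv /= andbT => /RltP.
Qed.

Lemma pos_extension_ge0 t : (0 <= (G t)%:E)%E.
Proof.
rewrite lee_fin; apply/RleP; by case: Rlt_dec => ht; [exact: g0|exact: Rle_refl].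
Qed.

Lemma integral_Ico_pos_extension x y : 0 < x ->
  (\int[haar]_(t in Ico x y) (G t)%:E = \int[haar]_(t in Ico x y) (g t)%:E)%E.
Proof.
move=> x0; apply: eq_integral => t; rewrite in_setE => /in_Ico h.
by case: Rlt_dec => // ht; case: ht; lra.
Qed.

Lemma RInt_le_integral a b : a <= b ->
  ((RInt (fun s => g (exp s)) a b)%:E <= \int[haar]_t (G t)%:E)%E.
Proof.
move=> ab; rewrite -dt_over_t_RInt // -integral_Ico_pos_extension; last exact: exp_pos.
apply: ge0_subset_integral => //.
  exact: measurable_pos_extension.
by move=> t _; exact: pos_extension_ge0.
Qed.

(** Monotone convergence along the intervals [[e^(-N), e^N)], which exhaust the half-line. *)
Lemma integral_le_RInt B :
  (forall N, RInt (fun s => g (exp s)) (- INR N) (INR N) <= B) ->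
  (\int[haar]_t (G t)%:E <= B%:E)%E.
Proof.
move=> hB.
pose F N : set (measurableTypeR R) := Ico (exp (- INR N)) (exp (INR N)).
have mF N : measurable (F N) by exact: measurable_itv.
have mG := measurable_pos_extension.
have eU : \bigcup_N F N = `]0%R, +oo[.
  apply/seteqP; split => t.
    by move=> [N _]; apply: Ico_sub_pos; exact: exp_pos.
  rewrite /= in_itv /= andbT => /RltP t0.
  have [N hN] := nfloor_ex (Rabs (ln t)) (Rabs_pos _).
  exists N.+1 => //; apply/in_Ico; rewrite S_INR -(exp_ln t) //.
  have [h1 h2] : - (INR N + 1) < ln t < INR N + 1 by have := Rabs_def2 (ln t) (INR N + 1) ltac:(lra); lra.
  by split; [apply: Rlt_le|]; exact: exp_increasing.
have -> : (\int[haar]_t (G t)%:E = \int[haar]_(t in \bigcup_N F N) (G t)%:E)%E.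
  rewrite [RHS]integral_mkcond; apply: eq_integral => t _; rewrite eU /patch.
  case: Rlt_dec => ht; first by rewrite mem_set //= in_itv /= andbT; apply/RltP.
  by rewrite memNset //= in_itv /= andbT => /RltP.
have hc : (\int[haar]_(t in F N) (G t)%:E)%E @[N --> \oo] --> (\int[haar]_(t in \bigcup_N F N) (G t)%:E)%E.
  apply: ge0_nondecreasing_set_cvg_integral => //.
  - apply/nondecreasing_seqP => N; rewrite subsetEset => t /in_Ico ht; apply/in_Ico.
    have h1 : exp (- INR N.+1) < exp (- INR N) by apply: exp_increasing; rewrite S_INR; lra.
    have h2 : exp (INR N) < exp (INR N.+1) by apply: exp_increasing; rewrite S_INR; lra.
    lra.
  - by move=> N; apply: measurable_funS mG.
  - by move=> N t _; exact: pos_extension_ge0.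
rewrite -(cvg_lim _ hc) //; apply: lime_le; first by apply/cvg_ex; eexists; exact: hc.
apply: nearW => N; rewrite integral_Ico_pos_extension; last exact: exp_pos.
have hN := pos_INR N.
by rewrite dt_over_t_RInt //; [rewrite lee_fin; apply/RleP; exact: hB|lra].
Qed.
End haar_bounds.

(** * Real powers and power means *)

Section powers.
Import Order.TTheory GRing.Theory Num.Theory.

Lemma powR_exp (a r : R) : 0 < a -> powR a r = exp (r * ln a).
Proof.
move=> a0; rewrite /powR gt_eqF; last by apply/RltP.
by rewrite RexpE RlnE.
Qed.

Lemma powR_nonneg (a r : R) : 0 <= powR a r.
Proof. by apply/RleP; exact: powR_ge0. Qed.

Lemma powR_zero (r : R) : 0 < r -> powR 0 r = 0.
Proof. by move=> r0; apply: powR0; rewrite gt_eqF //; apply/RltP. Qed.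

Lemma powR_mono (a b r : R) : 0 <= r -> 0 <= a <= b -> powR a r <= powR b r.
Proof.
move=> r0 [a0 ab]; apply/RleP; apply: ge0_ler_powR; rewrite ?nnegrE; apply/RleP => //.
exact: Rle_trans ab.
Qed.

Lemma powR_inv (a r : R) : 0 < r -> 0 <= a -> powR (powR a r) (/ r) = a.
Proof.
move=> r0 a0; rewrite -powRrM (Rinv_r r (Rgt_not_eq _ _ r0) : GRing.mul r (Rinv r) = GRing.one R) powRr1 //; exact/RleP.
Qed.

Lemma powR_inv_r (a r : R) : 0 < r -> 0 <= a -> powR (powR a (/ r)) r = a.
Proof.
move=> r0 a0; rewrite -powRrM (Rinv_l r (Rgt_not_eq _ _ r0) : GRing.mul (Rinv r) r = GRing.one R) powRr1 //; exact/RleP.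
Qed.

Lemma powR_mult (a b r : R) : 0 <= a -> 0 <= b -> powR (Rmult a b) r = powR a r * powR b r.
Proof. by move=> a0 b0; apply: powRM; apply/RleP. Qed.

Lemma powR_bernoulli (a r : R) : 1 <= r -> 0 <= a -> 1 + r * (a - 1) <= powR a r.
Proof.
move=> r1 [a0|<-]; last by rewrite powR_zero; lra.
rewrite powR_exp // -{1}(exp_ln a a0); set w := ln a.
(* convexity of [exp], since [w = (1/r) (r w) + (1 - 1/r) 0] *)
have h1 := exp_ineq1_le (r * w - w); have h2 := exp_ineq1_le (- w).
have ew := exp_pos w.
have e1 : exp (r * w) = exp w * exp (r * w - w) by rewrite -exp_plus; congr exp; ring.
have e2 : 1 = exp w * exp (- w) by rewrite -exp_plus Rplus_opp_r exp_0.
have k1 := Rmult_le_compat_l _ _ _ (Rlt_le _ _ ew) h1.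
have k2 := Rmult_le_compat_l _ _ _ (Rlt_le _ _ ew) h2.
rewrite -e1 in k1; rewrite -e2 in k2.
have := Rmult_le_compat_l (r - 1) _ _ ltac:(lra) k2; lra.
Qed.

Lemma powR_continuous (h : R -> R) t r : 0 < r -> (forall u, 0 <= h u) ->
  continuity_pt h t -> continuity_pt (fun u => powR (h u) r) t.
Proof.
move=> r0 h0 hc; case: (h0 t) => [ht|ht].
  apply: (@continuity_pt_ext_loc (fun u => exp (r * ln (h u)))).
    have [d [d0 hd]] := hc (h t) ht.
    exists (mkposreal d d0) => u hu; rewrite powR_exp //.
    have [->//|ne] := Req_dec u t.
    have := hd u; rewrite /= /R_dist => /(_ _) k.
    have /Rabs_def2 : Rabs (h u - h t) < h t by apply: k; split => //; split => //; exact: not_eq_sym.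
    lra.
  apply/continuity_pt_filterlim.
  apply: (continuous_comp (fun u => r * ln (h u)) exp); last exact: continuous_exp.
  apply: (continuous_scal_r r (fun u => ln (h u))).
  apply: (continuous_comp h ln); first exact/continuity_pt_filterlim.
  exact: continuous_ln.
move=> eps eps0; pose e := eps / 2; have e0 : 0 < e by rewrite /e; lra.
have p0 : 0 < powR e (/ r) by rewrite powR_exp //; exact: exp_pos.
have [d [d0 hd]] := hc _ p0.
exists d; split => // u hu; have := hd u hu.
rewrite /= /R_dist -ht powR_zero // !Rminus_0_r !Rabs_pos_eq; [|exact: powR_nonneg|exact: h0].
move=> k; apply: (Rle_lt_trans _ e); last by rewrite /e; lra.
rewrite -(@powR_inv_r e r) //; last lra.
by apply: powR_mono; [lra|split; [exact: h0|exact: Rlt_le]].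
Qed.

End powers.

Section power_means.
Context (X : NormedModule C_AbsRing).

(** Jensen's inequality for the power [p]: Bernoulli's inequality is applied to [a / m], with [m]
    the mean, and averaging removes the linear term. *)
Lemma rademacher_mean_norm (p : R) N (y : 'I_N -> X) : 1 <= p ->
  rademacher_mean (fun e => norm (signed_sum y e)) <= rademacher_norm p y.
Proof.
move=> p1; set m := rademacher_mean _.
have m0 : 0 <= m.
  have -> : 0 = rademacher_mean (fun e : {ffun 'I_N -> bool} => 0 + 0 * 0).
    by rewrite rademacher_mean_affine; ring.
  apply: rademacher_mean_le => e; have := norm_ge_0 (signed_sum y e); lra.
case: m0 => [m0|<-]; last exact: powR_nonneg.
have p0 : 0 < p by lra.
rewrite -(@powR_inv m p) //; last lra.
apply: powR_mono; first by apply: Rlt_le; exact: Rinv_0_lt_compat.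
split; first exact: powR_nonneg.
pose Q : R := powR m p; have Q0 : 0 <= Q by exact: powR_nonneg.
rewrite -/Q (_ : Q = rademacher_mean (fun e => Q * (1 - p) + (Q * p / m) * norm (signed_sum y e))); last first.
  by rewrite rademacher_mean_affine -/m; field; lra.
apply: rademacher_mean_le => e; set a := norm _.
have a0 : 0 <= a by exact: norm_ge_0.
have am0 : 0 <= a / m by apply: Rdiv_le_0_compat.
have e1 : m * (a / m) = a by field; lra.
rewrite -[X in _ <= powR X p]e1 powR_mult //; last lra.
apply: Rle_trans (Rmult_le_compat_l Q _ _ Q0 (powR_bernoulli p1 am0)).
by apply: Req_le; field; lra.
Qed.

Lemma rademacher_norm_le (r B : R) N (y : 'I_N -> X) : 0 < r ->
  (forall e, norm (signed_sum y e) <= B) -> rademacher_norm r y <= B.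
Proof.
move=> r0 hB.
have B0 : 0 <= B by apply: Rle_trans (hB [ffun=> true]); exact: norm_ge_0.
rewrite -[X in _ <= X](@powR_inv B r) //; apply: powR_mono.
  by apply: Rlt_le; exact: Rinv_0_lt_compat.
split.
  have -> : 0 = rademacher_mean (fun e : {ffun 'I_N -> bool} => 0 + 0 * 0).
    by rewrite rademacher_mean_affine; ring.
  apply: rademacher_mean_le => e; rewrite Rmult_0_l Rplus_0_l; exact: powR_nonneg.
pose Q : R := powR B r.
rewrite -/Q (_ : Q = rademacher_mean (fun e : {ffun 'I_N -> bool} => Q + 0 * 0)); last first.
  by rewrite rademacher_mean_affine; ring.
apply: rademacher_mean_le => e; rewrite Rmult_0_l Rplus_0_r.
by apply: powR_mono; [lra|split; [exact: norm_ge_0|exact: hB]].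
Qed.

Lemma lp_norm_powR (p : R) N (y : 'I_N -> X) : 0 < p ->
  powR (lp_norm p y) p = \big[Rplus/0]_(i < N) powR (norm (y i)) p.
Proof. by move=> p0; apply: powR_inv_r => //; apply: big_Rge0 => i; exact: powR_nonneg. Qed.

Lemma type_mean (p : R) : 1 <= p -> has_type X p -> exists2 tau, 0 < tau &
  forall N (y : 'I_N -> X) a K, 0 <= K -> 0 <= a ->
    a <= K * rademacher_mean (fun e => norm (signed_sum y e)) ->
    powR a p <= powR (Rmult K tau) p * \big[Rplus/0]_(i < N) powR (norm (y i)) p.
Proof.
move=> p1 [tau htau]; exists (Rmax tau 1); first by apply: Rlt_le_trans (Rmax_r _ _); lra.
move=> N y a K K0 a0 ha; have p0 : 0 < p by lra.
have t0 : 0 <= Rmax tau 1 by apply: Rle_trans (Rmax_r _ _); lra.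
have l0 : 0 <= lp_norm p y by exact: powR_nonneg.
rewrite -lp_norm_powR // -powR_mult //; last exact: Rmult_le_pos.
apply: powR_mono; first lra.
split=> //; apply: Rle_trans ha _; rewrite Rmult_assoc; apply: Rmult_le_compat_l => //.
apply: Rle_trans (rademacher_mean_norm y p1) _; apply: Rle_trans (htau N y) _.
by apply: Rmult_le_compat_r => //; exact: Rmax_l.
Qed.

Lemma cotype_sum (r : R) : 0 < r -> has_cotype X r%:E -> exists2 c, 0 <= c &
  forall N (y : 'I_N -> X) B, (forall e, norm (signed_sum y e) <= B) ->
    \big[Rplus/0]_(i < N) powR (norm (y i)) r <= powR (Rmult c B) r.
Proof.
move=> r0 [c hc]; exists (Rmax c 0); first exact: Rmax_r.
move=> N y B hB; rewrite -lp_norm_powR //; apply: powR_mono; first lra.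
split; first exact: powR_nonneg.
apply: Rle_trans (hc N y) _; apply: Rle_trans (_ : Rmax c 0 * rademacher_norm r y <= _).
  by apply: Rmult_le_compat_r (Rmax_l _ _); exact: powR_nonneg.
by apply: Rmult_le_compat_l; [exact: Rmax_r|exact: rademacher_norm_le].
Qed.

End power_means.

(** The integral over a long interval is the integral over one step of the sum over all translates.
    In this way estimates for sums, uniform in the starting point, become estimates for
    integrals. *)
Lemma RInt_steps (G : R -> R) s0 l n : (forall s, continuous G s) ->
  is_RInt (fun s => \big[Rplus/0]_(i < n) G (s + s0 + INR i * l)) 0 l
    (RInt G s0 (s0 + INR n * l)).
Proof.
move=> hG.
have hI a b : ex_RInt G a b by apply: ex_RInt_continuous => s _; exact: hG.
elim: n => [|n IH].
  rewrite /= Rmult_0_l Rplus_0_r RInt_point.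
  apply: (is_RInt_ext (fun=> 0)); first by move=> s _; rewrite big_ord0.
  by have := @is_RInt_const R_NormedModule 0 l 0; rewrite scal_zero_r.
rewrite -(RInt_Chasles G s0 (s0 + INR n * l)) //.
apply: (is_RInt_ext (fun s => plus (\big[Rplus/0]_(i < n) G (s + s0 + INR i * l)) (G (s + s0 + INR n * l)))).
  by move=> s _; rewrite big_ord_recr.
apply: is_RInt_plus => //.
have h := RInt_correct _ _ _ (hI (s0 + INR n * l) (s0 + INR n.+1 * l)).
have := @is_RInt_comp_lin _ G 1 (s0 + INR n * l) 0 l (RInt G (s0 + INR n * l) (s0 + INR n.+1 * l)).
rewrite (_ : 1 * 0 + (s0 + INR n * l) = s0 + INR n * l); last by ring.
rewrite (_ : 1 * l + (s0 + INR n * l) = s0 + INR n.+1 * l); last by rewrite S_INR; ring.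
move/(_ h); apply: is_RInt_ext => s _; rewrite scal_one; congr G; ring.
Qed.

(** * From sums to norms with respect to dt/t *)

Section Lq_estimates.
Import Order.TTheory GRing.Theory Num.Theory.
Context (X : NormedModule C_AbsRing) (F : R -> X).
Context (Fc : forall t, 0 < t -> continuity_pt (fun u => norm (F u)) t).
Local Notation haar := (@dt_over_t R : measure (measurableTypeR R) R).
Local Notation g r := (fun t => powR (norm (F t)) r).

Let g0 r t : 0 < t -> 0 <= g r t. Proof. by move=> _; exact: powR_nonneg. Qed.

Let gc r : 0 < r -> forall t, 0 < t -> continuity_pt (g r) t.
Proof. by move=> r0 t t0; apply: powR_continuous => // [u|]; [exact: norm_ge_0|exact: Fc]. Qed.

Let Gc r : 0 < r -> forall s, continuous (fun s => g r (exp s)) s.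
Proof.
move=> r0 s; apply: (continuous_comp exp (g r)); first exact: continuous_exp.
by apply/continuity_pt_filterlim; apply: gc => //; exact: exp_pos.
Qed.

Lemma Lq_dt_over_tE r : 0 < r -> Lq_dt_over_t r%:E F =
  poweR (\int[haar]_t (if Rlt_dec 0 t then g r t else 0)%:E)%E (/ r).
Proof.
move=> r0; rewrite /Lq_dt_over_t unlock; congr poweR.
apply: eq_integral => t _; case: Rlt_dec => ht /=.
  by rewrite ger0_norm //; apply/RleP; exact: norm_ge_0.
by rewrite normr0 powR_zero.
Qed.

Lemma Lq_le r B : 0 < r -> 0 <= B ->
  (forall n s, \big[Rplus/0]_(i < n) g r (exp (s + INR i * 1)) <= powR B r) ->
  (Lq_dt_over_t r%:E F <= B%:E)%E.
Proof.
move=> r0 B0 hB; rewrite Lq_dt_over_tE //.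
have : (\int[haar]_t (if Rlt_dec 0 t then g r t else 0)%:E <= (powR B r)%:E)%E.
  apply: (integral_le_RInt (@g0 r) (gc r0)) => N.
  have := @RInt_steps _ (- INR N) 1 (N + N)%nat (Gc r0).
  rewrite (_ : - INR N + INR (N + N) * 1 = INR N); last first.
    by rewrite -[INR (N + N)]/(INR (N + N)%coq_nat) plus_INR; ring.
  set v := RInt _ _ _ => hv.
  have hc := @is_RInt_const R_NormedModule 0 1 (powR B r).
  have := is_RInt_le _ _ _ _ _ _ Rle_0_1 hv hc.
  rewrite /scal /= /mult /= => /(_ _) k.
  apply: Rle_trans (k _) _; last by apply: Req_le; ring.
  by move=> s _; have := hB (N + N)%nat (s + - INR N).
set J := (\int[haar]_t _)%E => hJ.
have J0 : (0 <= J)%E by apply: integral_ge0 => t _; exact: pos_extension_ge0 (@g0 r) t.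
apply: (@le_trans _ _ (poweR (powR B r)%:E (/ r))); last first.
  by rewrite poweR_EFin powR_inv.
apply: gt0_ler_poweR => //.
- by apply/RleP; apply: Rlt_le; exact: Rinv_0_lt_compat.
- by rewrite in_itv /= J0 leey.
- by rewrite in_itv /= lee_fin leey andbT; apply/RleP; exact: powR_nonneg.
Qed.

Lemma Lq_ge r l c T n : 0 < r -> 0 < l -> 0 <= c ->
  (forall s, 0 <= s <= l -> c <= \big[Rplus/0]_(i < n) g r (exp (s - T + INR i * l))) ->
  ((powR (Rmult l c) (/ r))%:E <= Lq_dt_over_t r%:E F)%E.
Proof.
move=> r0 l0 c0 hc; rewrite Lq_dt_over_tE //.
have ab : - T <= - T + INR n * l.
  by have := Rmult_le_pos _ _ (pos_INR n) (Rlt_le _ _ l0); lra.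
have := RInt_le_integral (@g0 r) (gc r0) ab.
set J := (\int[haar]_t _)%E => hJ.
have hv := @RInt_steps _ (- T) l n (Gc r0).
have hk := @is_RInt_const R_NormedModule 0 l c.
have := is_RInt_le _ _ _ _ _ _ (Rlt_le _ _ l0) hk hv.
rewrite /scal /= /mult /= Rminus_0_r => /(_ _) k.
have {}k : l * c <= RInt (fun s => g r (exp s)) (- T) (- T + INR n * l).
  by apply: k => s hs; apply: hc; lra.
have lc0 : 0 <= l * c by apply: Rmult_le_pos; lra.
rewrite -poweR_EFin; apply: gt0_ler_poweR.
- by apply/RleP; apply: Rlt_le; exact: Rinv_0_lt_compat.
- by rewrite in_itv /= lee_fin leey andbT; apply/RleP.
- rewrite in_itv /= leey andbT; apply: integral_ge0 => t _; exact: pos_extension_ge0 (@g0 r) t.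
- by apply: le_trans hJ; rewrite lee_fin; apply/RleP.
Qed.

Lemma Loo_le B : 0 <= B -> (forall t, 0 < t -> norm (F t) <= B) ->
  (Lq_dt_over_t +oo%E F <= B%:E)%E.
Proof.
(* The norm for [+oo] is defined by cases on the measure of the whole space, with value 0 in the
   second case. *)
move=> B0 hB; rewrite /Lq_dt_over_t unlock; case: ifP => _; last by rewrite lee_fin; apply/RleP.
apply/ess_supP; apply: nearW => t /=; rewrite lee_fin; apply/RleP.
case: Rlt_dec => ht; last by rewrite normr0.
rewrite ger0_norm; first exact: hB.
by apply/RleP; exact: norm_ge_0.
Qed.

End Lq_estimates.

(** * Strong measurability of continuous orbits *)

Section strong_measurability.
Local Open Scope classical_set_scope.
Import Order.TTheory GRing.Theory Num.Theory.
Context (X : NormedModule C_AbsRing) (F : R -> X).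

(** A grid of mesh [1 / (n + 1)] on [(0, n + 1)]. Indices are shifted by one so that 0 stands for
    the points off the grid, and [cell_value] evaluates at the right end of a cell, which is
    positive even for the first one. *)
Let cell (n : nat) (t : R) : nat :=
  if Rlt_dec 0 t then if Rlt_dec t (INR n.+1) then (Num.truncn (t * INR n.+1)%R).+1 else 0%nat else 0%nat.

Let cell_value (n k : nat) : X := if k is k'.+1 then F (INR k / INR n.+1) else zero.

Let truncn_spec (u : R) : 0 <= u -> INR (Num.truncn u) <= u < INR (Num.truncn u) + 1.
Proof.
move=> u0; have /andP[/RleP h1 /RltP h2] := @truncn_itv R u ltac:(exact/RleP).
by rewrite -S_INR !INRE.
Qed.

Let truncn_eq (u : R) k : INR k <= u < INR k + 1 -> Num.truncn u = k.
Proof.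
move=> [h1 h2]; apply/truncn_def; apply/andP; split; first by rewrite -INRE; apply/RleP.
by rewrite -INRE; apply/RltP; rewrite S_INR.
Qed.

Lemma strongly_measurable_of_continuous :
  (forall t, 0 < t -> forall eta, 0 < eta -> exists2 d, 0 < d &
     forall t', 0 < t' -> Rabs (t' - t) < d -> norm (minus (F t') (F t)) < eta) ->
  strongly_measurable_Rplus F.
Proof.
move=> hF; exists (fun n t => cell_value n (cell n t)); split => [n|t t0].
  have n0 : 0 < INR n.+1 by rewrite S_INR; have := pos_INR n; lra.
  have mcell k : measurable (cell n @^-1` [set k] : set (measurableTypeR R)).
    have mI : measurable ([set` Interval (BRight 0) (BLeft (INR n.+1))] : set (measurableTypeR R)) by exact: measurable_itv.
    have inI t : ([set` Interval (BRight 0) (BLeft (INR n.+1))] : set R) t <-> 0 < t < INR n.+1.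
      rewrite /= in_itv /=; split; first by case/andP => /RltP h1 /RltP h2.
      by case=> h1 h2; apply/andP; split; exact/RltP.
    case: k => [|k].
      rewrite (_ : _ @^-1` _ = ~` ([set` Interval (BRight 0) (BLeft (INR n.+1))] : set R)); first exact: measurableC.
      apply/seteqP; split => t; rewrite /preimage /cell /=.
        by move=> h /inI [h1 h2]; move: h; case: Rlt_dec => //; case: Rlt_dec.
      move=> h; case: Rlt_dec => h1 //; case: Rlt_dec => h2 //.
      by case: h; apply/inI.
    pose x := INR k / INR n.+1; pose y := INR k.+1 / INR n.+1.
    have e t : (x <= t < y) <-> (INR k <= t * INR n.+1 < INR k + 1).
      rewrite -S_INR /x /y; split; first by case=> /(Rle_div_l _ _ _ n0) ? /(Rlt_div_r _ _ _ n0).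
      by case=> h1 h2; split; [apply/(Rle_div_l _ _ _ n0)|apply/(Rlt_div_r _ _ _ n0)].
    rewrite (_ : _ @^-1` _ = [set` Interval (BLeft x) (BLeft y)] `&` [set` Interval (BRight 0) (BLeft (INR n.+1))]).
      by apply: measurableI => //; exact: measurable_itv.
    apply/seteqP; split => t; rewrite /preimage /cell /=.
      case: Rlt_dec => [h1|_ //]; case: Rlt_dec => [h2|_ //] [h3].
      split; last by apply/inI.
      apply/in_Ico/e; rewrite -h3; apply: truncn_spec.
      by apply: Rmult_le_pos; lra.
    move=> [/in_Ico /e h1 /inI [h2 h3]] /=.
    by case: Rlt_dec => //= _; case: Rlt_dec => //= _; rewrite (truncn_eq h1).
  split.
    apply: (@sub_finite_set _ _ (cell_value n @` [set k | (k < (Num.truncn (INR n.+1 * INR n.+1)%R).+3)%nat])).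
      move=> _ [t _ <-]; exists (cell n t) => //=.
      rewrite /cell; case: Rlt_dec => //= h1; case: Rlt_dec => //= h2.
      rewrite ltnS ltnS; apply: leqW; apply: le_truncn; apply/RleP.
      by apply: Rmult_le_compat_r; lra.
    by apply: finite_image; exact: finite_II.
  move=> y; rewrite (_ : _ @^-1` _ = \bigcup_(k in [set k | cell_value n k = y]) (cell n @^-1` [set k])).
    by apply: bigcup_measurable => k _; exact: mcell.
  apply/seteqP; split => t /=; first by move=> h; exists (cell n t).
  by move=> [k /= hk hc]; rewrite hc.
apply/filterlim_locally => eps.
have [d d0 hd] := hF t t0 eps (cond_pos eps).
(* For [n >= N] this gives [n + 1 > t + 1 / d], so that [t] lies on the grid and the mesh is below
   [d]. *)
have [N hN] := nfloor_ex (t + / d) ltac:(by have := Rinv_0_lt_compat _ d0; lra).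
exists N => n hn.
have hn' : INR N <= INR n by exact: le_INR.
have tn : t + / d < INR n.+1 by rewrite S_INR; lra.
have id0 := Rinv_0_lt_compat _ d0.
have n0 : 0 < INR n.+1 by lra.
rewrite /cell; case: Rlt_dec => [h1|h1]; last lra.
case: Rlt_dec => [h2|h2]; last lra.
have := truncn_spec (u := t * INR n.+1) ltac:(apply: Rmult_le_pos; lra).
set k := Num.truncn _ => hk.
apply: norm_compat1; rewrite -[cell_value _ _]/(F (INR k.+1 / INR n.+1)); apply: hd.
  by apply: Rdiv_lt_0_compat => //; rewrite S_INR; have := pos_INR k; lra.
have -> : INR k.+1 / INR n.+1 - t = (INR k + 1 - t * INR n.+1) / INR n.+1.
  by rewrite S_INR; field; lra.
rewrite Rabs_pos_eq; last by apply: Rdiv_le_0_compat; lra.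
apply: (Rle_lt_trans _ (/ INR n.+1)).
  rewrite -[X in _ <= X]Rmult_1_l; apply: Rmult_le_compat_r; last lra.
  by apply: Rlt_le; exact: Rinv_0_lt_compat.
rewrite -[d]Rinv_inv; apply: Rinv_lt_contravar; last lra.
exact: Rmult_lt_0_compat.
Qed.

End strong_measurability.

(** * The two square function estimates *)

Section square_functions.
Context (X : CompleteNormedModule C_AbsRing) (A : operator X).
Context (omega sigma nu phi : R) (hA : sectorial A omega).
Context (hnu : omega < nu < sigma) (hsigma : sigma < phi) (hphi : phi < PI).
Context (M : R) (M0 : 0 <= M)
  (hM : forall z, outside nu z -> is_resolvent A z (resolvent A z) /\
    forall x, Cmod z * norm (resolvent A z x) <= M * norm x).
Context (Kc : R) (Kc0 : 0 <= Kc)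
  (hK : forall v eps K B x y, holo_decay sigma eps K v ->
    (forall z, sector sigma z -> Cmod (v z) <= B) -> is_dunford A nu v x y ->
    norm y <= Kc * B * norm x).
Context (eps Kf : R) (f : C -> C) (hf : holo_decay phi eps Kf f).
Local Notation orbit := (calc_orbit A nu f).

Lemma orbit_ln_continuous x t : 0 < t -> forall eta, 0 < eta -> exists2 d, 0 < d &
  forall t', 0 < t' -> Rabs (t' - t) < d -> norm (minus (orbit (ln t') x) (orbit (ln t) x)) < eta.
Proof.
move=> t0 eta eta0.
have [d1 d10 h1] := orbit_continuous hA hnu hsigma hphi Kc0 hK hf (ln t) x eta0.
have [d h2] := continuous_ln t t0 _ (locally_ball (ln t) (mkposreal d1 d10)).
exists d; first exact: cond_pos.
by move=> t' _ ht; apply: h1; exact: h2.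
Qed.

Lemma orbit_ln_norm_continuous x t : 0 < t ->
  continuity_pt (fun u => norm (orbit (ln u) x)) t.
Proof.
move=> t0 eta eta0; have [d d0 hd] := orbit_ln_continuous x t0 eta0.
exists (Rmin d t); split; first exact: Rmin_pos.
move=> u [_]; rewrite /= /R_dist => hu.
have [u1 u2] : Rabs (u - t) < d /\ Rabs (u - t) < t by move: hu; rewrite /Rmin; case: Rle_dec; lra.
have u0 : 0 < u by have := Rabs_def2 _ _ u2; lra.
have k := hd u u0 u1.
have k1 := norm_le_minus (orbit (ln u) x) (orbit (ln t) x).
have k2 := norm_le_minus (orbit (ln t) x) (orbit (ln u) x).
rewrite norm_minus_sym in k1.
have k3 := norm_minus_sym (orbit (ln t) x) (orbit (ln u) x).
apply: Rabs_def1; norm_lra.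
Qed.

Lemma square_function_upper (q : \bar R) : (2%:E <= q)%E -> has_cotype X q ->
  exists2 K, 0 <= K & forall x,
    (Lq_dt_over_t q (fun t => orbit (ln t) x) <= (Rmult K (norm x))%:E)%E.
Proof.
have [K K0 hb] := orbit_sum_bound hA hnu hsigma hphi Kc0 hK hf.
case: q => [r|_ _|//].
  rewrite lee_fin => /RleP h2 hq; have r2 : 2 <= r by exact: h2.
  have r0 : 0 < r by lra.
  have [c c0 hc] := cotype_sum r0 hq.
  exists (c * K); first exact: Rmult_le_pos.
  move=> x; have nx := norm_ge_0 x.
  have cK : 0 <= c * K by exact: Rmult_le_pos.
  apply: Lq_le => //.
  - by move=> t; exact: orbit_ln_norm_continuous.
  - exact: Rmult_le_pos.
  move=> n s.
  apply: (Rle_trans _ (\big[Rplus/0]_(i < n) powR (norm (orbit (s + INR i * 1) x)) r)).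
    by apply: Req_le; apply: eq_bigr => i _; rewrite ln_exp.
  rewrite Rmult_assoc; apply: hc => e; rewrite signed_sumE; apply: hb => i.
  by rewrite rademacher_sign_abs; lra.
exists K => // x; have nx := norm_ge_0 x.
apply: Loo_le; first exact: Rmult_le_pos.
(* For [q = +oo] a sum with one term and multiplier 1 is enough: it bounds [f(tA) x] for each
   [t]. *)
move=> t _; have := hb 1%nat (fun=> 1) (ln t) x ltac:(by move=> i; rewrite Rabs_R1; lra).
rewrite big_ord_recl big_ord0 plus_zero_r /= (_ : ln t + 0 * 1 = ln t); last by ring.
by rewrite (scal_one (calc_orbit A nu f (ln t) x)).
Qed.

Lemma square_function_lower z0 (p : R) : sector phi z0 -> f z0 <> RtoC 0 ->
  1 <= p -> has_type X p ->
  exists2 K, 0 <= K & forall x,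
    ((norm x)%:E <= K%:E * Lq_dt_over_t p%:E (fun t => orbit (ln t) x))%E.
Proof.
move=> hz0 fz0 p1 hX; have p0 : 0 < p by lra.
have [l [K [[l0 l1] K0 hlow]]] := orbit_lower hA hnu hsigma hphi M0 hM Kc0 hK hf hz0 fz0.
have [tau t0 htau] := type_mean p1 hX.
(* The 1 makes [D] positive even if [K = 0], since [a] is divided by it. *)
pose D := K * tau + 1; have D0 : 0 < D.
  by rewrite /D; have := Rmult_le_pos _ _ K0 (Rlt_le _ _ t0); lra.
pose l' : R := powR l (/ p); have l'0 : 0 < l' by rewrite /l' powR_exp //; exact: exp_pos.
pose K' := 4 * D / l'; have K'0 : 0 <= K' by apply: Rdiv_le_0_compat; lra.
exists K' => // x; set F := fun t => _.
have nx := norm_ge_0 x; pose a := norm x / 4.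
have aD : 0 <= a / D by apply: Rdiv_le_0_compat => //; rewrite /a; lra.
(* The case [x = 0] is separate because the margin [|x| / 4] used below must be positive; with it,
   [|x| / 2] minus the margin is [a]. *)
case: nx => [nx|nx]; last first.
  rewrite -nx; apply: mule_ge0; first by rewrite lee_fin; apply/RleP.
  exact: Lnorm_ge0.
have [n [T hs]] := hlow x a ltac:(rewrite /a; lra).
pose b := a / D; rewrite -/b in aD.
have key : ((Rmult l' b)%:E <= Lq_dt_over_t p%:E F)%E.
  have -> : Rmult l' b = powR (Rmult l (powR b p)) (/ p).
    by rewrite powR_mult ?powR_inv //; [lra|exact: powR_nonneg].
  apply: (@Lq_ge X F _ p l _ T n) => //.
  - by move=> t; exact: orbit_ln_norm_continuous.
  - exact: powR_nonneg.
  move=> s hsl; have := hs s hsl.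
  pose y (i : 'I_n) := orbit (s - T + INR i * l) x.
  set m := rademacher_mean _ => hm.
  have hm' : a <= K * m by move: hm; rewrite /a; lra.
  pose S := \big[Rplus/0]_(i < n) powR (norm (y i)) p.
  have hS : powR a p <= powR (Rmult K tau) p * S by apply: (htau n y a K) => //; rewrite /a; lra.
  rewrite (_ : a = Rmult D b) in hS; last by rewrite /b; field; lra.
  rewrite powR_mult in hS; [|lra|exact: aD].
  have -> : \big[Rplus/0]_(i < n) powR (norm (F (exp (s - T + INR i * l)))) p = S.
    by apply: eq_bigr => i _; rewrite /F ln_exp.
  have S0 : 0 <= S by apply: big_Rge0 => i; exact: powR_nonneg.
  have DK : powR (Rmult K tau) p <= powR D p.
    by apply: powR_mono; [lra|split; [apply: Rmult_le_pos; lra|rewrite /D; lra]].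
  have Dp : 0 < powR D p by rewrite powR_exp //; exact: exp_pos.
  apply: (Rmult_le_reg_l (powR D p)) => //.
  by apply: Rle_trans hS _; exact: Rmult_le_compat_r.
have -> : (norm x)%:E = (K'%:E * (Rmult l' b)%:E)%E.
  rewrite -EFinM; congr EFin; rewrite -[RHS]/(Rmult K' (Rmult l' b)) /K' /b /a; field.
  by split; lra.
by apply: lee_wpmul2l => //; rewrite lee_fin; apply/RleP.
Qed.

End square_functions.

Theorem proposition5p1 (X : CompleteNormedModule C_AbsRing)
    (p : R) (hp : 1 <= p <= 2) (hX : has_type X p)
    (q : \bar R) (hq : (2%:E <= q)%E) (hX' : has_cotype X q)
    (phi : R) (hphi : 0 < phi < PI)
    (A : operator X)
    (hA : exists2 sigma : R, sigma < phi & bounded_Hinf_calculus A sigma)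
    (f : C -> C) (hf : Hinf0 phi f)
    (hf0 : exists2 z : C, sector phi z & f z <> RtoC 0) :
  exists K : R, forall nu : R, dunford_angle A phi nu -> forall x : X,
    let fA : R -> X := fun t => dunford A nu (fun z => f (Cmult (RtoC t) z)) x in
    strongly_measurable_Rplus fA /\
    (Lq_dt_over_t q fA <= K%:E * (norm x)%:E)%E /\
    ((Lq_dt_over_t p%:E fA < +oo)%E ->
       ((norm x)%:E <= K%:E * Lq_dt_over_t p%:E fA)%E).
Proof.
have [sigma hsigma [nu0 [hnu0s [omega0 homega0 hA0]] [K0 hK0]]] := hA.
have [ho00 _] := hA0.
have [phi0 phiPI] := hphi; have [p1 _] := hp.
have hnu : omega0 < nu0 < sigma by split.
have sPI : sigma < PI by lra.
have hK := calculus_bound hA0 hnu sPI hK0.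
have [M M0 hM] := sectorial_resolvent_bound hA0 (nu := nu0) ltac:(lra).
have [eps hfd] := Hinf0_holo_decay hf.
have [z0 hz0 fz0] := hf0.
have [Ku Ku0 hu] := square_function_upper hA0 hnu hsigma phiPI (Rmax_r K0 0) hK hfd hq hX'.
have [Kl Kl0 hl] := square_function_lower hA0 hnu hsigma phiPI M0 hM (Rmax_r K0 0) hK hfd hz0 fz0 p1 hX.
exists (Rmax Ku Kl) => nu [hnuphi [omega homega hAo]] x fA.
pose F t := calc_orbit A nu0 f (ln t) x.
have eF t : 0 < t -> fA t = F t.
  move=> t0; have [ho _] := hAo.
  (* The smaller of the two sectoriality angles lies below both contour angles, so both contours
     belong to one calculus. *)
  have [om hom [h1 h2]] : exists2 om, sectorial A om & om < nu /\ om < nu0.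
    case: (Rle_lt_dec omega omega0) => h; first by exists omega => //; lra.
    by exists omega0 => //; lra.
  rewrite /F /calc_orbit /dilate exp_ln // /fA.
  apply: (dunford_rotate hom x phiPI h1 h2) => //; first lra.
  exact: holo_decay_dilate hphi t0 hfd.
(* The two functions agree only for [t > 0], which suffices as [Lq_dt_over_t] replaces the other
   values by 0. *)
have eL r : Lq_dt_over_t r fA = Lq_dt_over_t r F.
  congr Lnorm; apply: functional_extensionality => t.
  by case: Rlt_dec => // t0; rewrite eF.
have nx : (0 <= (norm x)%:E)%E by rewrite lee_fin; apply/RleP; exact: norm_ge_0.
split; [|split].
- have [s [h1 h2]] := strongly_measurable_of_continuous
    (orbit_ln_continuous hA0 hnu hsigma phiPI (Rmax_r K0 0) hK hfd x).
  by exists s; split => // t t0; rewrite eF //; exact: h2.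
- rewrite eL; apply: Order.POrderTheory.le_trans (hu x) _; rewrite EFinM.
  by apply: lee_wpmul2r => //; rewrite lee_fin; apply/RleP; exact: Rmax_l.
- move=> _; rewrite eL; apply: Order.POrderTheory.le_trans (hl x) _.
  apply: lee_wpmul2r; first exact: Lnorm_ge0.
  by rewrite lee_fin; apply/RleP; exact: Rmax_r.
Qed.
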